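(* Let $\alpha\in(0,1)$, $T>0$, $b>0$, and let $s:[0,T]\to\mathbb{R}$ be continuous with $s(0)=b$, differentiable on $(0,T]$ with $\dot s\ge 0$, and such that $t\mapsto t^{1-\alpha}\dot s(t)$ belongs to $C([0,T])$ (i.e. it is continuous on $(0,T]$ and extends continuously to $t=0$). Let $Q_{s,T}=\{(x,t): 0<x<s(t),\ 0<t<T\}$. If $f\in L^2(Q_{s,T})$, $h\in C^1([0,T])$ and $u_0\in L^2(0,b)$, then there exists a weak solution $u$ (in the sense defined in the context) of the problem $$\begin{cases} D^\alpha_s u(x,t)=u_{xx}(x,t)+f(x,t), & 0<x<s(t),\ 0<t<T,\\ -u_x(0,t)=h(t), & 0<t<T,\\ u(s(t),t)=0, & 0<t<T,\\ u(x,0)=u_0(x), & 0<x<b.\end{cases}$$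
   Context: Convention for $s^{-1}$: for $x\in[0,b]$ put $s^{-1}(x)=0$; for $x\in(b,s(T)]$ put $s^{-1}(x)=\max\{t: s(t)=x\}$. $D^\alpha_s$ is the Caputo derivative on the non-cylindrical domain: $D^\alpha_s w(x,t)=\frac{1}{\Gamma(1-\alpha)}\int_{s^{-1}(x)}^t (t-\tau)^{-\alpha}w_t(x,\tau)\,d\tau$ (lower limit $0$ if $x\le b$). Fractional integrals: $I^{1-\alpha}_s w(x,t)=\frac{1}{\Gamma(1-\alpha)}\int_{s^{-1}(x)}^t (t-\tau)^{-\alpha}w(x,\tau)\,d\tau$ for functions on $Q_{s,T}$ (lower limit $0$ if $x\le b$), and $I^{1-\alpha}w(x,t)=\frac{1}{\Gamma(1-\alpha)}\int_0^t(t-\tau)^{-\alpha}w(x,\tau)\,d\tau$ for functions on $(0,s(T))\times(0,T)$. A tilde denotes extension by zero: $\tilde u_0$ is the extension of $u_0$ by zero to $(0,s(T))$, $\tilde u$ is the extension of $u$ by zero from $Q_{s,T}$ to $(0,s(T))\times(0,T)$. Definition (weak solution). Let $f\in L^2(Q_{s,T})$, $h\in C^1([0,T])$, $u_0\in L^2(0,b)$. A function $u$ is a weak solution of the problem if $u,u_x\in L^2(Q_{s,T})$, $I^{1-\alpha}\tilde u\in L^\infty(0,T;L^2(0,s(T)))$, and $$-\int_{Q_{s,T}} I^{1-\alpha}_s[u(x,t)-\tilde u_0(x)]\,\varphi_t(x,t)\,dx\,dt+\int_{Q_{s,T}}u_x\varphi_x\,dx\,dt=\int_0^T h(t)\varphi(0,t)\,dt+\int_{Q_{s,T}}f\varphi\,dx\,dt$$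 for all $\varphi\in C^1(\overline{Q_{s,T}})$ such that $\varphi(x,T)=0$ for $x\in[0,s(T)]$ and $\varphi(s(t),t)=0$ for $t\in[0,T]$. *)

(* Defs.v *)
From mathcomp Require Import all_boot all_order all_algebra.
From mathcomp Require Import all_classical all_reals all_analysis ess_sup_inf.
Set Implicit Arguments.
Unset Strict Implicit.
Unset Printing Implicit Defensive.

Import Order.TTheory GRing.Theory Num.Theory.
Import numFieldNormedType.Exports.

Local Open Scope classical_set_scope.
Local Open Scope ring_scope.

(* Points of the plane are pairs (x, t): space first, time second.
   Functions on a subset of R or R * R are total functions whose values
   outside of the subset are irrelevant; [w \_ A] is the extension by zero
   from A. *)

Notation mu1 R := (@lebesgue_measure R).

Notation mu2 R := (@lebesgue_measure R \x @lebesgue_measure R)%E.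

Notation dir_x R := ((1, 0) : R * R).
Notation dir_t R := ((0, 1) : R * R).

Definition Gamma (R : realType) (z : R) : R :=
  \int[mu1 R]_(x in `]0, +oo[) (x `^ (z - 1) * expR (- x)).

Definition L2 d (X : measurableType d) (R : realType)
    (mu : {measure set X -> \bar R}) (A : set X) (f : X -> R) : Prop :=
  (f \_ A) \in Lfun mu 2%:E.

(* L^oo(0,T; L^2(0,l)): [w] is jointly measurable on (0,l) x (0,T) and
   t |-> ||w(., t)||_{L^2(0,l)} is essentially bounded on (0,T). *)
Definition LinftyL2 (R : realType) (l T : R) (w : R * R -> R) : Prop :=
  let rect := [set p : R * R | 0 < p.1 < l /\ 0 < p.2 < T] in
  measurable_fun (rect : set (measurableTypeR R * measurableTypeR R)) w /\
  (ess_sup (mu1 R)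
     (fun t : R => Lnorm (mu1 R) 2%:E (fun x : R => ((w \_ rect) (x, t))%:E))
   < +oo)%E.

(* Derivative relative to A: two-sided at interior points of an interval A,
   one-sided at its endpoints. *)
Definition is_derive_within (R : realType) (A : set R) (f : R -> R) (t df : R) :
    Prop :=
  (f y - f t) / (y - t) @[y --> within A t^'] --> df.

Definition C1_segment (R : realType) (a c : R) (f : R -> R) : Prop :=
  exists df : R -> R,
    (forall t, t \in `[a, c] -> is_derive_within `[a, c] f t (df t)) /\
    {within `[a, c], continuous df}.

(* C^1 of the closure of an open set U: the partial derivatives exist in U
   and extend continuously to the closure of U. *)
Definition C1_closure (R : realType) (U : set (R * R)) (phi : R * R -> R) :
    Prop :=
  {within closure U, continuous phi} /\
  forall v, v = dir_x R \/ v = dir_t R ->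
    (forall p, U p -> derivable phi p v) /\
    exists g : R * R -> R,
      {within closure U, continuous g} /\ forall p, U p -> g p = 'D_v phi p.

(* All iterated directional derivatives exist and are differentiable. *)
Definition smooth (R : realType) (psi : R * R -> R) : Prop :=
  forall (vs : seq (R * R)) (p : R * R),
    differentiable (foldr (fun v g => 'D_v g) psi vs) p.

Definition test_function (R : realType) (U : set (R * R)) (psi : R * R -> R) :
    Prop :=
  smooth psi /\
  exists K : set (R * R), [/\ compact K, K `<=` U & forall p, ~ K p -> psi p = 0].

Definition weak_dx (R : realType) (U : set (R * R)) (u v : R * R -> R) : Prop :=
  forall psi, test_function U psi ->
    (\int[mu2 R]_(p in U) (u p * 'D_(dir_x R) psi p))
    = - (\int[mu2 R]_(p in U) (v p * psi p)).

Definition Qs (R : realType) (s : R -> R) (T : R) : set (R * R) :=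
  [set p | 0 < p.1 < s p.2 /\ 0 < p.2 < T].

(* s is continuous on [0, T], hence for x in (b, s(T)] the supremum below
   is a maximum. *)
Definition sinv (R : realType) (b T : R) (s : R -> R) (x : R) : R :=
  if x <= b then 0 else sup [set t | t \in `[0, T] /\ s t = x].

(* I^{1-alpha} with lower limit [lo x] *)
Definition frac_int (R : realType) (alpha : R) (lo : R -> R) (w : R * R -> R)
    (p : R * R) : R :=
  (Gamma (1 - alpha))^-1 *
  \int[mu1 R]_(tau in `]lo p.1, p.2[) ((p.2 - tau) `^ (- alpha) * w (p.1, tau)).

Definition I_s (R : realType) (alpha b T : R) (s : R -> R) :=
  frac_int alpha (sinv b T s).

Definition I_0 (R : realType) (alpha : R) := frac_int alpha (cst (0 : R)).

(* [u q] with q in Q is the only part of u used: (x, tau) is in Q whenever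
   (x, t) is in Q and sinv x < tau < t. *)
Definition weak_solution (R : realType) (alpha b T : R) (s : R -> R)
    (f : R * R -> R) (h u0 : R -> R) (u : R * R -> R) : Prop :=
  let Q := Qs s T in
  exists ux : R * R -> R,
  [/\ L2 (mu2 R) Q u,
      weak_dx Q u ux /\ L2 (mu2 R) Q ux,
      LinftyL2 (s T) T (I_0 alpha (u \_ Q)) &
      forall phi : R * R -> R,
        C1_closure Q phi ->
        (forall x, x \in `[0, s T] -> phi (x, T) = 0) ->
        (forall t, t \in `[0, T] -> phi (s t, t) = 0) ->
        - (\int[mu2 R]_(p in Q)
             (I_s alpha b T s (fun q => u q - (u0 \_ `]0, b[) q.1) p
              * 'D_(dir_t R) phi p))
        + (\int[mu2 R]_(p in Q) (ux p * 'D_(dir_x R) phi p))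
        = (\int[mu1 R]_(t in `]0, T[) (h t * phi (0, t)))
          + (\int[mu2 R]_(p in Q) (f p * phi p))].

(* Main.v *)
(* With k(r) = r^(-alpha), the equation is tested with phi divided by a weight m
   that drops from 2 to 1 at a time t0: pairing phi / m with the fractional
   derivative of phi controls the integral of phi^2 k(t0 - t), and pairing
   phi_x / m with phi_x controls the gradient.  If t0 nearly maximises the first
   quantity, it follows that every test function phi is matched by a pair (v, q)
   in a convex set K,
     K = {(v, q) : |q|_(L^2) <= C, and \int v^2 k(t - tau) <= C^2 for all t},
   whose pairing with phi bounds the data applied to phi.  By Hahn-Banach and
   Riesz the data are represented by some (u, p) in the bipolar of K.  The pairs
   (v, q) are orthogonal to all (psi_x, psi), since v psi_x + q psi is
   (phi psi)_x / m; adding these tests makes p the weak derivative of u.  Being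
   in the bipolar of K, u satisfies the same energy bound as v, and this bounds
   the fractional integral of u in L^oo(0, T; L^2) by Cauchy-Schwarz. *)
Require Import Defs.
From HB Require Import structures.
From mathcomp Require Import all_boot all_order all_algebra.
From mathcomp Require Import all_classical all_reals all_analysis.
From mathcomp Require Import measurable_realfun ess_sup_inf.
From mathcomp Require Import ring lra.
Set Implicit Arguments.
Unset Strict Implicit.
Unset Printing Implicit Defensive.

Import Order.TTheory GRing.Theory Num.Theory.
Import numFieldNormedType.Exports.

Local Open Scope classical_set_scope.
Local Open Scope ring_scope.

(* [R * R] with the product of the Borel sigma-algebras *)
Local Notation plane R := (measurableTypeR R * measurableTypeR R)%type.

(** * Hahn-Banach theorem and duality in L^2 *)

(** The weight depends on [t0] and [t0] on the test function, so the map from a test function to its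
    partner is not linear and no single coercive bilinear form is available for a Lax-Milgram
    argument; the support function of K takes its place. A weight dropping at one fixed time would
    give the energy bound at that time only, whereas L^oo in time asks for all of them. All time
    derivatives are moved to the test function, which vanishes at T. The adjoint is the right-sided
    Caputo derivative, written as a superposition of increments phi(x, t) - phi(x, t + r), and its
    coercivity reduces to a pointwise inequality between squares. Since s is nondecreasing, the
    points of Q above a given x form the interval (sinv x, T), up to the null line x = b, and the
    estimates in time are made on these slices. The zero extension of phi may jump at sinv x, and
    this jump contributes a term of the good sign. For x < b the term carries the singular weight
    t^(-alpha), and it is what absorbs the initial datum. *)

Section hahn_banach.
Context {R : realType} {V : lmodType R}.
Implicit Types (p q : V -> R) (S : set (V * R)).

Definition sublinear p :=
  (forall x y, p (x + y) <= p x + p y) /\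
  (forall (a : R) x, 0 <= a -> p (a *: x) = a * p x).

Lemma sublinear0 p : sublinear p -> p 0 = 0.
Proof. by move=> [_ /(_ 0 0 (lexx _))]; rewrite scale0r mul0r. Qed.

Lemma sublinear_oppr p x : sublinear p -> - p (- x) <= p x.
Proof.
move=> sp; have [pD _] := sp; have := pD x (- x).
by rewrite subrr (sublinear0 sp); lra.
Qed.

(* [q' z = inf_(y, l) (q (z + y) - l)] *)
Lemma sublinear_minorant q S : sublinear q -> S (0, 0) ->
  (forall u v, S u -> S v -> S (u.1 + v.1, u.2 + v.2)) ->
  (forall (a : R) u, 0 < a -> S u -> S (a *: u.1, a * u.2)) ->
  (forall u, S u -> u.2 <= q u.1) ->
  exists q', [/\ sublinear q', (forall x, q' x <= q x) &
    forall u, S u -> q' (- u.1) <= - u.2].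
Proof.
move=> sq S0 SD SZ Sq; have [qD qZ] := sq.
pose E z := [set q (z + u.1) - u.2 | u in S].
have E0 z : E z !=set0 by exists (q (z + 0) - 0); exists (0, 0).
have Elb z : lbound (E z) (- q (- z)).
  move=> _ [u Su <-]; have := Sq _ Su; have := qD (z + u.1) (- z).
  by rewrite addrAC subrr add0r; lra.
have El z : has_lbound (E z) by exists (- q (- z)).
have EI z u : S u -> inf (E z) <= q (z + u.1) - u.2.
  by move=> Su; apply: ge_inf => //; exists u.
have infZ a z : 0 < a -> inf (E (a *: z)) <= a * inf (E z).
  move=> a0; rewrite -ler_pdivrMl//; apply: lb_le_inf => // _ [u Su <-].
  rewrite ler_pdivrMl//.
  rewrite mulrBr -(qZ _ _ (ltW a0)) scalerDr.
  exact: (EI (a *: z) (a *: u.1, a * u.2) (SZ _ _ a0 Su)).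
exists (fun z => inf (E z)); split.
- split=> [x y|a x].
    rewrite -lerBlDr; apply: lb_le_inf => // _ [u Su <-].
    rewrite lerBlDr [leRHS]addrC -lerBlDr; apply: lb_le_inf => // _ [v Sv <-].
    rewrite lerBlDr; apply: le_trans (EI _ _ (SD _ _ Su Sv)) _ => /=.
    by have := qD (x + u.1) (y + v.1); rewrite addrACA; lra.
  rewrite le_eqVlt => /orP[/eqP <-|a0].
    rewrite scale0r mul0r; apply/eqP; rewrite eq_le; apply/andP; split.
      by rewrite (le_trans (EI 0 _ S0))//= addr0 (sublinear0 sq) subr0.
    apply: lb_le_inf => // _ [u Su <-].
    by rewrite add0r subr_ge0; exact: Sq.
  apply/eqP; rewrite eq_le infZ//= mulrC -ler_pdivlMr//.
  have := @infZ a^-1 (a *: x); rewrite invr_gt0 => /(_ a0).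
  by rewrite scalerA mulVf ?gt_eqF// scale1r mulrC.
- by move=> x; rewrite (le_trans (EI x _ S0))//= addr0 subr0.
- move=> u Su; rewrite (le_trans (EI _ _ Su))// addNr (sublinear0 sq).
  by rewrite sub0r.
Qed.

(** Zorn gives a minimal sublinear functional below [p]. Applied to the ray of multiples of [x],
    [sublinear_minorant] cannot lower it further, which forces [q (- x) = - q x]; an odd sublinear
    functional is linear. *)
Lemma linear_minorant p : sublinear p ->
  exists l : V -> R, (forall x, l x <= p x) /\
    (forall (a : R) x y, l (a *: x + y) = a * l x + l y).
Proof.
move=> sp.
pose T := {q : V -> R | sublinear q /\ forall x, q x <= p x}.
pose le (q1 q2 : T) := `[< forall x, sval q2 x <= sval q1 x >].
have [||||[q [sq qp]] qmin] := @Zorn T le.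
- by move=> t; apply/asboolP.
- move=> r s t /asboolP rs /asboolP st; apply/asboolP => x.
  exact: le_trans (st x) (rs x).
- move=> [s ps] [t pt] /asboolP/= st /asboolP/= ts; apply: eq_exist.
  by apply/funext => x; apply/eqP; rewrite eq_le st ts.
- move=> A Atot.
  have [[t0 At0]|A0] := pselect (A !=set0); last first.
    by exists (exist _ p (conj sp (fun=> lexx _))) => s As; exfalso; apply: A0; exists s.
  pose E x := [set sval t x | t in A].
  have E0 x : E x !=set0 by exists (sval t0 x); exists t0.
  have El x : has_lbound (E x).
    exists (- p (- x)) => _ [[t [st tp]] At <-] /=.
    by have := sublinear_oppr x st; have := tp (- x); lra.
  have EI x t : A t -> inf (E x) <= sval t x.
    by move=> At; apply: ge_inf => //; exists t.
  have sE : sublinear (fun x => inf (E x)).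
    split=> [x y|a x a0].
      rewrite -lerBlDr; apply: lb_le_inf => // _ [s As <-].
      rewrite lerBlDr [leRHS]addrC -lerBlDr; apply: lb_le_inf => // _ [t At <-].
      (* In a chain one of the two functionals lies below the other, so both values can be taken
         from the smaller one. *)
      rewrite lerBlDr; have [/asboolP st|/asboolP ts] := Atot _ _ As At.
        apply: (le_trans (EI _ _ At)); apply: (le_trans ((svalP t).1.1 _ _)).
        by rewrite addrC lerD.
      apply: (le_trans (EI _ _ As)); apply: (le_trans ((svalP s).1.1 _ _)).
      by rewrite addrC lerD.
    move: a0; rewrite le_eqVlt => /orP[/eqP <-|a0].
      rewrite scale0r mul0r; apply/eqP; rewrite eq_le; apply/andP; split.
        by rewrite (le_trans (EI _ _ At0))// (sublinear0 (svalP t0).1).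
      by apply: lb_le_inf => // _ [t At <-]; rewrite (sublinear0 (svalP t).1).
    apply/eqP; rewrite eq_le; apply/andP; split.
      rewrite -ler_pdivrMl//; apply: lb_le_inf => // _ [u Su <-].
      by rewrite ler_pdivrMl// -((svalP u).1.2 _ _ (ltW a0)); exact: EI.
    apply: lb_le_inf => // _ [u Su <-].
    by rewrite ((svalP u).1.2 _ _ (ltW a0)) ler_pM2l//; exact: EI.
  have Ep x : inf (E x) <= p x := le_trans (EI _ _ At0) ((svalP t0).2 x).
  by exists (exist _ (fun x => inf (E x)) (conj sE Ep)) => s As; apply/asboolP => x; exact: EI.
have qminE q' : sublinear q' -> (forall x, q' x <= q x) -> q' = q.
  move=> sq' q'q; have q'p x : q' x <= p x := le_trans (q'q x) (qp x).
  have := qmin (exist _ q' (conj sq' q'p)).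
  have L : le (exist _ q (conj sq qp)) (exist _ q' (conj sq' q'p)) by apply/asboolP.
  by move=> /(_ L) [].
have qN x : q (- x) = - q x.
  pose S := [set u : V * R | exists2 t, 0 <= t & u = (t *: x, t * q x)].
  have [||||q' [sq' q'q q'S]] := @sublinear_minorant q S sq.
  - by exists 0 => //; rewrite scale0r mul0r.
  - move=> _ _ [t t0 ->] [t' t'0 ->]; exists (t + t'); first exact: addr_ge0.
    by rewrite scalerDl mulrDl.
  - move=> a _ a0 [t t0 ->]; exists (a * t); first by rewrite mulr_ge0// ltW.
    by rewrite scalerA mulrA.
  - by move=> _ [t t0 ->] /=; rewrite sq.2.
  have Sx : S (x, q x) by exists 1 => //; rewrite scale1r mul1r.
  have := q'S _ Sx; rewrite (qminE _ sq' q'q)/=.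
  have := sublinear_oppr x sq.
  by move=> *; apply/eqP; rewrite eq_le; apply/andP; split=> //; lra.
exists q; split=> // a x y; have [qD qZ] := sq.
have qA z w : q (z + w) = q z + q w.
  apply/eqP; rewrite eq_le qD/=; have := qD (- z) (- w).
  by rewrite -opprD !qN; lra.
rewrite qA; congr (_ + _).
have [a0|a0] := leP 0 a; first exact: qZ.
by rewrite -[a]opprK scaleNr qN qZ ?mulNr// oppr_ge0 ltW.
Qed.

(** [S] is the graph of a linear functional on a subspace, single valued because domination by [p]
    at [(0, c)] and [(0, - c)] forces [c = 0]. A linear functional lying above [S] also lies below
    it, by homogeneity with the factor -1. *)
Lemma hahn_banach p S : sublinear p -> S (0, 0) ->
  (forall u v, S u -> S v -> S (u.1 + v.1, u.2 + v.2)) ->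
  (forall (a : R) u, S u -> S (a *: u.1, a * u.2)) ->
  (forall u, S u -> u.2 <= p u.1) ->
  exists l : V -> R, [/\ forall x, l x <= p x,
    forall a x y, l (a *: x + y) = a * l x + l y &
    forall u, S u -> l u.1 = u.2].
Proof.
move=> sp S0 SD SZ Sp.
have [q [sq qp qS]] := sublinear_minorant sp S0 SD (fun a u _ => SZ a u) Sp.
have [l [lq ll]] := linear_minorant sq.
have lN x : l (- x) = - l x.
  have l0 : l 0 = 0 by have := ll (-1) 0 0; rewrite scaler0 addr0; lra.
  by have := ll (-1) x 0; rewrite addr0 scaleN1r l0 mulN1r addr0.
have lS u : S u -> u.2 <= l u.1.
  by move=> /qS; have := lq (- u.1); rewrite lN; lra.
exists l; split=> [x| //|u Su]; first exact: le_trans (lq _) (qp _).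
apply/eqP; rewrite eq_le lS//= andbT.
have := lS _ (SZ (-1) _ Su); rewrite /= scaleN1r lN mulN1r lerN2.
by [].
Qed.

End hahn_banach.

(** * Square-integrable functions and their pairing *)

Section square_integrable.
Context d (X : measurableType d) (R : realType).
Variable mu : {measure set X -> \bar R}.
Implicit Types f g h : X -> R.

Definition sqint f := measurable_fun setT f /\
  mu.-integrable setT (EFin \o (fun x => f x ^+ 2)).

Definition dot f g := \int[mu]_x (f x * g x).

Lemma integrable_le f g : measurable_fun setT f ->
  mu.-integrable setT (EFin \o g) -> (forall x, `|f x| <= g x) ->
  mu.-integrable setT (EFin \o f).
Proof.
move=> mf ig fg; apply: le_integrable ig => //; first exact/measurable_EFinP.
by move=> x _; rewrite /= lee_fin (le_trans (fg x))// ler_norm.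
Qed.

Lemma integrableDR f g : mu.-integrable setT (EFin \o f) ->
  mu.-integrable setT (EFin \o g) ->
  mu.-integrable setT (EFin \o (fun x => f x + g x)).
Proof.
by move=> fi gi; exact: (integrableD measurableT fi gi).
Qed.

Lemma integrableZR a f : mu.-integrable setT (EFin \o f) ->
  mu.-integrable setT (EFin \o (fun x => a * f x)).
Proof. by move=> fi; exact: (integrableZl measurableT a fi). Qed.

Lemma sqintM f g : sqint f -> sqint g ->
  mu.-integrable setT (EFin \o (fun x => f x * g x)).
Proof.
move=> [mf f2] [mg g2]; apply: (@integrable_le _ (fun x => f x ^+ 2 + g x ^+ 2)).
- exact: measurable_funM.
- exact: integrableDR.
- move=> x; rewrite ler_norml; apply/andP; split.
    by have := sqr_ge0 (f x + g x); have := sqr_ge0 (f x); have := sqr_ge0 (g x); nra.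
  by have := sqr_ge0 (f x - g x); have := sqr_ge0 (f x); have := sqr_ge0 (g x); nra.
Qed.

Lemma sqintD f g : sqint f -> sqint g -> sqint (fun x => f x + g x).
Proof.
move=> sf sg; have fg := sqintM sf sg; case: sf sg => mf f2 [mg g2].
split; first exact: measurable_funD.
rewrite (_ : (fun x => _) = (fun x => f x ^+ 2 + (2 * (f x * g x) + g x ^+ 2))); last first.
  by apply/funext => x; ring.
by apply: integrableDR => //; apply: integrableDR => //; exact: integrableZR.
Qed.

Lemma sqintZ a f : sqint f -> sqint (fun x => a * f x).
Proof.
move=> [mf f2]; split; first exact: measurable_funM.
rewrite (_ : (fun x => _) = (fun x => a ^+ 2 * f x ^+ 2)); last first.
  by apply/funext => x; ring.
exact: integrableZR.
Qed.

Lemma sqint0 : sqint (fun=> 0).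
Proof.
split; first exact: measurable_cst.
rewrite (_ : _ \o _ = cst 0%E); first exact: integrable0.
by apply/funext => x /=; rewrite expr0n.
Qed.

Lemma sqintB f g : sqint f -> sqint g -> sqint (fun x => f x - g x).
Proof.
move=> sf /(sqintZ (-1)) /(sqintD sf).
by under eq_fun do rewrite mulN1r.
Qed.

Lemma sqint_le f g : measurable_fun setT f -> sqint g ->
  (forall x, `|f x| <= `|g x|) -> sqint f.
Proof.
move=> mf [mg g2] fg; split=> //; apply: integrable_le g2 _.
  exact: measurable_funX.
by move=> x; rewrite normrX -[leRHS]real_normK ?num_real// lerXn2r ?nnegrE.
Qed.

Lemma Lfun2P f : reflect (sqint f) (f \in Lfun mu 2%:E).
Proof.
apply: (iffP idP) => [fL|[mf /integrableP[_ f2]]].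
  split; last exact: Lfun2_integrable_sqr.
  by move: fL; rewrite inE => /andP[/[!inE]].
rewrite inE; apply/andP; split; rewrite inE//= /finite_norm unlock.
rewrite poweR_lty//; apply: le_lt_trans f2; rewrite le_eqVlt; apply/orP; left.
apply/eqP/eq_integral => x _ /=.
by rewrite -[2%R]/(2%:R) powR_mulrn// normrX.
Qed.

Lemma dotC f g : dot f g = dot g f.
Proof. by congr Rintegral; apply/funext => x; rewrite mulrC. Qed.

Lemma dotDl f g h : sqint f -> sqint g -> sqint h ->
  dot (fun x => f x + g x) h = dot f h + dot g h.
Proof.
move=> sf sg sh; rewrite -RintegralD//; [|exact: sqintM|exact: sqintM].
by congr Rintegral; apply/funext => x; rewrite mulrDl.
Qed.

Lemma dotZl a f g : sqint f -> sqint g -> dot (fun x => a * f x) g = a * dot f g.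
Proof.
move=> sf sg; rewrite -RintegralZl//; last exact: sqintM.
by congr Rintegral; apply/funext => x; rewrite mulrA.
Qed.

Lemma dotDr f g h : sqint f -> sqint g -> sqint h ->
  dot h (fun x => f x + g x) = dot h f + dot h g.
Proof. by move=> *; rewrite dotC dotDl// !(dotC h). Qed.

Lemma dotZr a f g : sqint f -> sqint g -> dot g (fun x => a * f x) = a * dot g f.
Proof. by move=> *; rewrite dotC dotZl// dotC. Qed.

Lemma dotBl f g h : sqint f -> sqint g -> sqint h ->
  dot (fun x => f x - g x) h = dot f h - dot g h.
Proof.
move=> sf sg sh; rewrite -[in RHS]mulN1r -dotZl// -dotDl//; last exact: sqintZ.
by congr dot; apply/funext => x; rewrite mulN1r.
Qed.

Lemma dot_ge0 f : 0 <= dot f f.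
Proof. by apply: Rintegral_ge0 => x _; rewrite -expr2 sqr_ge0. Qed.

Lemma dot_expandD f g a : sqint f -> sqint g ->
  dot (fun x => f x + a * g x) (fun x => f x + a * g x) =
  dot f f + 2 * a * dot f g + a ^+ 2 * dot g g.
Proof.
move=> sf sg; have sag := sqintZ a sg; have sd := sqintD sf sag.
rewrite dotDl// !dotDr// !dotZl// !dotZr// (dotC g f); ring.
Qed.

Lemma dot_cauchy_schwarz f g : sqint f -> sqint g ->
  dot f g ^+ 2 <= dot f f * dot g g.
Proof.
move=> sf sg; have P a := dot_ge0 (fun x => f x + a * g x).
have {}P a : 0 <= dot f f + 2 * a * dot f g + a ^+ 2 * dot g g.
  by rewrite -dot_expandD.
have g0 := dot_ge0 g; have f0 := dot_ge0 f.
have [gE|gE] := eqVneq (dot g g) 0.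
  have [fE|fE] := eqVneq (dot f g) 0; first by rewrite fE gE; nra.
  (* Here the quadratic is affine in [a], and this [a] gives it the value -1. *)
  have := P (- (dot f f + 1) / (2 * dot f g)).
  rewrite gE mulr0 addr0.
  have -> : 2 * (- (dot f f + 1) / (2 * dot f g)) * dot f g = - (dot f f + 1).
    by field.
  lra.
have g_gt0 : 0 < dot g g by rewrite lt_neqAle eq_sym gE.
have := P (- dot f g / dot g g).
have -> : dot f f + 2 * (- dot f g / dot g g) * dot f g +
  (- dot f g / dot g g) ^+ 2 * dot g g = (dot f f * dot g g - dot f g ^+ 2) / dot g g.
  by field.
by rewrite pmulr_lge0 ?invr_gt0// subr_ge0.
Qed.

End square_integrable.

(** * Completeness of L^2 *)

Section riesz_fischer.
Context d (X : measurableType d) (R : realType).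
Variable mu : {measure set X -> \bar R}.
Implicit Types f g h : X -> R.

Lemma ae_eq_Rintegral f g : measurable_fun setT f -> measurable_fun setT g ->
  {ae mu, forall x, f x = g x} -> \int[mu]_x f x = \int[mu]_x g x.
Proof.
move=> mf mg fg; congr fine; apply: ae_eq_integral => //;
  try exact/measurable_EFinP.
by apply: filterS fg => x -> _.
Qed.

Lemma norm_le_sqr (a b : R) : 0 <= b -> a ^+ 2 <= b ^+ 2 -> `|a| <= b.
Proof.
move=> b0 ab; rewrite leNgt; apply/negP => ba.
have := real_normK (num_real a); have := normr_ge0 a; nra.
Qed.

Lemma cvg_div_exp2 (k : R) : (fun n => k / 2 ^+ n) @ \oo --> 0.
Proof.
have := @cvg_geometric R k 2^-1.
rewrite ger0_norm ?invr_ge0// invf_lt1// ltr1n => /(_ isT).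
rewrite (_ : geometric _ _ = fun n => k / 2 ^+ n)//.
by apply/funext => n; rewrite /geometric/= exprVn.
Qed.

Lemma geometric_increments_cvg (a : R^nat) (c : R) : 0 <= c ->
  (forall n, `|a n.+1 - a n| <= c / 2 ^+ n) ->
  exists l, a @ \oo --> l /\ forall n, `|a n - l| <= 2 * c / 2 ^+ n.
Proof.
move=> c0 da.
have tail n m : `|a (n + m)%N - a n| <= 2 * c / 2 ^+ n - 2 * c / 2 ^+ (n + m).
  elim: m => [|m IH]; first by rewrite addn0 !subrr normr0.
  rewrite addnS (le_trans (ler_distD (a (n + m)%N) _ _))//.
  rewrite (le_trans (lerD (da _) IH))// exprS invfM.
  by move: (2 ^+ n)^-1 (2 ^+ (n + m))^-1 => y z; lra.
have pow0 := cvg_div_exp2.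
have tail' n m : `|a (n + m)%N - a n| <= 2 * c / 2 ^+ n.
  rewrite (le_trans (tail n m))// gerBl divr_ge0 ?mulr_ge0//.
have ca : cvgn a.
  apply: cauchy_cvg; apply/cauchyP => e e0.
  have /cvgrPdist_lt /(_ _ e0) [N _ NP] := pow0 (2 * c).
  exists (a N); exists N => // m /= Nm; rewrite -ball_normE /ball_/= distrC.
  rewrite -(subnKC Nm) (le_lt_trans (tail' N _))//.
  have := NP N; rewrite /= sub0r normrN ger0_norm; first exact.
  by rewrite divr_ge0 ?mulr_ge0.
exists (limn a); split=> // n; rewrite distrC.
have : (fun m => `|a (n + m)%N - a n|) @ \oo --> `|limn a - a n|.
  apply: cvg_norm; apply: cvgB; last exact: cvg_cst.
  rewrite (_ : (fun m => _) = [sequence a (m + n)%N]_m); last first.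
    by apply/funext => m; rewrite addnC.
  by rewrite cvg_shiftn.
move=> /[dup] ac /cvg_lim <- //; apply: limr_le; first exact: cvgP ac.
by apply: nearW => m; exact: tail'.
Qed.

(** Riesz-Fischer with a rate. As the increments have squared norm at most 8^(-n), the series [G] of
    4^n ([D n])^2 is integrable; where it is finite, [D n] is at most sqrt G / 2^n, so the sequence
    converges geometrically. The squared error is at most a constant times 4^(-n) G, an integrable
    bound that gives the limit of every pairing. *)
Lemma sqint_complete (u : nat -> X -> R) : (forall n, sqint mu (u n)) ->
  (forall n, dot mu (fun x => u n.+1 x - u n x) (fun x => u n.+1 x - u n x)
             <= (8 ^+ n)^-1) ->
  exists v, sqint mu v /\
    forall h, sqint mu h -> (fun n => dot mu (u n) h) @ \oo --> dot mu v h.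
Proof.
move=> su du.
pose D n x := u n.+1 x - u n x.
have sD n : sqint mu (D n) by exact: sqintB.
pose G x := (\sum_(n <oo) (4 ^+ n * D n x ^+ 2)%:E)%E.
have G0 x : (0 <= G x)%E.
  by apply: nneseries_ge0 => n _ _; rewrite lee_fin mulr_ge0 ?sqr_ge0// exprn_ge0.
have mterm n : measurable_fun setT (fun x => (4 ^+ n * D n x ^+ 2)%:E).
  apply/measurable_EFinP; apply: measurable_funM => //.
  by apply: measurable_funX; exact: (sD n).1.
have mG : measurable_fun setT G.
  apply: ge0_emeasurable_sum => // n x _ _.
  by rewrite lee_fin mulr_ge0 ?sqr_ge0// exprn_ge0.
have iG : mu.-integrable setT G.
  apply/integrableP; split=> //.
  rewrite (eq_integral G); last by move=> x _; rewrite gee0_abs.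
  rewrite integral_nneseries//; last first.
    by move=> n x _; rewrite lee_fin mulr_ge0 ?sqr_ge0// exprn_ge0.
  (* 2 / 2^(n+1) is 4^n / 8^n, in the form summed by [epsilon_trick0]. *)
  apply: (@le_lt_trans _ _ (\sum_(n <oo) (2 / (2 ^ n.+1)%:R)%:E)%E); last first.
    by rewrite (le_lt_trans (@epsilon_trick0 _ _ _ _))// ltry.
  apply: lee_nneseries => [n _ _|n _].
    by apply: integral_ge0 => x _; rewrite lee_fin mulr_ge0 ?sqr_ge0// exprn_ge0.
  under eq_integral do rewrite EFinM.
  rewrite integralZl//; last exact: (sD n).2.
  have -> : (\int[mu]_x (D n x ^+ 2)%:E = (dot mu (D n) (D n))%:E)%E.
    rewrite /dot /Rintegral fineK; last exact/integrable_fin_num/sqintM.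
    by apply: eq_integral => x _; rewrite expr2.
  rewrite -EFinM lee_fin (le_trans (ler_wpM2l _ (du n)))// ?exprn_ge0//.
  have -> : 8 = 4 * 2 :> R by rewrite -natrM.
  rewrite exprMn natrX exprS.
  by rewrite le_eqVlt; apply/orP; left; apply/eqP; field; rewrite !expf_neq0.
pose g x := fine (G x).
have g0 x : 0 <= g x by rewrite fine_ge0.
pose A := [set x | (G x < +oo)%E].
have mA : measurable A.
  rewrite -[A]setTI; exact: emeasurable_fun_infty_o.
have aeA : {ae mu, forall x, A x}.
  have := integrable_ae measurableT iG.
  by apply: filterS => x /(_ I); rewrite ge0_fin_numE.
have Gfin x : A x -> G x = (g x)%:E.
  by move=> Ax; rewrite fineK// ge0_fin_numE.
have Dle n x : A x -> `|D n x| <= Num.sqrt (g x) / 2 ^+ n.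
  move=> Ax; apply: norm_le_sqr; first by rewrite divr_ge0 ?sqrtr_ge0// exprn_ge0.
  rewrite exprMn sqr_sqrtr// exprVn ler_pdivlMr; last first.
    by rewrite exprn_gt0// exprn_gt0.
  rewrite -exprM mulnC exprM mulrC -lee_fin -Gfin//.
  have -> : 2 ^+ 2 = 4 :> R by rewrite expr2 -natrM.
  rewrite /G (@nneseriesD1 _ _ n)//; last first.
    by move=> k _; rewrite lee_fin mulr_ge0 ?sqr_ge0// exprn_ge0.
  rewrite leeDl// nneseries_ge0// => k _ _.
  by rewrite lee_fin mulr_ge0 ?sqr_ge0// exprn_ge0.
(* Cutting off the null set where [G] is infinite makes the sequence converge at every point. *)
pose w n x := u n x * \1_A x.
have mw n : measurable_fun setT (w n).
  apply: measurable_funM; first exact: (su n).1.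
  exact: measurable_indic.
have wl x : exists l : R, ((fun n => w n x) @ \oo --> l) /\
    (forall n, `|w n x - l| <= 2 * Num.sqrt (g x) / 2 ^+ n).
  apply: geometric_increments_cvg => [|n]; first exact: sqrtr_ge0.
  rewrite /w -mulrBl; have [Ax|nAx] := pselect (A x).
    by rewrite indicE mem_set// mulr1; exact: Dle.
  rewrite indicE memNset// mulr0 normr0.
  by rewrite divr_ge0 ?sqrtr_ge0// exprn_ge0.
have [v /all_and2[wv vw]] := choice wl.
have mv : measurable_fun setT v.
  apply: (measurable_fun_cvg mw) => x _; exact: wv.
have mg : measurable_fun setT g by apply: measurableT_comp => //.
have ig : mu.-integrable setT (EFin \o g).
  apply/integrableP; split; first exact/measurable_EFinP.
  have /integrableP[_] := iG; apply: le_lt_trans.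
  apply: ge0_le_integral => //.
  - by apply: measurableT_comp => //; apply: measurableT_comp => //; exact/measurable_EFinP.
  - by apply: measurableT_comp.
  - move=> x _ /=; rewrite ger0_norm// gee0_abs//.
    have [Gy|] := eqVneq (G x) +oo%E; first by rewrite /g Gy leey.
    by rewrite -ltey => Gy; rewrite Gfin.
have vw2 n x : (w n x - v x) ^+ 2 <= (2 / 2 ^+ n) ^+ 2 * g x.
  rewrite -[leLHS]real_normK ?num_real//.
  rewrite -[g x]sqr_sqrtr// -exprMn.
  have := vw x n; rewrite mulrAC => vwx; apply: lerXn2r => //.
  by rewrite nnegrE (le_trans _ vwx).
have swv n : sqint mu (fun x => w n x - v x).
  split; first exact: measurable_funB.
  apply: (integrable_le _ (integrableZR ((2 / 2 ^+ n) ^+ 2) ig)).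
    by apply: measurable_funX; exact: measurable_funB.
  by move=> x; rewrite ger0_norm ?sqr_ge0.
have sw n : sqint mu (w n).
  apply: sqint_le (su n) _ => // x; rewrite normrM ler_piMr//.
  by rewrite indicE; case: (_ \in _); rewrite ?normr1 ?normr0.
have sv : sqint mu v.
  have := sqintB (sw 0%N) (swv 0%N).
  by under eq_fun do rewrite opprB addrCA subrr addr0.
exists v; split=> // h sh.
have uw n : dot mu (u n) h = dot mu (w n) h.
  apply: ae_eq_Rintegral.
  - by apply: measurable_funM; [exact: (su n).1|exact: sh.1].
  - by apply: measurable_funM => //; exact: sh.1.
  - by apply: filterS aeA => x Ax; rewrite /w indicE mem_set// mulr1.
have gI0 : 0 <= \int[mu]_x g x by apply: Rintegral_ge0.
pose C := Num.sqrt ((\int[mu]_x g x) * dot mu h h).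
have bound n : `|dot mu (u n) h - dot mu v h| <= 2 * C / 2 ^+ n.
  rewrite uw -dotBl//; apply: norm_le_sqr.
    by rewrite divr_ge0 ?mulr_ge0 ?sqrtr_ge0// exprn_ge0.
  rewrite (le_trans (dot_cauchy_schwarz (swv n) sh))//.
  rewrite mulrAC exprMn sqr_sqrtr ?mulr_ge0 ?dot_ge0// mulrA.
  rewrite ler_wpM2r ?dot_ge0// -RintegralZl//.
  apply: le_Rintegral => //.
  - exact: sqintM.
  - exact: integrableZR.
  - by move=> x _; rewrite -expr2.
have pow0 := cvg_div_exp2.
apply/cvgrPdist_le => e e0.
have /cvgrPdist_le /(_ _ e0) := pow0 (2 * C).
apply: filterS => n; rewrite sub0r normrN ger0_norm; last first.
  by rewrite divr_ge0 ?mulr_ge0 ?sqrtr_ge0// exprn_ge0.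
by rewrite distrC; exact: le_trans (bound n).
Qed.
End riesz_fischer.

Section riesz.
Context d (X : measurableType d) (R : realType).
Variable mu : {measure set X -> \bar R}.

Local Notation two_ge1 := (@lee1n R 2).
Local Notation Lt := (LfunType mu two_ge1).
Implicit Types f g h : Lt.

Lemma Lt_sqint f : sqint mu f.
Proof. by apply/Lfun2P; exact: LfunP. Qed.

Lemma sqint_Lt (f : X -> R) : sqint mu f -> exists f' : Lt, f' = f :> (X -> R).
Proof. by move=> /Lfun2P fL; exists (Lfun_Sub two_ge1 fL). Qed.

Lemma LtDE f g : (f + g : Lt) = (fun x => f x + g x) :> (X -> R).
Proof. by []. Qed.

Lemma LtZE (a : R) f : (a *: f : Lt) = (fun x => a * f x) :> (X -> R).
Proof. by []. Qed.

Lemma Lt0E : (0 : Lt) = (fun=> 0) :> (X -> R).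
Proof. by []. Qed.


(** The representative is obtained by minimising [J f] = |f|^2 - 2 [L f], which the second
    hypothesis, a form of continuity of [L], bounds below. By the parallelogram law a minimising
    sequence is Cauchy, and the claim is the vanishing of the first variation at its limit. *)
Lemma riesz_representation (L : Lt -> R) (M : R) :
  (forall (a : R) f g, L (a *: f + g) = a * L f + L g) ->
  (forall f, 2 * L f <= dot mu f f + M) ->
  exists u, sqint mu u /\ forall h, L h = dot mu u h.
Proof.
move=> Llin LM.
pose J f := dot mu f f - 2 * L f.
pose i := inf (range J).
have JM f : - M <= J f by have := LM f; rewrite /J; lra.
have ii f : i <= J f.
  by apply: ge_inf; [exists (- M) => _ [g _ <-]; exact: JM|exists f].
have L0 : L 0 = 0 by have := Llin (-1) 0 0; rewrite scaler0 addr0; lra.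
have LD f g : L (f + g) = L f + L g by rewrite -[f]scale1r Llin mul1r scale1r.
have LZ a f : L (a *: f) = a * L f by rewrite -[a *: f]addr0 Llin L0 addr0.
have JD f g (t : R) : J (f + t *: g) =
    J f + (2 * t * (dot mu f g - L g) + t ^+ 2 * dot mu g g).
  rewrite /J LtDE LtZE dot_expandD; [|exact: Lt_sqint..].
  by rewrite LD LZ; ring.
(* The parallelogram law bounds the squared distance of consecutive terms by twice the sum of their
   excesses over [i]; a quarter of 8^(-n) keeps this below 8^(-n). *)
have /choice[f_ f_J] : forall n, exists f, J f < i + (8 ^+ n)^-1 / 4.
  move=> n.
  have [||_ [f _ <-] fi] := @inf_adherent _ (range J) ((8 ^+ n)^-1 / 4).
  - by rewrite divr_gt0// invr_gt0 exprn_gt0.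
  - by split; [exists (J 0); exists 0|exists (- M) => _ [g _ <-]; exact: JM].
  - by exists f.
have [] := @sqint_complete _ _ _ mu (fun n => f_ n).
- by move=> n; exact: Lt_sqint.
- move=> n; set f := f_ n.+1; set g := f_ n.
  have fg : dot mu (fun x => f x - g x) (fun x => f x - g x) =
      2 * J f + 2 * J g - 4 * J (2^-1 *: f + 2^-1 *: g).
    rewrite /J LtDE !LtZE.
    rewrite (_ : (fun x => f x - g x) = (fun x => f x + -1 * g x)); last first.
      by apply/funext => x; rewrite mulN1r.
    have sf : sqint mu f by exact: Lt_sqint.
    have sg : sqint mu g by exact: Lt_sqint.
    have sf2 := sqintZ 2^-1 sf.
    rewrite !dot_expandD// !LD !LZ !dotZl// !dotZr//; by field.
  have := ii (2^-1 *: f + 2^-1 *: g); have := f_J n; have := f_J n.+1.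
  have e0 : 0 < (8 ^+ n)^-1 :> R by rewrite invr_gt0 exprn_gt0.
  rewrite fg -/f -/g exprS invfM; move: e0; set e := (8 ^+ n)^-1; lra.
move=> u [su fu]; exists u; split=> // h.
have sh : sqint mu h by exact: Lt_sqint.
have EL t : 0 <= 2 * t * (dot mu u h - L h) + t ^+ 2 * dot mu h h.
  have : (fun n => 2 * t * (dot mu (f_ n) h - L h) + t ^+ 2 * dot mu h h + 1 / 2 ^+ n)
      @ \oo --> 2 * t * (dot mu u h - L h) + t ^+ 2 * dot mu h h + 0.
    apply: cvgD; last exact: cvg_div_exp2.
    apply: cvgD; last exact: cvg_cst.
    apply: cvgM; first exact: cvg_cst.
    by apply: cvgB; [exact: fu|exact: cvg_cst].
  rewrite addr0 => /[dup] cl /cvg_lim <- //.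
  apply: limr_ge; first exact: cvgP cl.
  apply: nearW => n; have := ii (f_ n + t *: h); rewrite JD; have := f_J n.
  have : (8 ^+ n)^-1 / 4 <= 1 / 2 ^+ n :> R.
    rewrite mul1r (@le_trans _ _ (8 ^+ n)^-1)//.
      by rewrite ler_piMr ?invr_ge0 ?exprn_ge0// invf_le1// ler1n.
    by rewrite lef_pV2 ?posrE ?exprn_gt0// lerXn2r ?nnegrE// ler_nat.
  lra.
have q0 := dot_ge0 mu h.
(* This [t] nearly minimises the quadratic; the [+ 1] keeps the quotient meaningful when [h]
   vanishes almost everywhere. *)
have := EL (- (dot mu u h - L h) / (dot mu h h + 1)).
set de := dot mu u h - L h; set q := dot mu h h in q0 *.
have -> : 2 * (- de / (q + 1)) * de + (- de / (q + 1)) ^+ 2 * q =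
  - (de / (q + 1)) ^+ 2 * (q + 2) by field; rewrite gt_eqF// ltr_wpDl.
rewrite mulNr oppr_ge0 => P.
have : (de / (q + 1)) ^+ 2 = 0.
  by apply/eqP; rewrite eq_le sqr_ge0 andbT; move: P; nra.
move/eqP; rewrite expf_eq0/= mulf_eq0 invr_eq0 => /orP[/eqP|/eqP]; last lra.
by rewrite /de; lra.
Qed.

End riesz.

Section dual_existence.
Context d (X : measurableType d) (R : realType).
Variable mu : {measure set X -> \bar R}.
Local Notation two_ge1 := (@lee1n R 2).
Local Notation Lt := (LfunType mu two_ge1).

(* [K] spans a norm by duality; the data [l] on the test space [Y] is bounded
   by the support function of [K], so Hahn-Banach extends it to all of L^2. *)
Theorem dual_existence (K : set ((X -> R) * (X -> R)))
    (Y : set ((X -> R) * (X -> R) * R)) (M : R) :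
  K (fun=> 0, fun=> 0) ->
  (forall v, K v -> [/\ sqint mu v.1, sqint mu v.2,
    dot mu v.1 v.1 <= M & dot mu v.2 v.2 <= M]) ->
  (forall y, Y y -> sqint mu y.1.1 /\ sqint mu y.1.2) ->
  Y (fun=> 0, fun=> 0, 0) ->
  (forall y z, Y y -> Y z ->
     Y (fun p => y.1.1 p + z.1.1 p, fun p => y.1.2 p + z.1.2 p, y.2 + z.2)) ->
  (forall a y, Y y -> Y (fun p => a * y.1.1 p, fun p => a * y.1.2 p, a * y.2)) ->
  (forall y, Y y -> exists2 v, K v & y.2 <= dot mu v.1 y.1.1 + dot mu v.2 y.1.2) ->
  exists u p, [/\ sqint mu u, sqint mu p,
    (forall y, Y y -> dot mu u y.1.1 + dot mu p y.1.2 = y.2) &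
    (forall y1 y2 c, sqint mu y1 -> sqint mu y2 ->
      (forall v, K v -> dot mu v.1 y1 + dot mu v.2 y2 <= c) ->
      dot mu u y1 + dot mu p y2 <= c)].
Proof.
move=> K0 KL2 YL2 Y0 YD YZ YK.
pose pairing (v : (X -> R) * (X -> R)) (y : Lt * Lt) :=
  dot mu v.1 y.1 + dot mu v.2 y.2.
pose E y := [set pairing v y | v in K].
pose sigma y := sup (E y).
have pD v x y : K v -> pairing v (x + y) = pairing v x + pairing v y.
  move=> /KL2[v1 v2 _ _].
  rewrite /pairing -[(x + y).1]/(x.1 + y.1) -[(x + y).2]/(x.2 + y.2) !LtDE !dotDr//; try exact: Lt_sqint.
  by rewrite addrACA.
have pZ v a y : K v -> pairing v (a *: y) = a * pairing v y.
  move=> /KL2[v1 v2 _ _].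
  rewrite /pairing -[(a *: y).1]/(a *: y.1) -[(a *: y).2]/(a *: y.2) !LtZE !dotZr//; try exact: Lt_sqint.
  by rewrite mulrDr.
have amgm (v y : X -> R) : sqint mu v -> sqint mu y ->
    2 * dot mu v y <= dot mu v v + dot mu y y.
  move=> sv sy; have := dot_ge0 mu (fun x => v x + -1 * y x).
  by rewrite dot_expandD//; lra.
(* This bound serves twice: it makes the support function finite, and through [ls2] it is the
   boundedness required by [riesz_representation]. *)
have pB v y : K v -> 2 * pairing v y <= (dot mu y.1 y.1 + dot mu y.2 y.2) + 2 * M.
  move=> /KL2[v1 v2 v1M v2M]; rewrite /pairing.
  have := amgm v.1 y.1 v1 (Lt_sqint _); have := amgm v.2 y.2 v2 (Lt_sqint _).
  lra.
have E0 y : E y !=set0 by eexists; exists (fun=> 0, fun=> 0).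
have Eub y : has_ubound (E y).
  exists (((dot mu y.1 y.1 + dot mu y.2 y.2) + 2 * M) / 2) => _ [v Kv <-].
  by have := pB v y Kv; lra.
have Esup v y : K v -> pairing v y <= sigma y.
  by move=> Kv; apply: ub_le_sup => //; exists v.
have ssub : sublinear sigma.
  split=> [x y|a x].
    apply: ge_sup => // _ [v Kv <-].
    by rewrite pD// lerD// Esup.
  rewrite le_eqVlt => /orP[/eqP <-|a0].
    rewrite mul0r /sigma (_ : E _ = [set 0]) ?sup1//.
    rewrite eqEsubset; split=> [_ [v Kv <-]|_ ->]/=; first by rewrite pZ// mul0r.
    by exists (fun=> 0, fun=> 0) => //; rewrite pZ// mul0r.
  apply/eqP; rewrite eq_le; apply/andP; split.
    by apply: ge_sup => // _ [v Kv <-]; rewrite pZ// ler_pM2l// Esup.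
  rewrite -ler_pdivlMl//; apply: ge_sup => // _ [v Kv <-].
  by rewrite ler_pdivlMl// -pZ// Esup.
pose S := [set u : (Lt * Lt) * R | Y ((u.1.1 : X -> R), (u.1.2 : X -> R), u.2)].
have [||||l [ls llin lS]] := @hahn_banach _ _ sigma S ssub.
- exact: Y0.
- by move=> u v Su Sv; exact: (YD _ _ Su Sv).
- by move=> a u Su; exact: (YZ a _ Su).
- move=> u Su; have [v Kv /le_trans] := YK _ Su; apply; exact: (Esup v u.1 Kv).
have ls2 y : 2 * l y <= dot mu y.1 y.1 + dot mu y.2 y.2 + 2 * M.
  rewrite -ler_pdivlMl// (le_trans (ls y))//; apply: ge_sup => // _ [v Kv <-].
  by rewrite ler_pdivlMl// pB.
have dot00 : dot mu (0 : Lt) (0 : Lt) = 0.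
  by rewrite Lt0E -[fun=> _]/(cst 0) /dot; under eq_Rintegral do rewrite mulr0;
     rewrite Rintegral_cst//= mul0r.
have [|f|u [su uE]] := @riesz_representation _ _ _ mu (fun f => l (f, 0)) (2 * M).
- by move=> a f g; rewrite -llin; congr l; congr pair => /=; rewrite scaler0 addr0.
- by have := ls2 (f, 0); rewrite /= dot00 addr0.
have [|f|p [sp pE]] := @riesz_representation _ _ _ mu (fun f => l (0, f)) (2 * M).
- by move=> a f g; rewrite -llin; congr l; congr pair => /=; rewrite scaler0 addr0.
- by have := ls2 (0, f); rewrite /= dot00 add0r.
have lE (f g : Lt) : l (f, g) = dot mu u f + dot mu p g.
  rewrite -uE -pE -[X in X + _]mul1r -llin; congr l.
  by rewrite scale1r; congr pair => /=; rewrite ?addr0 ?add0r.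
exists u, p; split=> //.
- move=> [[y1 y2] c] Yy; have [s1 s2] := YL2 _ Yy.
  have [f1 f1E] := sqint_Lt s1; have [f2 f2E] := sqint_Lt s2.
  have := lS ((f1, f2), c); rewrite /S/= f1E f2E => /(_ Yy) <-.
  by rewrite lE f1E f2E.
(* Domination of [l] by the support function of [K] is the bipolar property. *)
- move=> y1 y2 c s1 s2 Kc.
  have [f1 f1E] := sqint_Lt s1; have [f2 f2E] := sqint_Lt s2.
  rewrite -f1E -f2E -lE (le_trans (ls _))//; apply: ge_sup => // _ [v Kv <-].
  by rewrite /pairing/= f1E f2E; exact: Kc.
Qed.

End dual_existence.

(** * Fubini, translations and the fractional kernel *)

Section real_fubini.
Context d1 d2 (X : measurableType d1) (Y : measurableType d2) (R : realType).
Variable m1 : {sigma_finite_measure set X -> \bar R}.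
Variable m2 : {sigma_finite_measure set Y -> \bar R}.
Implicit Type f : X * Y -> R.

Lemma abse_fine_le (x : \bar R) : (`|(fine x)%:E| <= `|x|)%E.
Proof. by case: x => [r||] /=; rewrite ?lexx ?normr0 ?leey. Qed.

(** Measurability holds without integrability of the slices: Tonelli handles the positive and the
    negative part, and [\int] is the finite part of their difference. *)
Lemma measurable_Rintegral1 f : measurable_fun setT f ->
  measurable_fun setT (fun x => \int[m2]_y f (x, y)).
Proof.
move=> /measurable_EFinP mf; apply: measurableT_comp => //.
rewrite (_ : (fun x => _) =
  (fun x => fubini_F m2 ((EFin \o f)^\+) x - fubini_F m2 ((EFin \o f)^\-) x)%E).
  apply: emeasurable_funB; apply: measurable_fun_fubini_tonelli_F => //.
    exact: measurable_funepos.
  exact: measurable_funeneg.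
by apply/funext => x; rewrite integralE /fubini_F /fubini_G; congr (_ - _)%E;
  apply: eq_integral => y _; rewrite ?funeposE ?funenegE.
Qed.

Lemma measurable_Rintegral2 f : measurable_fun setT f ->
  measurable_fun setT (fun y => \int[m1]_x f (x, y)).
Proof.
move=> /measurable_EFinP mf; apply: measurableT_comp => //.
rewrite (_ : (fun x => _) =
  (fun x => fubini_G m1 ((EFin \o f)^\+) x - fubini_G m1 ((EFin \o f)^\-) x)%E).
  apply: emeasurable_funB; apply: measurable_fun_fubini_tonelli_G => //.
    exact: measurable_funepos.
  exact: measurable_funeneg.
by apply/funext => x; rewrite integralE /fubini_F /fubini_G; congr (_ - _)%E;
  apply: eq_integral => y _; rewrite ?funeposE ?funenegE.
Qed.

(** Almost every slice is integrable; on the remaining null set [fine] may replace an infinite value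
    by 0. *)
Lemma Rintegral_prod1 f : (m1 \x m2)%E.-integrable setT (EFin \o f) ->
  \int[m1]_x (\int[m2]_y f (x, y)) = \int[(m1 \x m2)%E]_z f z.
Proof.
move=> fi; rewrite /Rintegral -(integral12_prod_meas1 fi); congr fine.
have Fi := integrable_fubini_F fi.
apply: ae_eq_integral => //; last 2 first.
- exact: measurable_int Fi.
- have := integrable_ae measurableT Fi; apply: filterS => x /(_ I) xfin _.
  by rewrite fineK.
- apply/measurable_EFinP/measurable_Rintegral1/measurable_EFinP.
  exact: measurable_int fi.
Qed.

Lemma integrable_fubini_G (f : X * Y -> \bar R) :
  (m1 \x m2)%E.-integrable setT f -> m2.-integrable setT (fubini_G m1 f).
Proof.
move=> fi; have mf := measurable_int _ fi.
have mG := measurable_fubini_G fi; apply/integrableP; split=> //.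
have /(integrable21ltyP m1 m2 mf) := fi; apply: le_lt_trans.
apply: ge0_le_integral => //; first exact: measurableT_comp.
- apply: (@measurable_fun_fubini_tonelli_G _ _ _ _ _ m1 (abse \o f)).
    exact: measurableT_comp.
  by move=> z /=.
- move=> y _; apply: le_abse_integral => //.
  exact: measurableT_comp.
Qed.

Lemma Rintegral_prod2 f : (m1 \x m2)%E.-integrable setT (EFin \o f) ->
  \int[m2]_y (\int[m1]_x f (x, y)) = \int[(m1 \x m2)%E]_z f z.
Proof.
move=> fi; rewrite /Rintegral -(integral21_prod_meas1 fi); congr fine.
have Fi := integrable_fubini_G fi.
apply: ae_eq_integral => //; last 2 first.
- exact: measurable_int Fi.
- have := integrable_ae measurableT Fi; apply: filterS => x /(_ I) xfin _.
  by rewrite fineK.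
- apply/measurable_EFinP/measurable_Rintegral2/measurable_EFinP.
  exact: measurable_int fi.
Qed.

Lemma Rintegral_swap f : (m1 \x m2)%E.-integrable setT (EFin \o f) ->
  \int[m1]_x (\int[m2]_y f (x, y)) = \int[m2]_y (\int[m1]_x f (x, y)).
Proof. by move=> fi; rewrite Rintegral_prod1// Rintegral_prod2. Qed.

Lemma integrable_Rintegral1 f : (m1 \x m2)%E.-integrable setT (EFin \o f) ->
  m1.-integrable setT (EFin \o (fun x => \int[m2]_y f (x, y))).
Proof.
move=> fi; apply: le_integrable (integrable_fubini_F fi) => //.
  apply/measurable_EFinP/measurable_Rintegral1/measurable_EFinP.
  exact: measurable_int fi.
by move=> x _; exact: abse_fine_le.
Qed.

Lemma integrable_Rintegral2 f : (m1 \x m2)%E.-integrable setT (EFin \o f) ->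
  m2.-integrable setT (EFin \o (fun y => \int[m1]_x f (x, y))).
Proof.
move=> fi; apply: le_integrable (integrable_fubini_G fi) => //.
  apply/measurable_EFinP/measurable_Rintegral2/measurable_EFinP.
  exact: measurable_int fi.
by move=> x _; exact: abse_fine_le.
Qed.

End real_fubini.

(** * Invariance of the integral under translation and reflection *)

Section translation.
Context {R : realType}.
Local Notation mu := (@lebesgue_measure R).

Lemma measurable_translation (c : R) : measurable_fun setT (fun x : R => x + c).
Proof. exact: measurable_funD. Qed.

Let shiftm (c : R) : {mfun measurableTypeR R >-> measurableTypeR R} :=
  @mfun_Sub _ _ (measurableTypeR R) (measurableTypeR R) _
    (mem_set (measurable_translation c)).

Lemma lebesgue_measure_translation (c : R) (A : set R) : measurable A ->
  pushforward mu (shiftm c) A = mu A.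
Proof.
move=> mA; apply/esym/lebesgue_measure_unique => //= _ [[a b]] _ <-.
rewrite /pushforward.
have -> : (shiftm c) @^-1` `]a, b]%classic = `]a - c, b - c]%classic.
  by apply/seteqP; split=> x /=; rewrite !in_itv/= ltrBlDr lerBrDr.
rewrite !lebesgue_measure_itv/= !lte_fin ltrD2r.
by case: ifPn => // _; congr EFin; rewrite opprB addrA subrK.
Qed.

Lemma ge0_integral_translation (f : R -> \bar R) (c : R) :
  measurable_fun setT f -> (forall x, 0 <= f x)%E ->
  (\int[mu]_x f (x + c)%R = \int[mu]_x f x)%E.
Proof.
move=> mf f0; transitivity (\int[pushforward mu (shiftm c)]_x f x)%E.
  by rewrite ge0_integral_pushforward.
by apply: eq_measure_integral => A mA _; exact: lebesgue_measure_translation.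
Qed.

Lemma Rintegral_translation (f : R -> R) (c : R) : measurable_fun setT f ->
  \int[mu]_x f (x + c) = \int[mu]_x f x.
Proof.
move=> mf; congr fine; rewrite integralE [RHS]integralE.
have mf' : measurable_fun setT (EFin \o f) by exact/measurable_EFinP.
congr (_ - _)%E.
  rewrite -[RHS](@ge0_integral_translation _ c)//; last exact: measurable_funepos.
  by apply: eq_integral => x _; rewrite !funeposE.
rewrite -[RHS](@ge0_integral_translation _ c)//; last exact: measurable_funeneg.
by apply: eq_integral => x _; rewrite !funenegE.
Qed.

Lemma integrable_translation (f : R -> R) (c : R) :
  mu.-integrable setT (EFin \o f) ->
  mu.-integrable setT (EFin \o (fun x => f (x + c))).
Proof.
move=> /integrableP[mf fi]; apply/integrableP; split.
  apply/measurable_EFinP; apply: measurableT_comp (measurable_translation c).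
  exact/measurable_EFinP.
by rewrite (@ge0_integral_translation (fun x => `|(f x)%:E|)%E)//;
  apply: measurableT_comp.
Qed.

End translation.

Section measurable_tools.
Context d (X : measurableType d) (R : realType).

Lemma measurable_natb (p : X -> bool) : measurable_fun setT p ->
  measurable_fun setT (fun x => (p x)%:R : R).
Proof.
move=> mp; rewrite (_ : (fun x => _) = (fun x => if p x then 1 else 0)).
  exact: measurable_fun_ifT.
by apply/funext => x; case: (p x).
Qed.

End measurable_tools.

Section reflection.
Context {R : realType}.
Local Notation mu := (@lebesgue_measure R).

Lemma ge0_integral_opp (f : R -> \bar R) :
  measurable_fun setT f -> (forall x, 0 <= f x)%E ->
  (\int[mu]_x f (- x)%R = \int[mu]_x f x)%E.
Proof.
move=> mf f0.
transitivity (\int[pushforward mu (-%R : _ -> measurableTypeR R)]_x f x)%E.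
  by rewrite ge0_integral_pushforward.
by apply: eq_measure_integral => A mA _; exact: lebesgue_measureN.
Qed.

Lemma integrable_opp (f : R -> R) :
  mu.-integrable setT (EFin \o f) ->
  mu.-integrable setT (EFin \o (fun x => f (- x))).
Proof.
move=> /integrableP[mf fi]; apply/integrableP; split.
  apply/measurable_EFinP; apply: measurableT_comp (@oppr_measurable _ _).
  exact/measurable_EFinP.
by rewrite (@ge0_integral_opp (fun x => `|(f x)%:E|)%E)//;
  apply: measurableT_comp.
Qed.

End reflection.

Lemma derivable_cvg {R : realType} (f : R -> R) (x : R) :
  derivable f x 1 -> f y @[y --> x] --> f x.
Proof. by move=> /derivable1_diffP/differentiable_continuous. Qed.

Lemma is_derive_cvg {R : realType} (f : R -> R) (x df : R) :
  is_derive x 1 f df -> f y @[y --> x] --> f x.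
Proof. by move=> [fx _]; exact: derivable_cvg. Qed.

(** * The fractional kernel and its density *)

Section kernel.
Context {R : realType} (alpha : R).
Hypothesis alpha01 : 0 < alpha < 1.
Local Notation mu := (@lebesgue_measure R).

Let alpha0 : 0 < alpha. Proof. by case/andP: alpha01. Qed.
Let alpha1 : alpha < 1. Proof. by case/andP: alpha01. Qed.

(** Extension by 0 to [r <= 0] builds the limits of integration into the kernel: [kern (t - x)] only
    sees [x < t]. *)
Definition kern (r : R) : R := if 0 < r then r `^ (- alpha) else 0.

(** Minus the derivative of [kern]: the weight of the increments in the Marchaud form of the
    fractional derivative. *)
Definition dens (r : R) : R := if 0 < r then alpha * r `^ (- alpha - 1) else 0.

Lemma kern_ge0 r : 0 <= kern r.
Proof. by rewrite /kern; case: ifPn => // _; exact: powR_ge0. Qed.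

Lemma dens_ge0 r : 0 <= dens r.
Proof. by rewrite /dens; case: ifPn => // _; rewrite mulr_ge0 ?powR_ge0// ltW. Qed.

Lemma kern_le0 r : r <= 0 -> kern r = 0.
Proof. by rewrite /kern ltNge => ->. Qed.

Lemma kern_gt0 r : 0 < r -> kern r = r `^ (- alpha).
Proof. by rewrite /kern => ->. Qed.

Lemma ler_kern r s : 0 < r -> r <= s -> kern s <= kern r.
Proof.
move=> r0 rs; have s0 := lt_le_trans r0 rs.
rewrite !kern_gt0// !powRN lef_pV2 ?posrE ?powR_gt0//.
by apply: ge0_ler_powR => //; rewrite ?nnegrE; exact: ltW.
Qed.

Lemma measurable_kern : measurable_fun setT kern.
Proof.
by apply: measurable_fun_ifT => //; exact: measurable_fun_ltr.
Qed.

Lemma measurable_sqrt_kern : measurable_fun setT (fun r => Num.sqrt (kern r)).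
Proof.
rewrite (_ : (fun r => _) = fun r => kern r `^ 2^-1).
  exact: (measurableT_comp (measurable_powR _) measurable_kern).
by apply/funext => r; rewrite powR12_sqrt// kern_ge0.
Qed.

Lemma measurable_dens : measurable_fun setT dens.
Proof.
apply: measurable_fun_ifT => //; first exact: measurable_fun_ltr.
by apply: measurable_funM => //; exact: measurable_powR.
Qed.

Lemma powRN_cvg_pinfty : x `^ (- alpha) @[x --> +oo%R] --> (0 : R).
Proof.
apply/cvgrPdist_lt => e e0; near=> x.
have x0 : 0 < x by near: x; exact: nbhs_pinfty_gt.
rewrite sub0r normrN ger0_norm ?powR_ge0// powRN invf_plt ?posrE ?powR_gt0//.
have <- : (e^-1 `^ alpha^-1) `^ alpha = e^-1.
  by rewrite -powRrM mulVf ?gt_eqF// powRr1// invr_ge0 ltW.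
apply: gt0_ltr_powR; rewrite ?nnegrE ?powR_ge0 ?(ltW x0)//.
Unshelve. all: by end_near. Qed.

Lemma dens_tail (s : R) : 0 < s ->
  (\int[mu]_r (dens r * (s <= r)%R%:R)%:E = (kern s)%:E)%E.
Proof.
move=> s0.
have dF (x : R) : 0 < x ->
    is_derive x 1 (fun x => - x `^ (- alpha)) (alpha * x `^ (- alpha - 1)).
  by move=> x0; have := is_deriveN (is_derive1_powR (- alpha) x0); rewrite mulNr opprK.
transitivity (\int[mu]_(x in `[s, +oo[) (alpha * x `^ (- alpha - 1))%:E)%E.
  rewrite [RHS]integral_mkcond; apply: eq_integral => x _.
  rewrite patchE mem_setE in_itv/= andbT /dens; case: (leP s x) => sx.
    by rewrite (lt_le_trans s0 sx) mulr1.
  by rewrite mulr0.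
rewrite (@ge0_continuous_FTC2y _ _ (fun x => - x `^ (- alpha)) _ 0).
- by rewrite kern_gt0// sub0e -EFinN opprK.
- by move=> x _; rewrite mulr_ge0 ?powR_ge0// ltW.
- apply: continuous_in_subspaceT => x; rewrite inE/= in_itv/= andbT => sx.
  have x0 := lt_le_trans s0 sx.
  apply: cvgM; first exact: cvg_cst.
  exact: is_derive_cvg (is_derive1_powR _ x0).
- by rewrite -oppr0; apply: cvgN; exact: powRN_cvg_pinfty.
- by move=> x sx; by have [] := dF _ (lt_trans s0 sx).
- apply: cvg_at_right_filter.
  exact: is_derive_cvg (dF _ s0).
- move=> x; rewrite in_itv/= andbT => sx.
  by rewrite derive1E; have [_ ->] := dF _ (lt_trans s0 sx).
Qed.

Lemma dens_tail_integrable (s : R) : 0 < s ->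
  mu.-integrable setT (EFin \o (fun r => dens r * (s <= r)%R%:R)).
Proof.
move=> s0; apply/integrableP; split.
  apply/measurable_EFinP; apply: measurable_funM; first exact: measurable_dens.
  by apply: measurable_natb; exact: measurable_fun_ler.
under eq_integral do rewrite gee0_abs ?lee_fin ?mulr_ge0 ?dens_ge0//.
by rewrite dens_tail// ltry.
Qed.

Lemma dens_tailR (s : R) : 0 < s -> \int[mu]_r (dens r * (s <= r)%R%:R) = kern s.
Proof. by move=> s0; rewrite /Rintegral dens_tail. Qed.

Lemma kern_integral_bound (e T : R) : 0 < e -> e < T ->
  (\int[mu]_(x in `[e, T]) (kern x)%:E <= (T `^ (1 - alpha) / (1 - alpha))%:E)%E.
Proof.
move=> e0 eT.
have a1 : 1 - alpha != 0 by rewrite gt_eqF// subr_gt0.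
have dF (x : R) : 0 < x ->
    is_derive x 1 (fun x => (1 - alpha)^-1 * x `^ (1 - alpha)) (x `^ (- alpha)).
  move=> x0; have := is_deriveZ (1 - alpha)^-1 (is_derive1_powR (1 - alpha) x0).
  rewrite /GRing.scale/= mulrA mulVf// mul1r.
  by rewrite (_ : 1 - alpha - 1 = - alpha)//; ring.
have -> : (\int[mu]_(x in `[e, T]) (kern x)%:E =
    \int[mu]_(x in `[e, T]) (x `^ (- alpha))%:E)%E.
  apply: eq_integral => x; rewrite inE/= in_itv/= => /andP[ex _].
  by rewrite kern_gt0// (lt_le_trans e0 ex).
rewrite (@continuous_FTC2 _ _ (fun x => (1 - alpha)^-1 * x `^ (1 - alpha)))//.
- rewrite -EFinB lee_fin [X in X - _]mulrC gerBl.
  by rewrite mulr_ge0 ?powR_ge0// invr_ge0 subr_ge0 ltW.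
- apply: continuous_in_subspaceT => x; rewrite inE/= in_itv/= => /andP[ex _].
  exact: is_derive_cvg (is_derive1_powR _ (lt_le_trans e0 ex)).
- split.
  + move=> x; rewrite in_itv/= => /andP[ex _].
    by have [] := dF _ (lt_trans e0 ex).
  + apply: cvg_at_right_filter.
    exact: is_derive_cvg (dF _ e0).
  + apply: cvg_at_left_filter.
    exact: is_derive_cvg (dF _ (lt_trans e0 eT)).
- move=> x; rewrite in_itv/= => /andP[ex _].
  by rewrite derive1E; have [_ ->] := dF _ (lt_trans e0 ex).
Qed.

Lemma kern_integrable (T : R) :
  mu.-integrable setT (EFin \o (fun r => kern r * (r <= T)%R%:R)).
Proof.
have mk : measurable_fun setT (fun r => kern r * (r <= T)%R%:R).
  apply: measurable_funM; first exact: measurable_kern.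
  by apply: measurable_natb; exact: measurable_fun_ler.
have [T0|T0] := leP T 0.
  rewrite (_ : _ \o _ = cst 0%E); first exact: integrable0.
  apply/funext => r /=; case: (leP r T) => rT; last by rewrite mulr0.
  by rewrite kern_le0 ?mul0r// (le_trans rT).
apply/integrableP; split; first exact/measurable_EFinP.
(* The kernel is singular at 0, so ]0, T] is exhausted by segments away from 0; [n.+2] makes them
   nondegenerate, as [kern_integral_bound] asks. *)
pose F (n : nat) := `[T / n.+2%:R, T]%classic.
have Fn0 n : 0 < T / n.+2%:R by rewrite divr_gt0.
have FT n : T / n.+2%:R < T by rewrite ltr_pdivrMr// ltr_pMr// ltr1n.
rewrite [X in (X < _)%E](_ : _ =
    (\int[mu]_x ((EFin \o kern) \_ (\bigcup_n F n)) x)%E); last first.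
  apply: eq_integral.
  move=> r _ /=; rewrite ger0_norm; last by rewrite mulr_ge0// kern_ge0.
  rewrite patchE; case: ifPn => [|].
    by rewrite inE => -[n _]; rewrite /F/= in_itv/= => /andP[_ ->]; rewrite mulr1.
  move=> /negP nr; congr EFin; have [r0|r0] := leP r 0; first by rewrite kern_le0 ?mul0r.
  case: (leP r T) => rT; last by rewrite mulr0.
  exfalso; apply: nr; rewrite inE; exists (Num.truncn (T / r)) => //=.
  rewrite /F/= in_itv/= rT andbT ler_pdivrMr// mulrC -ler_pdivrMr//.
  by rewrite ltW// (lt_le_trans (truncnS_gt _))// ler_nat.
rewrite -integral_mkcond.
have nF : nondecreasing_seq F.
  apply/nondecreasing_seqP => n; apply/subsetPset => r.
  rewrite /F/= !in_itv/= => /andP[+ ->]; rewrite andbT; apply: le_trans.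
  by rewrite ler_pM2l// lef_pV2 ?posrE// ler_nat.
have cF := @ge0_nondecreasing_set_cvg_integral _ (measurableTypeR R) _ F (EFin \o kern) mu nF.
have mkE D : measurable_fun D (EFin \o kern).
  by apply/measurable_EFinP/measurable_funTS; exact: measurable_kern.
have f0 i x : F i x -> (0 <= (EFin \o kern) x)%E by rewrite lee_fin kern_ge0.
have {}cF := cF (fun=> measurable_itv _) (fun=> mkE _) f0.
rewrite -(cvg_lim _ cF)//.
apply: (@le_lt_trans _ _ (T `^ (1 - alpha) / (1 - alpha))%:E); last exact: ltry.
apply: lime_le; first exact: cvgP cF.
by apply: nearW => n; exact: kern_integral_bound.
Qed.

End kernel.

Section product_integrable.
Context d1 d2 (X : measurableType d1) (Y : measurableType d2) (R : realType).
Variable m1 : {sigma_finite_measure set X -> \bar R}.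
Variable m2 : {sigma_finite_measure set Y -> \bar R}.

Lemma integrable_prodM (p : X -> R) (q : Y -> R) :
  m1.-integrable setT (EFin \o p) -> m2.-integrable setT (EFin \o q) ->
  (m1 \x m2)%E.-integrable setT (EFin \o (fun z => p z.1 * q z.2)).
Proof.
move=> pi qi.
have mp : measurable_fun setT p by apply/measurable_EFinP; exact: measurable_int pi.
have mq : measurable_fun setT q by apply/measurable_EFinP; exact: measurable_int qi.
apply/integrable12ltyP.
  apply/measurable_EFinP; apply: measurable_funM.
    exact: measurableT_comp mp measurable_fst.
  exact: measurableT_comp mq measurable_snd.
have /integrableP[_ pi'] := pi; have /integrableP[_ qi'] := qi.
have -> : (\int[m1]_x \int[m2]_y `|(p x * q y)%:E| =
   \int[m1]_x (`|(p x)%:E| * \int[m2]_y `|(q y)%:E|))%E.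
  apply: eq_integral => x _; rewrite -ge0_integralZl//.
    by apply: eq_integral => y _; rewrite EFinM abseM.
  by apply: measurableT_comp => //; exact/measurable_EFinP.
rewrite ge0_integralZr//.
- rewrite lte_mul_pinfty//; first exact: integral_ge0.
  by rewrite ge0_fin_numE//; exact: integral_ge0.
- by apply: measurableT_comp => //; exact/measurable_EFinP.
- exact: integral_ge0.
Qed.

End product_integrable.

Lemma Rintegral_eq0 d (X : measurableType d) (R : realType)
    (mu : {measure set X -> \bar R}) (f : X -> R) :
  (forall x, f x = 0) -> \int[mu]_x f x = 0.
Proof.
move=> f0; rewrite /Rintegral integral0_eq// => x _.
by rewrite f0.
Qed.

Section kernel_layer.
Context {R : realType} (alpha : R).
Hypothesis alpha01 : 0 < alpha < 1.
Local Notation mu := (@lebesgue_measure R).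
Local Notation kern := (kern alpha).
Local Notation dens := (dens alpha).

Lemma integrableR_measurable (q : R -> R) :
  mu.-integrable setT (EFin \o q) -> measurable_fun setT q.
Proof. by move=> qi; apply/measurable_EFinP; exact: measurable_int qi. Qed.

Lemma integrable_mulb (q : R -> R) (p : R -> bool) : measurable_fun setT p ->
  mu.-integrable setT (EFin \o q) ->
  mu.-integrable setT (EFin \o (fun x => q x * (p x)%:R)).
Proof.
move=> mp qi; have mq := integrableR_measurable qi.
apply: le_integrable qi => //.
  by apply/measurable_EFinP; apply: measurable_funM => //; exact: measurable_natb.
move=> x _ /=; rewrite lee_fin normrM ler_piMr//.
by case: (p x); rewrite ?normr1 ?normr0.
Qed.

Let measurable_between (l : R -> R) r : measurable_fun setT l ->
  measurable_fun setT (fun x => (0 < l x) && (l x <= r)).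
Proof.
move=> ml; apply: measurable_and; first exact: measurable_fun_ltr.
exact: measurable_fun_ler.
Qed.

(* [kern s] is the integral of [dens r] over [r >= s]. *)
Lemma kern_layer (q l : R -> R) : measurable_fun setT l ->
  mu.-integrable setT (EFin \o q) ->
  mu.-integrable setT (EFin \o (fun x => q x * kern (l x))) ->
  mu.-integrable setT (EFin \o
    (fun r => dens r * \int[mu]_x (q x * ((0 < l x) && (l x <= r))%:R))) /\
  \int[mu]_x (q x * kern (l x)) =
  \int[mu]_r (dens r * \int[mu]_x (q x * ((0 < l x) && (l x <= r))%:R)).
Proof.
move=> ml qi qki; have mq := integrableR_measurable qi.
pose f (z : plane R) : R :=
  q z.1 * (0 < l z.1)%R%:R * (dens z.2 * (l z.1 <= z.2)%R%:R).
have ml1 : measurable_fun setT (fun z : plane R => l z.1).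
  exact: measurableT_comp ml measurable_fst.
have mf : measurable_fun setT f.
  apply: measurable_funM; apply: measurable_funM.
  - exact: measurableT_comp mq measurable_fst.
  - by apply: measurable_natb; apply: measurable_fun_ltr.
  - exact: measurableT_comp (measurable_dens alpha) measurable_snd.
  - by apply: measurable_natb; apply: measurable_fun_ler.
have fi : (mu \x mu)%E.-integrable setT (EFin \o f).
  apply/integrable12ltyP; first exact/measurable_EFinP.
  have /integrableP[_] := qki; apply: le_lt_trans.
  rewrite le_eqVlt; apply/orP; left; apply/eqP/eq_integral => x _.
  have [lx|lx] := ltP 0 (l x); last first.
    rewrite integral0_eq; last first.
      by move=> r _; rewrite /f /= ltNge lx mulr0 mul0r normr0.
    by rewrite /= kern_le0// mulr0 normr0.
  have -> : (\int[mu]_r `|(EFin \o f) (x, r)| =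
      \int[mu]_r (`|q x|%:E * (dens r * (l x <= r)%R%:R)%:E))%E.
    apply: eq_integral => r _; rewrite /f /= lx mulr1 normrM EFinM.
    by rewrite [X in (_ * X%:E)%E]ger0_norm// mulr_ge0// dens_ge0.
  rewrite ge0_integralZl//.
  - by rewrite dens_tail// /= -EFinM normrM [X in _ = (_ * X)%:E]ger0_norm ?kern_ge0.
  - apply/measurable_EFinP; apply: measurable_funM; first exact: measurable_dens.
    by apply: measurable_natb; exact: measurable_fun_ler.
  - by move=> r _; rewrite lee_fin mulr_ge0// dens_ge0.
have f1 x : \int[mu]_r f (x, r) = q x * kern (l x).
  have [lx|lx] := ltP 0 (l x); last first.
    rewrite kern_le0// mulr0; apply: Rintegral_eq0 => r.
    by rewrite /f /= ltNge lx mulr0 mul0r.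
  rewrite -(dens_tailR alpha01 lx) -RintegralZl//; last exact: dens_tail_integrable.
  by apply: eq_Rintegral => r _; rewrite /f /= lx mulr1.
have f2 r : \int[mu]_x f (x, r) =
    dens r * \int[mu]_x (q x * ((0 < l x) && (l x <= r))%:R).
  rewrite -RintegralZl//; last by apply: integrable_mulb => //; exact: measurable_between.
  apply: eq_Rintegral => x _; rewrite /f /= -mulnb natrM; ring.
split.
  have := integrable_Rintegral2 fi; apply: eq_integrable => // r _.
  by rewrite /= f2.
have := Rintegral_swap fi.
under eq_Rintegral do rewrite f1.
by under [X in _ = X -> _]eq_Rintegral do rewrite f2.
Qed.

End kernel_layer.

(** * Coercivity of the fractional derivative in one variable *)

Section one_dimensional.
Context {R : realType} (alpha : R).
Hypothesis alpha01 : 0 < alpha < 1.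
Local Notation mu := (@lebesgue_measure R).
Local Notation kern := (kern alpha).
Local Notation dens := (dens alpha).

Let alpha0 : 0 < alpha. Proof. by case/andP: alpha01. Qed.

Lemma integrable_itvb (a T : R) :
  mu.-integrable setT (EFin \o (fun x => ((a < x) && (x < T))%R%:R)).
Proof.
have := @integrable_indic_itv R a T false true.
apply: eq_integrable => // x _ /=; congr EFin.
by rewrite indicE mem_setE in_itv.
Qed.

Lemma integrable_bounded_itv (a T B : R) (q : R -> R) : measurable_fun setT q ->
  (forall x, `|q x| <= B) -> (forall x, ~~ (a < x < T) -> q x = 0) ->
  mu.-integrable setT (EFin \o q).
Proof.
move=> mq qB q0; apply: (integrable_le _ (integrableZR B (integrable_itvb a T))) => [//|x].
have [|/q0 ->] := boolP (a < x < T); first by rewrite mulr1.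
by rewrite normr0 mulr0.
Qed.

Lemma integrable_kern_left (a T B : R) (q : R -> R) : measurable_fun setT q ->
  (forall x, `|q x| <= B) -> (forall x, ~~ (a < x < T) -> q x = 0) ->
  mu.-integrable setT (EFin \o (fun x => q x * kern (x - a))).
Proof.
move=> mq qB q0.
have ki := integrableZR B (integrable_translation (- a) (kern_integrable alpha01 (T - a))).
apply: (integrable_le _ ki) => [|x].
  apply: measurable_funM => //.
  exact: measurableT_comp (measurable_kern alpha) (measurable_translation (- a)).
have B0 : 0 <= B := le_trans (normr_ge0 _) (qB 0).
have [/andP[ax xT]|/q0 ->] := boolP (a < x < T).
  rewrite lerD2r (ltW xT) mulr1 normrM [X in _ * X]ger0_norm ?kern_ge0//.
  by rewrite ler_wpM2r ?kern_ge0.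
by rewrite mul0r normr0 !mulr_ge0// kern_ge0.
Qed.

Lemma integrable_itvb_kern (T : R) : mu.-integrable setT
  (EFin \o (fun t => ((0 < t) && (t < T))%R%:R * kern t)).
Proof.
have := @integrable_kern_left 0 T 1 (fun t => ((0 < t) && (t < T))%R%:R).
under [X in _ -> _ -> _ -> mu.-integrable setT (EFin \o X)]eq_fun do rewrite subr0.
apply.
- exact: integrableR_measurable (integrable_itvb 0 T).
- by move=> x; case: (_ && _); rewrite ?normr1 ?normr0.
- by move=> x /negbTE ->.
Qed.

Lemma integrable_kern_right (a T B c : R) (q : R -> R) : measurable_fun setT q ->
  (forall x, `|q x| <= B) -> (forall x, ~~ (a < x < T) -> q x = 0) ->
  mu.-integrable setT (EFin \o (fun x => q x * kern (c - x))).
Proof.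
move=> mq qB q0.
have ki := integrableZR B
  (integrable_opp (integrable_translation c (kern_integrable alpha01 (c - a)))).
apply: (integrable_le _ ki) => [|x].
  apply: measurable_funM => //.
  by apply: measurableT_comp (measurable_kern alpha) _; exact: measurable_funB.
have B0 : 0 <= B := le_trans (normr_ge0 _) (qB 0).
rewrite [- x + c]addrC.
have [/andP[ax xT]|/q0 ->] := boolP (a < x < T).
  rewrite lerD2l lerN2 (ltW ax) mulr1 normrM [X in _ * X]ger0_norm ?kern_ge0//.
  by rewrite ler_wpM2r ?kern_ge0.
by rewrite mul0r normr0 !mulr_ge0// kern_ge0.
Qed.

Variables (a T L M : R) (phi psi : R -> R).
Hypothesis mphi : measurable_fun setT phi.
Hypothesis mpsi : measurable_fun setT psi.
Hypothesis phiM : forall x, `|phi x| <= M.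
Hypothesis psiL : forall x, `|psi x| <= L.
Hypothesis phi0 : forall x, ~~ (a < x < T) -> phi x = 0.
Hypothesis psi0 : forall x, ~~ (a < x < T) -> psi x = 0.
(** [phi] is a function on (a, T) extended by zero. It may jump at [a], hence [a < x], but not at
    [T], hence no upper bound on [y]. *)
Hypothesis FTC : forall x y, a < x < T -> x <= y ->
  phi y - phi x = \int[mu]_t (psi t * ((x < t) && (t <= y))%R%:R).

Let M0 : 0 <= M. Proof. exact: le_trans (normr_ge0 _) (phiM 0). Qed.
Let L0 : 0 <= L. Proof. exact: le_trans (normr_ge0 _) (psiL 0). Qed.

(* right-sided Caputo derivative of [phi], up to the factor [1 / Gamma (1 - alpha)] *)
Definition rcaputo (x : R) := - \int[mu]_t (psi t * kern (t - x)).

Let psi_int : mu.-integrable setT (EFin \o psi).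
Proof. exact: (@integrable_bounded_itv a T L). Qed.

(** The layer formula writes [kern] as a superposition of indicators of (x, x + r], and [psi]
    integrates to an increment of [phi] on each of them. The result is the Marchaud form, in which
    the derivative of [phi] no longer appears. *)
Lemma rcaputo_dens x : a < x < T ->
  rcaputo x = \int[mu]_r (dens r * (phi x - phi (x + r))).
Proof.
move=> axT; have /andP[ax xT] := axT.
have ki : mu.-integrable setT (EFin \o (fun t => psi t * kern (t - x))).
  have := integrable_kern_left (a := x) (T := T) (B := L)
    (q := fun t => psi t * (x < t)%R%:R).
  have -> : (fun t => psi t * (x < t)%R%:R * kern (t - x)) =
      (fun t => psi t * kern (t - x)).
    apply/funext => t; case: ltP => tx; first by rewrite mulr1.
    by rewrite kern_le0 ?mulr0// subr_le0.
  apply.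
  - apply: measurable_funM => //; apply: measurable_natb.
    exact: measurable_fun_ltr.
  - move=> t; rewrite normrM (le_trans _ (psiL t))// ler_piMr//.
    by case: (_ < _); rewrite ?normr1 ?normr0.
  - move=> t; case: ltP => xt /=; rewrite ?mulr0// mulr1 => tT.
    by apply: psi0; rewrite negb_and tT orbT.
have [ |_ E] := kern_layer alpha01 (l := fun t => t - x) _ psi_int ki.
  exact: measurable_translation.
rewrite /rcaputo E -mulN1r -RintegralZl//; last first.
  by have [] := kern_layer alpha01 (measurable_translation (- x)) psi_int ki.
apply: eq_Rintegral => r _; rewrite mulrCA mulN1r.
have [r0|r0] := leP r 0; first by rewrite /dens ltNge r0 !mul0r.
congr (_ * _); rewrite -[RHS]opprB FTC ?lerDl ?(ltW r0)//; congr (- _).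
by apply: eq_Rintegral => t _; rewrite subr_gt0 lerBlDl.
Qed.

Lemma phi_lipschitz x r : a < x < T -> 0 <= r -> `|phi x - phi (x + r)| <= L * r.
Proof.
move=> axT r0; rewrite distrC FTC ?lerDl//.
have bi : mu.-integrable setT (EFin \o (fun t => ((x < t) && (t <= x + r))%R%:R)).
  have := @integrable_indic_itv R x (x + r) false false.
  apply: eq_integrable => // t _ /=; congr EFin.
  by rewrite indicE mem_setE in_itv.
have mb : measurable_fun setT (fun t : R => (x < t) && (t <= x + r)).
  by apply: measurable_and; [exact: measurable_fun_ltr|exact: measurable_fun_ler].
rewrite (le_trans (le_normr_Rintegral _ _))//; first exact: integrable_mulb.
apply: (@le_trans _ _ (\int[mu]_t (L * ((x < t) && (t <= x + r))%R%:R))).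
  apply: le_Rintegral => //.
  - by apply: integrable_norm; exact: integrable_mulb.
  - exact: integrableZR.
  - by move=> t _; rewrite normrM [X in _ * X]ger0_norm// ler_wpM2r.
rewrite RintegralZl// ler_wpM2l//.
have -> : \int[mu]_t ((x < t) && (t <= x + r))%R%:R = \int[mu]_t \1_(`]x, x + r]) t.
  by apply: eq_Rintegral => t _; rewrite indicE mem_setE in_itv.
have E : fine (mu `]x, x + r]%classic) = r.
  rewrite lebesgue_measure_itv/= lte_fin ltrDl; move: r0.
  by rewrite le_eqVlt => /orP[/eqP <-|->] /=; rewrite ?ltxx// addrAC subrr add0r.
by rewrite /Rintegral integral_indic// setIT -[leRHS]E; exact: lexx.
Qed.

(** Below [r = 1] the Lipschitz bound turns [dens r] into [alpha * kern r], integrable at 0; above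
    it the bound [2 * M] leaves the integrable tail of [dens]. *)
Let dom r := L * alpha * (kern r * (r <= 1)%R%:R) + 2 * M * (dens r * (1 <= r)%R%:R).

Let dom_int : mu.-integrable setT (EFin \o dom).
Proof.
apply: integrableDR; apply: integrableZR; first exact: kern_integrable.
exact: dens_tail_integrable.
Qed.

Let dom_ge0 r : 0 <= dom r.
Proof. by rewrite /dom addr_ge0// !mulr_ge0// ?kern_ge0 ?dens_ge0// ltW. Qed.

Let dens_diff_le x r : a < x < T -> `|dens r * (phi x - phi (x + r))| <= dom r.
Proof.
move=> axT; rewrite normrM ger0_norm ?dens_ge0//.
have [r0|r0] := leP r 0; first by rewrite {1}/dens ltNge r0 mul0r.
rewrite /dom; have [r1|r1] := leP r 1.
  rewrite mulr1 ler_wpDr ?mulr_ge0 ?dens_ge0//.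
  rewrite (le_trans (ler_wpM2l (dens_ge0 alpha01 _) (phi_lipschitz axT (ltW r0))))//.
  rewrite /dens r0 kern_gt0//.
  have -> : r `^ (- alpha) = r `^ (- alpha - 1) * r.
    rewrite -[in X in _ = _ * X](powRr1 (ltW r0)) -powRD ?subrK//.
    by apply/implyP => _; rewrite gt_eqF.
  by rewrite le_eqVlt; apply/orP; left; apply/eqP; ring.
rewrite mulr0 mulr0 add0r (ltW r1) mulr1 mulrC ler_wpM2r ?dens_ge0//.
by rewrite (le_trans (ler_normB _ _))// mulrDl mul1r lerD.
Qed.

Section against.
Variables (g : R -> R) (B : R).
Hypothesis mg : measurable_fun setT g.
Hypothesis gB : forall x, `|g x| <= B.
Hypothesis g0 : forall x, ~~ (a < x < T) -> g x = 0.

Let Phi (z : plane R) : R :=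
  g z.1 * (dens z.2 * (phi z.1 - phi (z.1 + z.2))).

Let Phi_int : (mu \x mu)%E.-integrable setT (EFin \o Phi).
Proof.
have gi : mu.-integrable setT (EFin \o (fun x => B * ((a < x) && (x < T))%R%:R)).
  exact: integrableZR (integrable_itvb _ _).
apply: (integrable_le _ (integrable_prodM gi dom_int)).
  apply: measurable_funM; first exact: measurableT_comp mg measurable_fst.
  apply: measurable_funM.
    exact: measurableT_comp (measurable_dens alpha) measurable_snd.
  apply: measurable_funB; first exact: measurableT_comp mphi measurable_fst.
  by apply: measurableT_comp mphi _; exact: measurable_funD.
move=> [x r]; rewrite /Phi /=.
have B0 : 0 <= B := le_trans (normr_ge0 _) (gB 0).
have [axT|/g0 ->] := boolP (a < x < T); last by rewrite mul0r normr0 mulr0 mul0r.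
by rewrite mulr1 normrM ler_pM// dens_diff_le.
Qed.

Lemma rcaputo_against :
  mu.-integrable setT (EFin \o (fun x => g x * rcaputo x)) /\
  mu.-integrable setT (EFin \o
    (fun r => dens r * \int[mu]_x (g x * (phi x - phi (x + r))))) /\
  \int[mu]_x (g x * rcaputo x) =
  \int[mu]_r (dens r * \int[mu]_x (g x * (phi x - phi (x + r)))).
Proof.
have gi : mu.-integrable setT (EFin \o g) by exact: (@integrable_bounded_itv a T B).
have D2 r : mu.-integrable setT (EFin \o (fun x => g x * (phi x - phi (x + r)))).
  apply: (@integrable_bounded_itv a T (B * (2 * M))).
  - apply: measurable_funM => //; apply: measurable_funB => //.
    exact: measurableT_comp mphi (measurable_translation r).
  - move=> x; rewrite normrM ler_pM// (le_trans (ler_normB _ _))// mulrDl mul1r.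
    exact: lerD.
  - by move=> x /g0 ->; rewrite mul0r.
have P1 x : \int[mu]_r Phi (x, r) = g x * rcaputo x.
  have [axT|/g0 gx] := boolP (a < x < T); last first.
    by rewrite gx mul0r; apply: Rintegral_eq0 => r; rewrite /Phi/= gx mul0r.
  rewrite rcaputo_dens// -RintegralZl//.
  apply: (integrable_le _ dom_int) => [|r]; last exact: dens_diff_le.
  apply: measurable_funM; first exact: measurable_dens.
  apply: measurable_funB => //; apply: measurableT_comp mphi _.
  exact: measurable_funD.
have P2 r : \int[mu]_x Phi (x, r) = dens r * \int[mu]_x (g x * (phi x - phi (x + r))).
  by rewrite -RintegralZl//; apply: eq_Rintegral => x _; rewrite /Phi/= mulrCA.
split.
  by have := integrable_Rintegral1 Phi_int; apply: eq_integrable => // x _ /=; rewrite P1.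
split.
  by have := integrable_Rintegral2 Phi_int; apply: eq_integrable => // x _ /=; rewrite P2.
have := Rintegral_swap Phi_int.
under eq_Rintegral do rewrite P1.
by under [X in _ = X -> _]eq_Rintegral do rewrite P2.
Qed.

End against.

Let phi_int : mu.-integrable setT (EFin \o phi).
Proof. exact: (@integrable_bounded_itv a T M). Qed.

(** Integrated over (a, T), the increment of step [r] telescopes to the integral of [phi] over (a, a
    + r], and summation against [dens] rebuilds [kern (x - a)]. This boundary term at [a] is where
    the initial datum will enter. *)
Lemma integral_rcaputo :
  \int[mu]_x (((a < x) && (x < T))%R%:R * rcaputo x) =
  \int[mu]_x (phi x * kern (x - a)).
Proof.
have mitv : measurable_fun setT (fun x : R => ((a < x) && (x < T))%R).
  by apply: measurable_and; exact: measurable_fun_ltr.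
have [||_ [_ ->]] := @rcaputo_against (fun x => ((a < x) && (x < T))%R%:R) 1
    (measurable_natb mitv).
- by move=> x; case: (_ && _); rewrite ?normr1 ?normr0.
- by move=> x /negbTE ->.
have [ |_ ->] := kern_layer alpha01 (l := fun t => t - a) _ phi_int
    (integrable_kern_left mphi phiM phi0).
  exact: measurable_translation.
apply: eq_Rintegral => r _.
have [r0|r0] := leP r 0; first by rewrite /dens ltNge r0 !mul0r.
congr (_ * _).
(* [K (x + r)] is [phi (x + r)] restricted to [a < x], so that the translation by [r] can be undone
   under the integral. *)
pose K x := phi x * (a < x - r)%R%:R.
have Ki : mu.-integrable setT (EFin \o K).
  by apply: integrable_mulb => //; apply: measurable_fun_ltr => //; exact: measurable_funB.
have -> : \int[mu]_x (((a < x) && (x < T))%R%:R * (phi x - phi (x + r))) =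
    \int[mu]_x (phi x - K (x + r)).
  apply: eq_Rintegral => x _; rewrite /K addrK.
  have [ax|xa] := ltP a x; last by rewrite mul0r mulr0 phi0 ?subr0// ltNge xa.
  have [xT|Tx] := ltP x T; first by rewrite mul1r mulr1.
  rewrite mul0r !phi0 ?mul0r ?subr0// !negb_and -!leNgt ?Tx ?orbT//.
  by rewrite (le_trans Tx) ?orbT// lerDl ltW.
rewrite RintegralB//; last exact: integrable_translation.
rewrite Rintegral_translation; last exact: integrableR_measurable.
rewrite -RintegralB//; apply: eq_Rintegral => x _.
rewrite /K subr_gt0.
have [ax|xa] := ltP a x; last by rewrite phi0 ?mul0r ?subr0// ltNge xa.
have -> : (a < x - r) = ~~ (x - a <= r) by rewrite -ltNge ltrBrDl ltrBrDr addrC.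
by case: (x - a <= r); rewrite /= ?mulr0 ?mulr1 ?subr0 ?subrr.
Qed.

Section coercivity.
Variable t0 : R.

(* The drop of this weight at [t0] leaves [phi t0] in the energy balance, paired
   with the kernel looking back from [t0]. *)
Definition jump (x : R) : R := 1 + (x < t0)%R%:R.

Lemma jump_ge1 x : 1 <= jump x.
Proof. by rewrite /jump lerDl. Qed.

Lemma measurable_jump : measurable_fun setT jump.
Proof.
apply: measurable_funD => //; apply: measurable_natb.
exact: measurable_fun_ltr.
Qed.

Lemma measurable_jumpV : measurable_fun setT (fun x => (jump x)^-1).
Proof.
rewrite (_ : (fun x => _) = (fun x : R => if x < t0 then 2^-1 else 1)).
  by apply: measurable_fun_ifT => //; exact: measurable_fun_ltr.
apply/funext => x; rewrite /jump; case: (x < t0) => /=; last by rewrite addr0 invr1.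
by rewrite -[1 + 1]/(2%:R).
Qed.

Let v x := phi x / jump x.

Let jump_gt0 x : 0 < jump x. Proof. exact: lt_le_trans (jump_ge1 x). Qed.

Let phiE x : phi x = jump x * v x.
Proof. by rewrite /v mulrCA divff ?mulr1// gt_eqF. Qed.

Let mv : measurable_fun setT v.
Proof. by apply: measurable_funM => //; exact: measurable_jumpV. Qed.

Let vM x : `|v x| <= M.
Proof.
have px : `|phi x| = jump x * `|v x|.
  by rewrite {1}phiE normrM ger0_norm// ltW.
by have := phiM x; rewrite px; apply: le_trans; rewrite ler_peMl// jump_ge1.
Qed.

Let v0 x : ~~ (a < x < T) -> v x = 0.
Proof. by move=> /phi0 px; rewrite /v px mul0r. Qed.

Let v2 x := v x ^+ 2.
Let mv2 : measurable_fun setT v2. Proof. exact: measurable_funX. Qed.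
Let v2M x : `|v2 x| <= M ^+ 2.
Proof. by rewrite normrX lerXn2r ?nnegrE. Qed.
Let v20 x : ~~ (a < x < T) -> v2 x = 0.
Proof. by move=> /v0 vx; rewrite /v2 vx expr0n. Qed.
Let v2i : mu.-integrable setT (EFin \o v2).
Proof. exact: (@integrable_bounded_itv a T (M ^+ 2)). Qed.

Let H x := jump x * v2 x.
Let Hi : mu.-integrable setT (EFin \o H).
Proof.
apply: (@integrable_bounded_itv a T (2 * M ^+ 2)).
- by apply: measurable_funM => //; exact: measurable_jump.
- move=> x; rewrite normrM ler_pM// ger0_norm ?(ltW (jump_gt0 _))//.
  by rewrite /jump; case: (x < t0) => /=; lra.
- by move=> x /v20; rewrite /H => ->; rewrite mulr0.
Qed.

Let mbetween (l : R -> R) r : measurable_fun setT l ->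
  measurable_fun setT (fun x => (0 < l x) && (l x <= r)).
Proof.
move=> ml; apply: measurable_and; first exact: measurable_fun_ltr.
exact: measurable_fun_ler.
Qed.

Let mleft : measurable_fun setT (fun x : R => x - a).
Proof. exact: measurable_translation. Qed.
Let mright : measurable_fun setT (fun x : R => t0 - x).
Proof. exact: measurable_funB. Qed.

(** With [phi] = m v, expanding m(x + r) (v(x) - v(x + r))^2 >= 0 bounds twice the integrand below
    by (m(x) - m(x + r)) v(x)^2 + m(x) v(x)^2 - m(x + r) v(x + r)^2. The first term is v^2 on [t0 -
    r, t0), where the step [r] crosses the drop of m; the others telescope to the mass of m v^2 on
    (a, a + r], and m >= 1. *)
Let difference_le r : 0 < r ->
  2^-1 * (\int[mu]_x (v2 x * ((0 < t0 - x) && (t0 - x <= r))%R%:R) +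
          \int[mu]_x (v2 x * ((0 < x - a) && (x - a <= r))%R%:R))
  <= \int[mu]_x (v x * (phi x - phi (x + r))).
Proof.
move=> r0.
(* Where [x <= a] the integrand vanishes but [H (x + r)] need not; [K (x + r)] compensates it there,
   and its integral is the mass at the entry. *)
pose K x := H x * (x - r <= a)%R%:R.
have Ki : mu.-integrable setT (EFin \o K).
  by apply: integrable_mulb => //; apply: measurable_fun_ler => //; exact: measurable_funB.
pose I1 x := v2 x * ((0 < t0 - x) && (t0 - x <= r))%R%:R.
pose I2 x := v2 x * ((0 < x - a) && (x - a <= r))%R%:R.
have I1i : mu.-integrable setT (EFin \o I1) by apply: integrable_mulb => //; exact: mbetween.
have I2i : mu.-integrable setT (EFin \o I2) by apply: integrable_mulb => //; exact: mbetween.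
have Di : mu.-integrable setT (EFin \o (fun x => v x * (phi x - phi (x + r)))).
  apply: (@integrable_bounded_itv a T (M * (2 * M))).
  - apply: measurable_funM => //; apply: measurable_funB => //.
    exact: measurableT_comp mphi (measurable_translation r).
  - move=> x; rewrite normrM ler_pM// (le_trans (ler_normB _ _))// mulrDl mul1r.
    exact: lerD.
  - by move=> x /v0 ->; rewrite mul0r.
have HTi := integrable_translation r Hi.
have KTi := integrable_translation r Ki.
have I2K : \int[mu]_x I2 x <= \int[mu]_x K x.
  apply: le_Rintegral => // x _; rewrite /I2 /K /H.
  rewrite [X in X <= _](_ : _ = v2 x * (x - a <= r)%R%:R).
    rewrite (_ : (x - r <= a) = (x - a <= r)); last by rewrite !lerBlDr addrC.
    by rewrite ler_wpM2r// ler_peMl ?sqr_ge0// jump_ge1.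
  rewrite subr_gt0; have [//|xa] := ltP a x.
  by rewrite v20 ?mul0r// ltNge xa.
have pw x : 2^-1 * (I1 x + H x) + 2^-1 * (K (x + r) - H (x + r)) <=
    v x * (phi x - phi (x + r)).
  rewrite /K addrK !phiE /H /I1 /v2.
  have jx := jump_ge1 (x + r).
  have key : jump (x + r) <= jump x.
    rewrite /jump lerD2l ler_nat; have [_|x0] := ltP x t0; first exact: leq_b1.
    by rewrite ltNge (le_trans x0)// lerDl ltW.
  have [xa|ax] := leP x a.
    rewrite v0 ?ltNge ?xa//= expr0n /= !mulr0 !mul0r mulr1; lra.
  rewrite mulr0 sub0r.
  have key2 : v x ^+ 2 * ((0 < t0 - x) && (t0 - x <= r))%R%:R <=
      v x ^+ 2 * (jump x - jump (x + r)).
    rewrite ler_wpM2l ?sqr_ge0//.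
    have [/andP[x0 xr]|_] := boolP (_ && _); last by rewrite subr_ge0.
    rewrite /jump -[x < t0]subr_gt0 x0.
    have -> /= : (x + r < t0) = false by rewrite ltNge -lerBlDl xr.
    lra.
  have : 0 <= jump (x + r) * (v x - v (x + r)) ^+ 2.
    by rewrite mulr_ge0 ?sqr_ge0// (le_trans _ jx).
  move: key2; move: (v x ^+ 2 * (_)%:R) => z; lra.
have -> : 2^-1 * (\int[mu]_x I1 x + \int[mu]_x I2 x) =
    2^-1 * (\int[mu]_x I1 x + \int[mu]_x H x) +
    2^-1 * (\int[mu]_x I2 x - \int[mu]_x H (x + r)).
  rewrite Rintegral_translation; last exact: integrableR_measurable.
  by ring.
apply: (@le_trans _ _ (\int[mu]_x
  (2^-1 * (I1 x + H x) + 2^-1 * (K (x + r) - H (x + r))))).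
  rewrite RintegralD//; last 2 first.
  - by apply: integrableZR; exact: integrableDR.
  - apply: integrableZR; apply: integrableDR => //.
    by under eq_fun do rewrite -mulN1r; exact: integrableZR.
  rewrite RintegralZl//; last exact: integrableDR.
  rewrite RintegralD// lerD2l RintegralZl//; last first.
    apply: integrableDR => //.
    by under eq_fun do rewrite -mulN1r; exact: integrableZR.
  rewrite ler_wpM2l// RintegralB// lerD2r.
  by rewrite [leRHS]Rintegral_translation//; exact: integrableR_measurable.
apply: le_Rintegral => //.
apply: integrableDR; apply: integrableZR; first exact: integrableDR.
apply: integrableDR => //.
by under eq_fun do rewrite -mulN1r; exact: integrableZR.
Qed.

(** The estimates for the steps [r] are summed against [dens], which turns the two indicator masses
    into kernels. The first looks back from [t0]; the second comes from the jump of the zero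
    extension at [a]. *)
Lemma rcaputo_coercive :
  2^-1 * (\int[mu]_x (v x ^+ 2 * kern (t0 - x)) +
          \int[mu]_x (v x ^+ 2 * kern (x - a))) <= \int[mu]_x (v x * rcaputo x).
Proof.
have [_ [Si ->]] := rcaputo_against mv vM v0.
have [i1 E1] := kern_layer alpha01 mright v2i (integrable_kern_right t0 mv2 v2M v20).
have [i2 E2] := kern_layer alpha01 mleft v2i (integrable_kern_left mv2 v2M v20).
rewrite [X in _ * (X + _)]E1 [X in _ * (_ + X)]E2.
rewrite -RintegralD// -RintegralZl//; last exact: integrableDR.
apply: le_Rintegral => //; first by apply: integrableZR; exact: integrableDR.
move=> r _; rewrite -mulrDr mulrCA.
have [r0|r0] := leP r 0; first by rewrite /dens ltNge r0 !mul0r.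
by rewrite ler_wpM2l ?dens_ge0// difference_le.
Qed.

End coercivity.

End one_dimensional.

(** * The non-cylindrical domain and its test functions *)

Section plane_topology.
Context {R : realType}.

(** An open set is the union of the countably many rational boxes inside it, and boxes belong to the
    product sigma-algebra. *)
Lemma open_prod_measurable (A : set (R * R)) : open A ->
  measurable (A : set (plane R)).
Proof.
move=> oA.
pose box (q : (rat * rat) * (rat * rat)) : set (R * R) :=
  `]ratr q.1.1, ratr q.1.2[%classic `*` `]ratr q.2.1, ratr q.2.2[%classic.
have -> : A = \bigcup_q (if `[< box q `<=` A >] then box q else set0).
  apply/seteqP; split=> [p Ap|p [q _]]; last by case: asboolP => // qA /qA.
  have /nbhs_ballP[e e0 eA] : nbhs p A by exact: open_nbhs_nbhs.
  have rat2 (x : R) : exists q : rat * rat, x - e < ratr q.1 /\ ratr q.1 < x /\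
      x < ratr q.2 /\ ratr q.2 < x + e.
    have /rat_in_itvoo[q1] : x - e < x by rewrite ltrBlDr ltrDl.
    have /rat_in_itvoo[q2] : x < x + e by rewrite ltrDl.
    rewrite !in_itv/= => /andP[? ?] /andP[? ?].
    by exists (q1, q2).
  have [q1 [q11 [q12 [q13 q14]]]] := rat2 p.1.
  have [q2 [q21 [q22 [q23 q24]]]] := rat2 p.2.
  exists (q1, q2) => //; case: asboolP => [_|].
    by split=> /=; rewrite ?in_itv/=; apply/andP.
  case=> -[y z] [/=]; rewrite !in_itv/= => /andP[y1 y2] /andP[z1 z2].
  apply: eA; split; rewrite /ball/= ltr_norml; apply/andP; split; lra.
apply: countable_bigcupT_measurable => // q; case: ifPn => // _.
by apply: measurableX; exact: measurable_itv.
Qed.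

Lemma measurable_patch_continuous (D : set (R * R)) (f : R * R -> R) : open D ->
  {within D, continuous f} ->
  measurable_fun [set: plane R] (f \_ D).
Proof.
move=> oD; rewrite continuous_open_subspace// => cf.
have mD := open_prod_measurable oD.
apply/(measurable_restrictT f mD) => _.
apply: (measurability _ (RGenOpens.measurableE R)) => //.
move=> _ [_ [a [b ->] <-]]; apply: open_prod_measurable.
rewrite openE => p [Dp fp].
have Dn : nbhs p D by exact: open_nbhs_nbhs.
have fn : nbhs p (f @^-1` `]a, b[%classic).
  apply: (cf p); first by rewrite inE.
  apply: open_nbhs_nbhs; split=> //; exact: interval_open.
exact: filterI.
Qed.

Lemma within_continuous_slice (U : topologicalType) (A : set R) (B : set U)
    (k : R -> U) (f : U -> R) :
  (forall t, A t -> B (k t)) -> continuous k -> {within B, continuous f} ->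
  {within A, continuous (f \o k)}.
Proof.
move=> AB ck /subspace_continuousP cf; apply/subspace_continuousP => x Ax.
have kx : k t @[t --> within A (nbhs x)] --> within B (nbhs (k x)).
  move=> W /= BW.
  have tn : \forall t \near x, B (k t) -> W (k t) := ck x _ BW.
  change (\forall t \near x, A t -> W (k t)).
  by apply: filterS tn => t tW At; exact: (tW (AB _ At)).
have fk := cf _ (AB _ Ax).
by move=> W /= fW; exact: (kx _ (fk _ fW)).
Qed.

Lemma compact_within_bounded (A : set (R * R)) (f : R * R -> R) :
  compact A -> {within A, continuous f} ->
  exists C, 0 <= C /\ forall p, A p -> `|f p| <= C.
Proof.
move=> cA cf; have := compact_bounded (continuous_compact cf cA).
move=> [M [_ /(_ (`|M| + 1))]] H; exists (`|M| + 1); split.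
  by rewrite addr_ge0.
move=> p Ap; apply: H; last by exists p.
by rewrite (le_lt_trans (ler_norm _))// ltrDl.
Qed.

Lemma Rintegral_FTC (a b : R) (F f : R -> R) : a < b ->
  {within `[a, b], continuous f} -> {within `[a, b], continuous F} ->
  (forall x, a < x < b -> is_derive x 1 F (f x)) ->
  \int[@lebesgue_measure R]_(x in `[a, b]) f x = F b - F a.
Proof.
move=> ab cf cF dF; rewrite /Rintegral (@continuous_FTC2 _ f F)//.
  have [_ cFa cFb] := (continuous_within_itvP _ ab).1 cF.
  split=> // x; rewrite in_itv/= => xab.
  by have [] := dF x xab.
move=> x; rewrite in_itv/= => xab; rewrite derive1E.
by have [_ ->] := dF x xab.
Qed.

End plane_topology.

Section derivative_within.
Context {R : realType}.

Lemma near_dnbhs_ball (x : R) (P : R -> Prop) : (\forall y \near x^', P y) ->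
  exists2 d, 0 < d & forall y, `|x - y| < d -> y != x -> P y.
Proof. by move=> [d /= d0 H]; exists d => // y xy yx; exact: H. Qed.

Lemma is_derive_within_ball (A : set R) (f : R -> R) (t df e : R) :
  is_derive_within A f t df -> 0 < e ->
  exists2 d, 0 < d & forall y, `|t - y| < d -> y != t -> A y ->
    `|df - (f y - f t) / (y - t)| < e.
Proof.
move=> /cvgrPdist_lt H e0; have := H _ e0; rewrite near_withinE => /near_dnbhs_ball[d d0 P].
by exists d => // y ty yt Ay; exact: P.
Qed.

Lemma is_derive_within_cvg (A : set R) (f : R -> R) (t df : R) :
  is_derive_within A f t df -> f @ within A (nbhs t) --> f t.
Proof.
move=> H; have [d d0 P] := is_derive_within_ball H ltr01.
apply/cvgrPdist_lt => e e0; rewrite near_withinE.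
apply/nbhs_ballP; exists (Num.min d (e / (`|df| + 1))) => /=.
  by rewrite lt_min d0 divr_gt0// ltr_wpDl.
move=> y; rewrite /ball/= lt_min => /andP[yd ye] Ay.
have [->|yt] := eqVneq y t; first by rewrite subrr normr0.
have yt0 : y - t != 0 by rewrite subr_eq0.
have q1 := P _ yd yt Ay.
rewrite distrC -[f y - f t](divfK yt0) normrM.
move: ye; rewrite distrC ltr_pdivlMr ?ltr_wpDl//; apply: le_lt_trans.
rewrite mulrC ler_wpM2l// -lerBlDl.
by rewrite (le_trans (lerB_dist _ _))// distrC ltW.
Qed.

Lemma is_derive_within_interior (A : set R) (f : R -> R) (t df : R) :
  nbhs t A -> is_derive_within A f t df -> is_derive t 1 f df.
Proof.
move=> /nbhs_ballP[r /= r0 rA] H.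
have L : h^-1 *: (f (h *: (1 : R) + t) - f t) @[h --> 0^'] --> df.
  apply/cvgrPdist_lt => e e0.
  have [d d0 P] := is_derive_within_ball H e0.
  exists (Num.min d r) => /=; first by rewrite lt_min d0.
  move=> h /=; rewrite sub0r normrN lt_min => /andP[hd hr] h0.
  have := P (h + t); rewrite opprD addrCA subrr addr0 normrN => /(_ hd).
  rewrite addrK => PP.
  rewrite /GRing.scale/= mulr1 mulrC; apply: PP.
    by rewrite -subr_eq0 addrK.
  by apply: rA; rewrite /ball/= opprD addrCA subrr addr0 normrN.
split; first exact: cvgP L.
exact: cvg_lim L.
Qed.

Lemma C1_segment_continuous (a c : R) (f : R -> R) :
  C1_segment a c f -> {within `[a, c], continuous f}.
Proof.
move=> [df [fd _]]; apply/subspace_continuousP => t tac.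
by apply: is_derive_within_cvg; exact: fd.
Qed.

Lemma derive_within_ge0_nondecreasing (a c : R) (f df : R -> R) :
  {within `[a, c], continuous f} ->
  (forall t, t \in `]a, c] -> is_derive_within `[a, c] f t (df t)) ->
  (forall t, t \in `]a, c] -> 0 <= df t) ->
  {in `[a, c] &, {homo f : x y / x <= y}}.
Proof.
move=> cf fd df0.
have D x : x \in `]a, c[ -> is_derive x 1 f (df x).
  move=> xac; apply: (@is_derive_within_interior `[a, c]).
    rewrite -/(interior _ _); have : `]a, c[%classic `<=` interior `[a, c].
      by rewrite -open_subsetE; [exact: subset_itvW|exact: interval_open].
    by apply; exact: xac.
  by apply: fd; move: xac; rewrite !in_itv/= => /andP[-> /ltW].
apply: ger0_derive1_le_cc => //.
- by move=> x /D[].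
- move=> x xac; rewrite derive1E; have [_ ->] := D _ xac.
  by apply: df0; move: xac; rewrite !in_itv/= => /andP[-> /ltW].
Qed.

End derivative_within.

(** Monotonicity of [s] makes the times [t] with [(x, t)] in the domain an interval ending at [T],
    so that one-dimensional estimates apply at fixed [x]. *)
Definition moving_domain (R : realType) (b T : R) (s : R -> R) :=
  [/\ 0 < T, 0 < b, {within `[0, T], continuous s}, s 0 = b &
      {in `[0, T] &, {homo s : x y / x <= y}}].

(** * Geometry of the domain and of its slices *)

Section domain.
Context {R : realType} (b T : R) (s : R -> R).
Hypothesis dom : moving_domain b T s.

Let T0 : 0 < T. Proof. by case: dom. Qed.
Let b0 : 0 < b. Proof. by case: dom. Qed.
Let s_cont : {within `[0, T], continuous s}. Proof. by case: dom. Qed.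
Let s0 : s 0 = b. Proof. by case: dom. Qed.
Let s_mono : {in `[0, T] &, {homo s : x y / x <= y}}. Proof. by case: dom. Qed.

Local Notation Q := (Qs s T).
Local Notation a := (sinv b T s).

Lemma s_le x y : 0 <= x -> x <= y -> y <= T -> s x <= s y.
Proof.
move=> x0 xy yT; apply: s_mono => //; rewrite in_itv/=; apply/andP; split=> //.
  exact: le_trans yT.
exact: le_trans xy.
Qed.

Lemma s_geb t : 0 <= t -> t <= T -> b <= s t.
Proof. by move=> t0 tT; rewrite -s0; exact: s_le. Qed.

Lemma sT_gt0 : 0 < s T.
Proof. by rewrite (lt_le_trans b0)// s_geb// ltW. Qed.

Lemma s_near t e : 0 <= t -> t <= T -> 0 < e ->
  exists2 d, 0 < d & forall y, `|t - y| < d -> 0 <= y -> y <= T -> `|s t - s y| < e.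
Proof.
move=> t0 tT e0.
have tI : `[0, T]%classic t by rewrite /= in_itv/= t0.
have /subspace_continuousP/(_ _ tI)/cvgrPdist_lt/(_ _ e0) := s_cont.
rewrite near_withinE => /nbhs_ballP[d /= d0 H]; exists d => // y ty y0 yT.
by apply: H => //=; rewrite in_itv/= y0.
Qed.

Lemma Qs_open : open Q.
Proof.
rewrite openE => -[x t] [/= /andP[x0 xs] /andP[t0 tT]].
have e0 : 0 < (s t - x) / 2 by rewrite divr_gt0// subr_gt0.
have [d d0 H] := s_near (ltW t0) (ltW tT) e0.
apply/nbhs_ballP.
exists (Num.min (Num.min d ((s t - x) / 2)) (Num.min x (Num.min t (T - t)))) => /=.
  by rewrite !lt_min d0 e0 x0 t0 subr_gt0.
move=> [y r] [/=]; rewrite /ball/= !lt_min => /andP[/andP[_ +] /andP[+ _]].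
move=> xy1 xy2 /andP[/andP[tr _] /andP[_ /andP[tr1 tr2]]].
move: xy1 xy2 tr1 tr2; rewrite !ltr_norml => /andP[h1 h2] /andP[h3 h4].
move=> /andP[h5 h6] /andP[h7 h8].
have r0 : 0 < r by lra.
have rT : r < T by lra.
have := H _ tr (ltW r0) (ltW rT); rewrite ltr_norml => /andP[h9 h10].
split=> /=; apply/andP; split=> //; lra.
Qed.

Lemma Qs_measurable : measurable (Q : set (plane R)).
Proof. exact: open_prod_measurable Qs_open. Qed.

Lemma Qs_rect p : Q p -> (0 < p.1 < s T) /\ (0 < p.2 < T).
Proof.
move=> [/andP[x0 xs] /andP[t0 tT]]; split; last by rewrite t0.
by rewrite x0 (lt_le_trans xs)// s_le// ltW.
Qed.

Lemma closure_Qs_compact : compact (closure Q).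
Proof.
apply: (@subclosed_compact _ _ (`[0, s T]%classic `*` `[0, T]%classic)).
- exact: closed_closure.
- by apply: compact_setX; exact: segment_compact.
- rewrite -[X in _ `<=` X](_ : closure (`[0, s T]%classic `*` `[0, T]%classic) = _).
    apply: closure_subset => p /Qs_rect[/andP[x0 xs] /andP[t0 tT]].
    by split; rewrite /= in_itv/= !ltW.
  apply/esym/closure_id; apply: compact_closed; first exact: norm_hausdorff.
  by apply: compact_setX; exact: segment_compact.
Qed.

Lemma closure_Qs x t : 0 <= t -> t <= T -> 0 <= x -> x <= s t -> closure Q (x, t).
Proof.
move=> t0 tT x0 xs U /nbhs_ballP[e /= e0 eU].
have e40 : 0 < e / 4 by rewrite divr_gt0.
have [d d0 H] := s_near t0 tT e40.
have [r [rt r0 rT]] : exists r, [/\ `|t - r| < Num.min d e, 0 < r & r < T].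
  pose m := Num.min (Num.min d e) T.
  have m0 : 0 < m by rewrite !lt_min d0 e0 T0.
  have mde : m <= Num.min d e by rewrite ge_min lexx.
  have mT : m <= T by rewrite ge_min lexx orbT.
  have [tT2|tT2] := leP t (T / 2).
    by exists (t + m / 3); split; [rewrite ltr_norml; apply/andP; split|..]; lra.
  by exists (t - m / 3); split; [rewrite ltr_norml; apply/andP; split|..]; lra.
move: rt; rewrite lt_min => /andP[rd re].
have := H _ rd (ltW r0) (ltW rT); rewrite ltr_norml => /andP[h1 h2].
have sr0 := lt_le_trans b0 (s_geb (ltW r0) (ltW rT)).
pose m := Num.min (e / 4) (s r / 2).
have m0 : 0 < m by rewrite lt_min e40 divr_gt0.
have me : m <= e / 4 by rewrite ge_min lexx.
have ms : m <= s r / 2 by rewrite ge_min lexx orbT.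
have [y [xy y0 ys]] : exists y, [/\ `|x - y| < e, 0 < y & y < s r].
  have [xm|xm] := leP x m.
    by exists m; split; [rewrite ltr_norml; apply/andP; split|..]; lra.
  have [xm2|xm2] := leP x (s r - m).
    by exists x; split; [rewrite subrr normr0|..]; lra.
  by exists (s r - m); split; [rewrite ltr_norml; apply/andP; split|..]; lra.
exists (y, r); split; first by split; apply/andP.
by apply: eU; split.
Qed.

Let E x := [set t | t \in `[0, T] /\ s t = x].

Let Eub x : has_ubound (E x).
Proof. by exists T => t [/[!in_itv]/= /andP[]]. Qed.

Let E0 x : b < x -> x < s T -> E x !=set0.
Proof.
move=> bx xT; have [] := @IVT _ s 0 T x (ltW T0) s_cont.
  by rewrite ge_min le_max s0 (ltW bx) (ltW xT) orbT.
by move=> c cT scx; exists c.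
Qed.

Lemma sinv_ge0 x : 0 <= a x.
Proof.
rewrite /sinv; case: ifPn => // _; rewrite -/(E x).
(* For [x] above the range of [s] the set is empty and [sup] takes its default value 0. *)
have [[t Et]|nE] := pselect (E x !=set0).
  apply: (le_trans _ (ub_le_sup (Eub x) Et)).
  by have [/[!in_itv]/= /andP[]] := Et.
by rewrite sup_out// => -[].
Qed.

Lemma sinv_le_of_lt x t : 0 <= t -> t <= T -> x < s t -> a x <= t.
Proof.
move=> t0 tT xt; rewrite /sinv; case: ifPn => // _; rewrite -/(E x).
have [E0'|nE] := pselect (E x !=set0); last by rewrite sup_out// => -[].
apply: ge_sup => // e [/[!in_itv]/= /andP[e0 eT] se]; rewrite leNgt; apply/negP => te.
by have := s_le t0 (ltW te) eT; rewrite se leNgt xt.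
Qed.

Lemma lt_s_sinv x t : 0 < t -> t <= T -> x < s t -> x < s T -> a x < t.
Proof.
move=> t0 tT xt xT.
have st0 : 0 < s t - x by rewrite subr_gt0.
have [d d0 H] := s_near (ltW t0) tT st0.
pose m := Num.min d t.
have m0 : 0 < m by rewrite lt_min d0 t0.
have md : m <= d by rewrite ge_min lexx.
have mt : m <= t by rewrite ge_min lexx orbT.
apply: (@le_lt_trans _ _ (t - m / 2)); last lra.
have r0 : 0 <= t - m / 2 by lra.
have rT : t - m / 2 <= T by lra.
apply: sinv_le_of_lt => //.
have td : `|t - (t - m / 2)| < d by rewrite ltr_norml; apply/andP; split; lra.
have := H _ td r0 rT; rewrite ltr_norml => /andP[h1 h2].
lra.
Qed.

Lemma le_s_sinv x t : x < s T -> a x <= t -> t <= T -> x <= s t.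
Proof.
move=> xT at_ tT; have t0 := le_trans (sinv_ge0 x) at_.
have [xb|bx] := leP x b; first by rewrite (le_trans xb)// s_geb.
have [e Ee] := E0 bx xT; have [/[!in_itv]/= /andP[e0 eT] <-] := Ee.
apply: s_le => //; apply: le_trans at_.
by rewrite /sinv [x <= b]leNgt bx/= -/(E x); exact: ub_le_sup.
Qed.

(** For [x > b], [sinv x] is the largest time with [s t = x], so equality cannot recur afterwards.
    The value [b] is excluded because [sinv b] is 0 by convention, while [s] may stay at [b] for
    some time. *)
Lemma sinv_lt_s x t : x != b -> x < s T -> a x < t -> t <= T -> x < s t.
Proof.
move=> xb xT at_ tT; have t0 := le_trans (sinv_ge0 x) (ltW at_).
rewrite lt_neqAle le_s_sinv ?(ltW at_)// andbT; apply/eqP => xs.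
have [xb'|bx] := leP x b.
  have : x = b by apply/eqP; rewrite eq_le xb'/= xs s_geb.
  by move/eqP; rewrite (negbTE xb).
move: at_; rewrite ltNge => /negP; apply.
rewrite /sinv [x <= b]leNgt bx/= -/(E x); apply: ub_le_sup => //.
by split=> //; rewrite in_itv/= t0.
Qed.

Lemma Qs_slice x t : 0 < x -> x < s T -> x != b -> Q (x, t) <-> a x < t < T.
Proof.
move=> x0 xT xb; split=> [[/= /andP[_ xs] /andP[t0 tT]]|/andP[at_ tT]].
  by rewrite tT andbT lt_s_sinv// ltW.
split=> /=.
  by rewrite x0 sinv_lt_s// ltW.
by rewrite tT andbT (le_lt_trans (sinv_ge0 x)).
Qed.

Lemma closure_Qs_slice x t : 0 <= x -> x < s T -> a x <= t -> t <= T ->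
  closure Q (x, t).
Proof.
move=> x0 xT at_ tT; apply: closure_Qs => //; last exact: le_s_sinv.
exact: le_trans (sinv_ge0 x) at_.
Qed.

End domain.

Section plane_integrals.
Context {R : realType}.
Local Notation mu := (@lebesgue_measure R).
Local Notation mu2 := (@lebesgue_measure R \x @lebesgue_measure R)%E.

Lemma integrable2_bounded (l T C : R) (f : R * R -> R) :
  measurable_fun [set: plane R] f ->
  (forall p, `|f p| <= C) ->
  (forall p, ~ (0 < p.1 < l /\ 0 < p.2 < T) -> f p = 0) ->
  mu2.-integrable setT (EFin \o f).
Proof.
move=> mf fC f0.
apply: (integrable_le mf (integrable_prodM (integrableZR C (integrable_itvb 0 l))
  (integrable_itvb 0 T))) => p.
have [[p1 p2]|/f0 ->] := pselect (0 < p.1 < l /\ 0 < p.2 < T).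
  by rewrite p1 p2 !mulr1.
rewrite normr0 !mulr_ge0//; exact: le_trans (normr_ge0 _) (fC (0, 0)).
Qed.

Lemma sqint2_bounded (l T C : R) (f : R * R -> R) :
  measurable_fun [set: plane R] f ->
  (forall p, `|f p| <= C) ->
  (forall p, ~ (0 < p.1 < l /\ 0 < p.2 < T) -> f p = 0) -> sqint mu2 f.
Proof.
move=> mf fC f0; split=> //; apply: (@integrable2_bounded l T (C ^+ 2)).
- exact: measurable_funX.
- move=> p; rewrite normrX lerXn2r ?nnegrE//; exact: le_trans (normr_ge0 _) (fC p).
- by move=> p /f0 ->; rewrite expr0n.
Qed.

Lemma ae_neq (c : R) : {ae mu, forall t : R, t != c}.
Proof.
exists [set c]; split; [exact: measurable_set1|exact: lebesgue_measure_set1|].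
by move=> t /= /negP; rewrite negbK => /eqP.
Qed.

Lemma integrable_continuous_itv (a b : R) (f : R -> R) :
  {within `[a, b], continuous f} ->
  mu.-integrable setT (EFin \o (f \_ `[a, b])).
Proof.
move=> cf; have := continuous_compact_integrable (@segment_compact _ a b) cf.
by move=> /integrable_mkcond; rewrite restrict_EFin; apply; exact: measurable_itv.
Qed.

Lemma Rintegral_FTC_open (a b : R) (F f g : R -> R) : a < b ->
  {within `[a, b], continuous f} -> {within `[a, b], continuous F} ->
  (forall x, a < x < b -> is_derive x 1 F (f x)) ->
  measurable_fun setT g ->
  (forall x, x != a -> x != b -> g x = f x * ((a < x) && (x < b))%R%:R) ->
  \int[mu]_x g x = F b - F a.
Proof.
move=> ab cf cF dF mg gE; rewrite -(Rintegral_FTC ab cf cF dF) [RHS]Rintegral_mkcond.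
have fi := integrable_continuous_itv cf.
apply: (@ae_eq_Rintegral _ (measurableTypeR R) _ mu) => //; first exact: integrableR_measurable fi.
have na := ae_neq a; have nb := ae_neq b; apply: (@filterS2 _ _ (ae_filter_ringOfSetsType mu)) na nb => x xa xb; rewrite gE//.
rewrite patchE mem_setE in_itv/= !le_eqVlt eq_sym (negbTE xa) (negbTE xb)/=.
by case: ifPn => _; rewrite ?mulr1 ?mulr0.
Qed.

End plane_integrals.

Section test_functions.
Context {R : realType} (b T : R) (s : R -> R).
Hypothesis dom : moving_domain b T s.

Local Notation Q := (Qs s T).

(* [psi] together with its derivative [px] in the first variable *)
Definition x_test (psi px : R * R -> R) :=
  [/\ {within closure Q, continuous psi}, {within closure Q, continuous px},
    (forall x t, Q (x, t) -> is_derive x 1 (fun y => psi (y, t)) (px (x, t))) &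
    (forall t, 0 <= t <= T -> psi (s t, t) = 0)].

(** [px] and [pt] are continuous extensions of the partial derivatives to the closure. They are
    carried as data because the estimates use their bounds on [Q] and their linear combinations. *)
Definition xt_test (phi px pt : R * R -> R) :=
  [/\ x_test phi px, {within closure Q, continuous pt},
    (forall x t, Q (x, t) -> is_derive t 1 (fun r => phi (x, r)) (pt (x, t))) &
    (forall x, 0 <= x <= s T -> phi (x, T) = 0)].

Lemma derivable_slice (phi : R * R -> R) x t v :
  derivable phi (x, t) v ->
  forall k : R -> R * R, (forall h : R, h *: v + (x, t) = k h) ->
  (h^-1 *: (phi (k h) - phi (x, t))) @[h --> 0^'] --> 'D_v phi (x, t).
Proof.
move=> d k hk; under eq_fun do rewrite -hk.
exact: d.
Qed.

Lemma is_derive_slice_x (phi : R * R -> R) x t : derivable phi (x, t) (dir_x R) ->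
  is_derive x 1 (fun y => phi (y, t)) ('D_(dir_x R) phi (x, t)).
Proof.
move=> /derivable_slice/(_ (fun h => (h *: (1 : R) + x, t))) H.
have L : h^-1 *: (phi (h *: (1 : R) + x, t) - phi (x, t)) @[h --> 0^']
    --> 'D_(dir_x R) phi (x, t).
  by apply: H => h; congr pair => /=; rewrite scaler0 add0r.
split; first exact: cvgP L.
exact: cvg_lim L.
Qed.

Lemma is_derive_slice_t (phi : R * R -> R) x t : derivable phi (x, t) (dir_t R) ->
  is_derive t 1 (fun r => phi (x, r)) ('D_(dir_t R) phi (x, t)).
Proof.
move=> /derivable_slice/(_ (fun h => (x, h *: (1 : R) + t))) H.
have L : h^-1 *: (phi (x, h *: (1 : R) + t) - phi (x, t)) @[h --> 0^']
    --> 'D_(dir_t R) phi (x, t).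
  by apply: H => h; congr pair => /=; rewrite scaler0 add0r.
split; first exact: cvgP L.
exact: cvg_lim L.
Qed.

Lemma xt_test_C1 (phi : R * R -> R) : C1_closure Q phi ->
  (forall x, x \in `[0, s T] -> phi (x, T) = 0) ->
  (forall t, t \in `[0, T] -> phi (s t, t) = 0) ->
  exists px pt, xt_test phi px pt /\
    forall p, Q p -> px p = 'D_(dir_x R) phi p /\ pt p = 'D_(dir_t R) phi p.
Proof.
move=> [cphi dphi] phiT phis.
have [dx [px [cpx pxE]]] := dphi (dir_x R) (or_introl erefl).
have [dt [pt [cpt ptE]]] := dphi (dir_t R) (or_intror erefl).
exists px, pt; split; last by move=> p Qp; rewrite pxE ?ptE.
split=> //.
- split=> //.
  by move=> x t Qxt; rewrite pxE//; apply: is_derive_slice_x; exact: dx.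
- by move=> x t Qxt; rewrite ptE//; apply: is_derive_slice_t; exact: dt.
Qed.

Lemma x_test_test_function (psi : R * R -> R) : test_function Q psi ->
  [/\ x_test psi ('D_(dir_x R) psi) & forall t, psi (0, t) = 0].
Proof.
move=> [sm [K [_ KQ K0]]].
have cD vs : continuous (foldr (fun v g => 'D_v g) psi vs).
  by move=> p; apply: differentiable_continuous; exact: sm.
split; last by move=> t; apply: K0 => /KQ[/= /andP[]]; rewrite ltxx.
split.
- exact: continuous_subspaceT (cD [::]).
- exact: continuous_subspaceT (cD [:: dir_x R]).
- move=> x t _; apply: is_derive_slice_x; apply: diff_derivable.
  exact: (sm [::]).
- by move=> t _; apply: K0 => /KQ[/= /andP[_]]; rewrite ltxx.
Qed.

Lemma within_cont_add (f g : R * R -> R) (c : R) : {within closure Q, continuous f} ->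
  {within closure Q, continuous g} -> {within closure Q, continuous (fun p => c * f p + g p)}.
Proof.
move=> /subspace_continuousP cf /subspace_continuousP cg.
apply/subspace_continuousP => p Qp.
by apply: cvgD; [apply: cvgM; [exact: cvg_cst|exact: cf]|exact: cg].
Qed.

Lemma is_derive_lin (f g : R -> R) (x c df dg : R) : is_derive x 1 f df ->
  is_derive x 1 g dg -> is_derive x 1 (fun y => c * f y + g y) (c * df + dg).
Proof.
by move=> fd gd; have := is_deriveD (is_deriveZ c fd) gd.
Qed.

Lemma x_test_lin (f fx g gx : R * R -> R) c : x_test f fx -> x_test g gx ->
  x_test (fun p => c * f p + g p) (fun p => c * fx p + gx p).
Proof.
move=> [f1 f2 f3 f4] [g1 g2 g3 g4]; split; try exact: within_cont_add.
- by move=> x t Qxt; apply: is_derive_lin; [exact: f3|exact: g3].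
- by move=> t tT; rewrite f4// g4// mulr0 addr0.
Qed.

Lemma xt_test_lin (f fx ft g gx gt : R * R -> R) c :
  xt_test f fx ft -> xt_test g gx gt ->
  xt_test (fun p => c * f p + g p) (fun p => c * fx p + gx p)
    (fun p => c * ft p + gt p).
Proof.
move=> [f1 f2 f3 f4] [g1 g2 g3 g4]; split; try exact: within_cont_add.
- exact: x_test_lin.
- by move=> x t Qxt; apply: is_derive_lin; [exact: f3|exact: g3].
- by move=> t tT; rewrite f4// g4// mulr0 addr0.
Qed.

Lemma x_test0 : x_test (fun=> 0) (fun=> 0).
Proof.
split=> //; try by apply: continuous_subspaceT => p; exact: cvg_cst.
by move=> x t _; exact: is_derive_cst.
Qed.

Lemma xt_test0 : xt_test (fun=> 0) (fun=> 0) (fun=> 0).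
Proof.
split=> //; first exact: x_test0.
  by apply: continuous_subspaceT => p; exact: cvg_cst.
by move=> x t _; exact: is_derive_cst.
Qed.

Lemma closure_bounded (f : R * R -> R) : {within closure Q, continuous f} ->
  exists C, 0 <= C /\ forall p, `|(f \_ Q) p| <= C.
Proof.
move=> cf; have cQ := closure_Qs_compact dom.
have [C [C0 H]] := compact_within_bounded cQ cf.
exists C; split=> // p; rewrite patchE; case: ifPn => [|_]; last by rewrite normr0.
by rewrite inE => Qp; apply: H; exact: subset_closure.
Qed.

Lemma closure_measurable (f : R * R -> R) : {within closure Q, continuous f} ->
  measurable_fun [set: plane R] (f \_ Q).
Proof.
move=> cf; apply: measurable_patch_continuous; first exact: (Qs_open dom).
exact: (continuous_subspaceW (@subset_closure _ Q) cf).
Qed.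

Lemma patch_Qs_rect (f : R * R -> R) p : ~ (0 < p.1 < s T /\ 0 < p.2 < T) ->
  (f \_ Q) p = 0.
Proof.
move=> nr; rewrite patchE; case: ifPn => //; rewrite inE => /(Qs_rect dom)[p1 p2].
by exfalso; exact: nr.
Qed.

Lemma sqint_closure (f : R * R -> R) : {within closure Q, continuous f} ->
  sqint (mu2 R) (f \_ Q).
Proof.
move=> cf; have [C [_ fC]] := closure_bounded cf.
apply: (@sqint2_bounded _ (s T) T C) => //; first exact: closure_measurable.
exact: patch_Qs_rect.
Qed.

End test_functions.

(** * Test functions at fixed time and at fixed position *)

Section slices.
Context {R : realType} (b T : R) (s : R -> R).
Hypothesis dom : moving_domain b T s.

Let b0 : 0 < b. Proof. by case: dom. Qed.

Local Notation Q := (Qs s T).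
Local Notation a := (sinv b T s).
Local Notation mu := (@lebesgue_measure R).

Lemma measurable_slice_x (f : R * R -> R) (t : R) :
  measurable_fun [set: plane R] f ->
  measurable_fun setT (fun x => f (x, t)).
Proof. by move=> mf; exact: measurableT_comp mf (measurable_pair2 t). Qed.

Lemma measurable_slice_t (f : R * R -> R) (x : R) :
  measurable_fun [set: plane R] f ->
  measurable_fun setT (fun t => f (x, t)).
Proof. by move=> mf; exact: measurableT_comp mf (measurable_pair1 x). Qed.

Lemma continuous_pair1 (x : R) : continuous (fun t : R => (x, t)).
Proof. by move=> t; exact: (cvg_pair (cvg_cst x) cvg_id). Qed.

Lemma continuous_pair2 (t : R) : continuous (fun x : R => (x, t)).
Proof. by move=> x; exact: (cvg_pair cvg_id (cvg_cst t)). Qed.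

Lemma x_slice_FTC (psi px : R * R -> R) t : x_test T s psi px -> 0 < t < T ->
  \int[mu]_x (px \_ Q) (x, t) = - psi (0, t).
Proof.
move=> [c1 c2 d3 d4] /andP[t0 tT].
have st0 : 0 < s t by rewrite (lt_le_trans b0)// (s_geb dom)// ltW.
have cl x : `[0, s t]%classic x -> closure Q (x, t).
  rewrite /= in_itv/= => /andP[x0 xs]; apply: (closure_Qs dom) => //; exact: ltW.
have QE x : Q (x, t) <-> 0 < x < s t.
  by rewrite /Qs/= t0 tT; split=> [[]|].
have -> : - psi (0, t) = psi (s t, t) - psi (0, t).
  by rewrite (d4 t) ?sub0r// (ltW t0) ltW.
apply: (@Rintegral_FTC_open _ 0 (s t) (fun x => psi (x, t)) (fun x => px (x, t))) => //.
- exact: (within_continuous_slice cl (@continuous_pair2 t) c2).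
- exact: (within_continuous_slice cl (@continuous_pair2 t) c1).
- by move=> x /QE; exact: d3.
- by apply: measurable_slice_x; exact: (closure_measurable dom c2).
- move=> x _ _; rewrite patchE; case: ifPn.
    by rewrite inE => /QE ->; rewrite mulr1.
  move=> /negP nQ; case: (boolP (0 < x < s t)) => [xt|]; last by rewrite mulr0.
  by exfalso; apply: nQ; rewrite inE; exact/QE.
Qed.

(** This supplies the hypothesis [FTC] of the one-dimensional estimates, with [a x] as entry
    time. *)
Lemma t_slice_FTC (phi px pt : R * R -> R) x : xt_test T s phi px pt ->
  0 < x < s T -> x != b -> forall y z, a x < y < T -> y <= z ->
  (phi \_ Q) (x, z) - (phi \_ Q) (x, y) =
  \int[mu]_t ((pt \_ Q) (x, t) * ((y < t) && (t <= z))%R%:R).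
Proof.
move=> [[c1 _ _ _] c2 d3 phiT] /andP[x0 xT] xb y z /andP[ay yT] yz.
have QE t : Q (x, t) <-> a x < t < T by exact: (Qs_slice dom).
have mpt : measurable_fun setT (fun t => (pt \_ Q) (x, t)).
  by apply: measurable_slice_t; exact: (closure_measurable dom c2).
have mb : measurable_fun setT (fun t : R => (y < t) && (t <= z)).
  by apply: measurable_and; [exact: measurable_fun_ltr|exact: measurable_fun_ler].
(* [phi] vanishes at time [T] and both extensions vanish beyond it, so the upper limit can be capped
   at [T]. *)
pose z' := Num.min z T.
have zT' : z' <= T by rewrite ge_min lexx orbT.
have phiQ t : y <= t -> t <= T -> (phi \_ Q) (x, t) = phi (x, t).
  move=> yt; rewrite le_eqVlt => /orP[/eqP ->|tT]; rewrite patchE.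
    rewrite memNset; last by move=> /QE; rewrite ltxx andbF.
    by rewrite phiT// (ltW x0) (ltW xT).
  by rewrite mem_set//; apply/QE; rewrite tT (lt_le_trans ay).
have -> : (phi \_ Q) (x, z) = phi (x, z').
  rewrite /z'; have [zT|Tz] := leP z T; first by rewrite phiQ.
  rewrite patchE memNset; last by move=> /QE /andP[_]; rewrite ltNge (ltW Tz).
  by rewrite phiT// (ltW x0) (ltW xT).
rewrite phiQ// ?(ltW yT)//.
have [yz'|z'y] := ltP y z'; last first.
  have zy : z = y.
    apply/eqP; rewrite eq_le yz andbT; move: z'y; rewrite /z' ge_min leNgt.
    by rewrite orbC leNgt yT /= -leNgt.
  rewrite /z' zy min_l ?ltW// subrr Rintegral_eq0// => t.
  by rewrite ltNge andNb mulr0.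
have cl t : `[y, z']%classic t -> closure Q (x, t).
  rewrite /= in_itv/= => /andP[yt tz]; apply: (closure_Qs_slice dom) => //.
  - exact: ltW.
  - by rewrite (le_trans (ltW ay)).
  - exact: le_trans zT'.
symmetry.
apply: (@Rintegral_FTC_open _ y z' (fun t => phi (x, t)) (fun t => pt (x, t))) => //.
- exact: (within_continuous_slice cl (@continuous_pair1 x) c2).
- exact: (within_continuous_slice cl (@continuous_pair1 x) c1).
- move=> t /andP[yt tz]; apply: d3; apply/QE.
  by rewrite (lt_trans ay)//= (lt_le_trans tz).
- by apply: measurable_funM => //; exact: measurable_natb.
- move=> t ty tz; rewrite patchE; have [yt|ty'] := ltP y t; last by rewrite !mulr0.
  have [tz'|z't] := ltP t z'.
    move: (tz'); rewrite lt_min => /andP[/ltW -> tT].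
    by rewrite mem_set//; apply/QE; rewrite (lt_trans ay).
  rewrite !mulr0; move: z't; rewrite /z' ge_min => /orP[zt|Tt].
    have [tz2|] := leP t z; last by rewrite mulr0.
    have tE : t = z by apply/eqP; rewrite eq_le tz2.
    rewrite memNset ?mul0r// => /QE /andP[_ tT].
    by move: tz; rewrite /z' -tE (min_l (ltW tT)) eqxx.
  by rewrite memNset ?mul0r// => /QE /andP[_]; rewrite ltNge Tt.
Qed.

(** A trace bound at [x = 0]: as [psi] vanishes on the moving boundary, [psi (0, t)] is minus the
    integral of [px], and Cauchy-Schwarz is applied against the indicator of (0, s T). *)
Lemma x_slice_bound (psi px : R * R -> R) t : x_test T s psi px -> 0 < t < T ->
  psi (0, t) ^+ 2 <= s T * \int[mu]_x ((px \_ Q) (x, t) ^+ 2).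
Proof.
move=> xt tT; have := x_slice_FTC xt tT.
have [c1 c2 _ _] := xt.
have [C [C0 pC]] := closure_bounded dom c2.
have mp : measurable_fun setT (fun x => (px \_ Q) (x, t)).
  by apply: measurable_slice_x; exact: (closure_measurable dom c2).
have p0 x : ~~ (0 < x < s T) -> (px \_ Q) (x, t) = 0.
  by move=> xs; apply: (patch_Qs_rect dom) => -[]; rewrite /= (negbTE xs).
pose f x := (px \_ Q) (x, t).
pose g (x : R) := ((0 < x) && (x < s T))%R%:R : R.
have gi := integrable_itvb 0 (s T).
have mg := integrableR_measurable gi.
have g2 : (fun x => g x ^+ 2) = g.
  by apply/funext => x; rewrite /g; case: (_ && _); rewrite ?expr1n ?expr0n.
have sg : sqint mu g by split=> //; rewrite g2.
have sf : sqint mu f.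
  split=> //; apply: (@integrable_bounded_itv _ 0 (s T) (C ^+ 2)).
  - exact: measurable_funX.
  - by move=> x; rewrite normrX lerXn2r ?nnegrE//; exact: pC.
  - by move=> x /p0; rewrite /f => ->; rewrite expr0n.
have fg : dot mu f g = \int[mu]_x f x.
  apply: eq_Rintegral => x _; rewrite /f /g.
  by case: (boolP (0 < x < s T)) => [|/p0 ->]; rewrite ?mulr1 ?mul0r.
have gg : dot mu g g = s T.
  have -> : dot mu g g = \int[mu]_x \1_(`]0, s T[) x.
    apply: eq_Rintegral => x _; rewrite indicE mem_setE in_itv/= -expr2.
    by rewrite /g; case: (_ && _); rewrite ?expr1n ?expr0n.
  have E : fine (mu `]0, s T[%classic) = s T.
    by rewrite lebesgue_measure_itv/= lte_fin (sT_gt0 dom) /= ?subr0 ?oppr0 ?addr0.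
  by rewrite /Rintegral integral_indic// setIT -[RHS]E.
have ff : dot mu f f = \int[mu]_x ((px \_ Q) (x, t) ^+ 2).
  by apply: eq_Rintegral => x _; rewrite -expr2.
by move=> I; have := dot_cauchy_schwarz sf sg; rewrite fg gg I sqrrN mulrC ff.
Qed.

End slices.

(** * Fractional integrals and coercivity in the plane *)

Section slice_swap.
Context {R : realType} (alpha : R).
Hypothesis alpha01 : 0 < alpha < 1.
Local Notation mu := (@lebesgue_measure R).
Local Notation kern := (kern alpha).

Definition kern_mass (T : R) := \int[mu]_r (kern r * (r <= T)%R%:R).

Lemma kern_mass_ge0 T : 0 <= kern_mass T.
Proof. by apply: Rintegral_ge0 => r _; rewrite mulr_ge0// kern_ge0. Qed.

Lemma kern_mass_shift (T x : R) :
  \int[mu]_t (kern (t - x) * (t - x <= T)%R%:R) = kern_mass T /\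
  mu.-integrable setT (EFin \o (fun t => kern (t - x) * (t - x <= T)%R%:R)).
Proof.
have ki := kern_integrable alpha01 T.
split; last exact: integrable_translation ki.
exact: (Rintegral_translation (f := fun r => kern r * (r <= T)%R%:R) _
  (integrableR_measurable ki)).
Qed.

Lemma kern_mass_reflect (T x : R) :
  mu.-integrable setT (EFin \o (fun t => kern (x - t) * (x - t <= T)%R%:R)).
Proof.
have := integrable_opp (integrable_translation x (kern_integrable alpha01 T)).
by apply: eq_integrable => // t _ /=; rewrite [- t + x]addrC.
Qed.

Variables (T C : R) (w psi : R -> R).
Hypothesis wi : mu.-integrable setT (EFin \o w).
Hypothesis mpsi : measurable_fun setT psi.
Hypothesis psiC : forall x, `|psi x| <= C.
Hypothesis w0 : forall x, ~~ (0 < x < T) -> w x = 0.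
Hypothesis psi0 : forall x, ~~ (0 < x < T) -> psi x = 0.

Let C0 : 0 <= C. Proof. exact: le_trans (normr_ge0 _) (psiC 0). Qed.

Lemma psi_kern_bound x : 0 < x ->
  mu.-integrable setT (EFin \o (fun t => psi t * kern (t - x))) /\
  \int[mu]_t `|psi t * kern (t - x)| <= C * kern_mass T.
Proof.
move=> x0; have [kE ki] := kern_mass_shift T x.
have b t : `|psi t * kern (t - x)| <= C * (kern (t - x) * (t - x <= T)%R%:R).
  rewrite normrM [X in _ * X]ger0_norm ?kern_ge0//.
  have [/andP[t0 tT]|/psi0 ->] := boolP (0 < t < T).
    have -> : t - x <= T by rewrite lerBlDr (le_trans (ltW tT))// lerDl ltW.
    by rewrite mulr1 ler_wpM2r ?kern_ge0.
  by rewrite normr0 mul0r !mulr_ge0// kern_ge0.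
have i1 : mu.-integrable setT (EFin \o (fun t => psi t * kern (t - x))).
  apply: (integrable_le _ (integrableZR C ki) b).
  apply: measurable_funM => //.
  exact: measurableT_comp (measurable_kern alpha) (measurable_translation (- x)).
split=> //; rewrite -kE -RintegralZl//; apply: le_Rintegral => //.
- exact: integrable_norm.
- exact: integrableZR.
Qed.

Let f (z : plane R) : R :=
  w z.1 * (psi z.2 * kern (z.2 - z.1)).

Let fi : (mu \x mu)%E.-integrable setT (EFin \o f).
Proof.
have mw := integrableR_measurable wi.
apply/integrable12ltyP.
  apply/measurable_EFinP; apply: measurable_funM.
    exact: measurableT_comp mw measurable_fst.
  apply: measurable_funM; first exact: measurableT_comp mpsi measurable_snd.
  by apply: measurableT_comp (measurable_kern alpha) _; exact: measurable_funB.
have /integrableP[_ wi'] := integrableZR (C * kern_mass T) wi.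
apply: le_lt_trans wi'; apply: ge0_le_integral => //.
- by move=> x _; exact: integral_ge0.
- apply: (@measurable_fun_fubini_tonelli_F _ _ _ _ _ mu (fun z => `|(f z)%:E|)%E) => //.
  apply: measurableT_comp => //; apply/measurable_EFinP; apply: measurable_funM.
    exact: measurableT_comp mw measurable_fst.
  apply: measurable_funM; first exact: measurableT_comp mpsi measurable_snd.
  by apply: measurableT_comp (measurable_kern alpha) _; exact: measurable_funB.
- by apply: measurableT_comp => //; apply/measurable_EFinP; exact: measurable_funM.
move=> x _; have [/andP[x0 xT]|/w0 wx] := boolP (0 < x < T); last first.
  by rewrite integral0_eq ?abse_ge0// => t _; rewrite /= /f/= wx mul0r normr0.
have [pki pkb] := psi_kern_bound x0.
have pkn := integrableZR `|w x| (integrable_norm pki).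
have -> : (\int[mu]_t `|(EFin \o f) (x, t)| =
    (\int[mu]_t (`|w x| * `|psi t * kern (t - x)|))%R%:E)%E.
  rewrite /Rintegral fineK ?integrable_fin_num//.
  by apply: eq_integral => t _; rewrite /= /f/= normrM.
rewrite lee_fin normrM [X in _ <= X * _]ger0_norm ?mulr_ge0 ?kern_mass_ge0//.
by rewrite RintegralZl ?integrable_norm// mulrC ler_wpM2r.
Qed.

Definition kern_conv (t : R) := \int[mu]_x (kern (t - x) * w x).

Lemma measurable_kern_conv : measurable_fun setT kern_conv.
Proof.
apply: (@measurable_Rintegral2 _ _ _ _ _ mu
  (fun z : plane R => kern (z.2 - z.1) * w z.1)).
apply: measurable_funM; last first.
  exact: measurableT_comp (integrableR_measurable wi) measurable_fst.
by apply: measurableT_comp (measurable_kern alpha) _; exact: measurable_funB.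
Qed.

Let conv_ae : {ae mu, forall t, \int[mu]_x f (x, t) = kern_conv t * psi t}.
Proof.
have := ae_integrable2 fi; apply: filterS => t fit.
(* Fubini gives convergence of the convolution only where [psi t] is nonzero, after division by it;
   elsewhere both sides vanish. *)
have [pt|pt] := eqVneq (psi t) 0.
  by rewrite pt mulr0 Rintegral_eq0// => x; rewrite /f/= pt mul0r mulr0.
rewrite mulrC -RintegralZl//.
  by apply: eq_Rintegral => x _; rewrite /f/=; ring.
have := integrableZl measurableT (psi t)^-1 fit.
apply: eq_integrable => // x _ /=; rewrite -EFinM /f/=; congr EFin.
by field.
Qed.

Lemma kern_conv_integrable : mu.-integrable setT (EFin \o (fun t => kern_conv t * psi t)).
Proof.
have /integrableP[mF iF] := integrable_Rintegral2 fi.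
have mK : measurable_fun setT (fun t => kern_conv t * psi t).
  by apply: measurable_funM => //; exact: measurable_kern_conv.
apply/integrableP; split; first exact/measurable_EFinP.
apply: le_lt_trans iF; rewrite le_eqVlt; apply/orP; left; apply/eqP.
apply: ae_eq_integral => //.
- by apply: measurableT_comp => //; exact/measurable_EFinP.
- exact: measurableT_comp.
- by apply: filterS conv_ae => t /= ->.
Qed.

(** Fractional integration by parts: Fubini moves the kernel from [w] to [psi], where it looks
    forward in time. *)
Lemma kern_conv_swap : \int[mu]_t (kern_conv t * psi t) =
  \int[mu]_x (w x * \int[mu]_t (psi t * kern (t - x))).
Proof.
have mK : measurable_fun setT (fun t => kern_conv t * psi t).
  by apply: measurable_funM => //; exact: measurable_kern_conv.
transitivity (\int[mu]_t (\int[mu]_x f (x, t))).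
  apply: ae_eq_Rintegral => //.
    exact: integrableR_measurable (integrable_Rintegral2 fi).
  by apply: filterS conv_ae => t ->.
rewrite -(Rintegral_swap fi); apply: eq_Rintegral => x _.
have [/andP[x0 xT]|/w0 wx] := boolP (0 < x < T); last first.
  by rewrite wx mul0r Rintegral_eq0// => t; rewrite /f/= wx mul0r.
by rewrite /f/= RintegralZl//; exact: (psi_kern_bound x0).1.
Qed.

(** Young's inequality for the kernel in L^1, with [psi] bounded. Its bound, linear in the L^1 norm
    of the slice of [w], is what makes [conv2_integrable] work over the plane. *)
Lemma kern_conv_bound :
  \int[mu]_t `|kern_conv t * psi t| <= C * kern_mass T * \int[mu]_x `|w x|.
Proof.
have Fi := integrable_Rintegral2 fi.
have mK : measurable_fun setT (fun t => kern_conv t * psi t).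
  by apply: measurable_funM => //; exact: measurable_kern_conv.
have fni : (mu \x mu)%E.-integrable setT (EFin \o (fun z => `|f z|)).
  exact: integrable_norm.
have -> : \int[mu]_t `|kern_conv t * psi t| = \int[mu]_t `|\int[mu]_x f (x, t)|.
  apply: ae_eq_Rintegral => //.
  - exact: measurableT_comp.
  - by apply: measurableT_comp => //; exact: integrableR_measurable Fi.
  - by apply: filterS conv_ae => t ->.
apply: (@le_trans _ _ (\int[mu]_t (\int[mu]_x `|f (x, t)|))).
  rewrite -lee_fin /Rintegral !fineK; last 2 first.
  - exact: integrable_fin_num (integrable_Rintegral2 fni).
  - exact: integrable_fin_num (integrable_norm Fi).
  have mF := integrableR_measurable Fi.
  have mFn := integrableR_measurable (integrable_Rintegral2 fni).
  apply: ae_ge0_le_integral => //.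
  - by apply/measurable_EFinP; exact: measurableT_comp.
  - by move=> t _; rewrite lee_fin; apply: Rintegral_ge0.
  - exact/measurable_EFinP.
  - have := ae_integrable2 fi; apply: filterS => t fit _; rewrite lee_fin.
    exact: le_normr_Rintegral.
rewrite -(Rintegral_swap fni) -RintegralZl//; last exact: integrable_norm.
apply: le_Rintegral => //.
- exact: integrable_Rintegral1 fni.
- by apply: integrableZR; exact: integrable_norm.
move=> x _; have [/andP[x0 xT]|/w0 wx] := boolP (0 < x < T); last first.
  rewrite wx normr0 mulr0 Rintegral_eq0// => t; rewrite /f/= wx mul0r normr0//.
have [pki pkb] := psi_kern_bound x0.
have -> : \int[mu]_t `|f (x, t)| = \int[mu]_t (`|w x| * `|psi t * kern (t - x)|).
  by apply: eq_Rintegral => t _; rewrite /f/= normrM.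
by rewrite RintegralZl ?integrable_norm// mulrC ler_wpM2r.
Qed.

End slice_swap.

(** * Fractional integration by parts over the plane *)

Section plane_convolution.
Context {R : realType} (alpha b T : R) (s : R -> R).
Hypothesis alpha01 : 0 < alpha < 1.
Hypothesis dom : moving_domain b T s.

Local Notation Q := (Qs s T).
Local Notation mu := (@lebesgue_measure R).
Local Notation mu2 := (@lebesgue_measure R \x @lebesgue_measure R)%E.
Local Notation kern := (kern alpha).

Lemma patch_off (f : R * R -> R) (A : set (R * R)) p : ~ A p -> (f \_ A) p = 0.
Proof. by move=> nA; rewrite patchE memNset. Qed.

Lemma patch_in (f : R * R -> R) (A : set (R * R)) p : A p -> (f \_ A) p = f p.
Proof. by move=> Ap; rewrite patchE mem_set. Qed.

Lemma patch_slice_t (f : R * R -> R) x t : ~~ (0 < t < T) -> (f \_ Q) (x, t) = 0.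
Proof.
by move=> t0; apply: (patch_Qs_rect dom) => -[_]; rewrite /= (negbTE t0).
Qed.

Lemma patch_slice_x (f : R * R -> R) x t : ~~ (0 < x < s T) -> (f \_ Q) (x, t) = 0.
Proof.
by move=> t0; apply: (patch_Qs_rect dom) => -[]; rewrite /= (negbTE t0).
Qed.

Lemma sqint_rect_integrable (w : R * R -> R) : sqint mu2 w ->
  (forall p, ~ Q p -> w p = 0) -> mu2.-integrable setT (EFin \o w).
Proof.
move=> sw w0.
pose g (p : plane R) : R :=
  ((0 < p.1) && (p.1 < s T))%R%:R * ((0 < p.2) && (p.2 < T))%R%:R.
have mg : measurable_fun setT g.
  apply: measurable_funM; apply: measurable_natb.
    by apply: measurable_and; apply: measurable_fun_ltr.
  by apply: measurable_and; apply: measurable_fun_ltr.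
have sg : sqint mu2 g.
  apply: (@sqint2_bounded _ (s T) T 1) => // p; rewrite /g.
    by case: (_ && _); case: (_ && _); rewrite ?mulr1 ?mulr0 ?mul0r ?normr1 ?normr0.
  case: (boolP (0 < p.1 < s T)) => p1; last by rewrite mul0r.
  by case: (boolP (0 < p.2 < T)) => p2; [move=> []|rewrite mulr0].
have := sqintM sw sg; apply: eq_integrable => // p _ /=; congr EFin.
have [/(Qs_rect dom)[p1 p2]|/w0 ->] := pselect (Q p); last by rewrite mul0r.
by rewrite /g p1 p2 !mulr1.
Qed.

Definition conv2 (w : R * R -> R) (p : R * R) : R :=
  kern_conv alpha (fun t => w (p.1, t)) p.2.

Lemma measurable_conv2 (w : R * R -> R) :
  measurable_fun [set: plane R] w ->
  measurable_fun [set: plane R] (conv2 w).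
Proof.
move=> mw; apply: (@measurable_Rintegral1 _ _
  (plane R)%type (measurableTypeR R) _ mu
  (fun z => kern (z.1.2 - z.2) * w (z.1.1, z.2))).
apply: measurable_funM.
  apply: measurableT_comp (measurable_kern alpha) _; apply: measurable_funB => //.
  exact: measurableT_comp measurable_snd measurable_fst.
apply: measurableT_comp mw _; apply/measurable_fun_pairP; split.
  exact: (measurableT_comp measurable_fst measurable_fst).
exact: measurable_snd.
Qed.

Definition rc2 (pt : R * R -> R) (p : R * R) : R :=
  rcaputo alpha (fun t => (pt \_ Q) (p.1, t)) p.2.

Section rcaputo_plane.
Variable pt : R * R -> R.
Hypothesis cpt : {within closure Q, continuous pt}.

Let mFt := closure_measurable dom cpt.

Lemma measurable_rc2 :
  measurable_fun [set: plane R] (rc2 pt).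
Proof.
have m : measurable_fun [set: plane R]
    (fun p => \int[mu]_t ((pt \_ Q) (p.1, t) * kern (t - p.2))).
  apply: (@measurable_Rintegral1 _ _
    (plane R)%type (measurableTypeR R) _ mu
    (fun z => (pt \_ Q) (z.1.1, z.2) * kern (z.2 - z.1.2))).
  apply: measurable_funM.
    apply: measurableT_comp mFt _; apply/measurable_fun_pairP; split.
      exact: (measurableT_comp measurable_fst measurable_fst).
    exact: measurable_snd.
  apply: measurableT_comp (measurable_kern alpha) _; apply: measurable_funB => //.
  exact: measurableT_comp measurable_snd measurable_fst.
exact: measurable_funN m.
Qed.

Lemma rc2_bounded : exists C, forall p, `|(rc2 pt \_ Q) p| <= C.
Proof.
have [C [C0 tC]] := closure_bounded dom cpt.
exists (C * kern_mass alpha T) => p.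
have [Qp|nQ] := pselect (Q p); last first.
  by rewrite patch_off// normr0 mulr_ge0// kern_mass_ge0.
have [_ /andP[p0 pT]] := Qs_rect dom Qp.
have [i1 i2] := @psi_kern_bound _ _ alpha01 T C (fun t => (pt \_ Q) (p.1, t))
  (measurable_slice_t p.1 mFt) (fun t => tC _) (patch_slice_t pt p.1) _ p0.
rewrite patch_in// /rc2 /rcaputo normrN; apply: le_trans i2.
exact: le_normr_Rintegral.
Qed.

Lemma sqint_rc2 : sqint mu2 (rc2 pt \_ Q).
Proof.
have [C rC] := rc2_bounded.
apply: (@sqint2_bounded _ (s T) T C) => //; last exact: (patch_Qs_rect dom).
apply/(measurable_restrictT _ (Qs_measurable dom)).
by apply: measurable_funTS; exact: measurable_rc2.
Qed.

Variable w : R * R -> R.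
Hypothesis sw : sqint mu2 w.
Hypothesis w0 : forall p, ~ Q p -> w p = 0.

Let wi : mu2.-integrable setT (EFin \o w).
Proof. exact: sqint_rect_integrable. Qed.

Let w_t x t : ~~ (0 < t < T) -> w (x, t) = 0.
Proof.
by move=> t0; apply: w0 => /(Qs_rect dom)[_]; rewrite /= (negbTE t0).
Qed.

Let mJ : measurable_fun [set: plane R]
  (fun p => conv2 w p * (pt \_ Q) p).
Proof. by apply: measurable_funM => //; apply: measurable_conv2; case: sw. Qed.

Lemma conv2_integrable : mu2.-integrable setT (EFin \o (fun p => conv2 w p * (pt \_ Q) p)).
Proof.
have [C [C0 tC]] := closure_bounded dom cpt.
have Wi := integrableZR (C * kern_mass alpha T) (integrable_Rintegral1 (integrable_norm wi)).
apply/integrable12ltyP; first exact/measurable_EFinP.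
have /integrableP[mW iW] := Wi; apply: le_lt_trans iW.
apply: ae_ge0_le_integral => //.
- by move=> x _; exact: integral_ge0.
- apply: (@measurable_fun_fubini_tonelli_F _ _ _ _ _ mu
    (fun z => `|(conv2 w z * (pt \_ Q) z)%:E|)%E) => //.
  by apply: measurableT_comp => //; exact/measurable_EFinP.
- exact: measurableT_comp.
have := ae_integrable1 wi; apply: filterS => x wxi _.
have ki := @kern_conv_integrable _ _ alpha01 T C _ (fun t => (pt \_ Q) (x, t)) wxi
  (measurable_slice_t x mFt) (fun t => tC _) (w_t x) (patch_slice_t pt x).
have kb := @kern_conv_bound _ _ alpha01 T C _ (fun t => (pt \_ Q) (x, t)) wxi
  (measurable_slice_t x mFt) (fun t => tC _) (w_t x) (patch_slice_t pt x).
pose F p := conv2 w p * (pt \_ Q) p.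
have -> : (\int[mu]_t `|(EFin \o F) (x, t)| = (\int[mu]_t `|F (x, t)|%R)%R%:E)%E.
  by rewrite /Rintegral fineK// integrable_fin_num//; exact: integrable_norm.
by rewrite lee_fin (le_trans kb)// ler_norm.
Qed.

(** With [pt] the time derivative of a test function, this moves the fractional integral off [w] in
    the weak formulation. It is [kern_conv_swap] on almost every slice, a square-integrable [w] on a
    bounded domain being integrable. *)
Lemma conv2_swap : \int[mu2]_p (conv2 w p * (pt \_ Q) p) = - dot mu2 w (rc2 pt \_ Q).
Proof.
have [C [C0 tC]] := closure_bounded dom cpt.
have swr := integrableZR (-1) (sqintM sw sqint_rc2).
rewrite -mulN1r -RintegralZl//; last exact: sqintM sw sqint_rc2.
rewrite -(Rintegral_prod1 conv2_integrable) -(Rintegral_prod1 swr).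
apply: ae_eq_Rintegral.
- exact: integrableR_measurable (integrable_Rintegral1 conv2_integrable).
- exact: integrableR_measurable (integrable_Rintegral1 swr).
have := ae_integrable1 wi; apply: filterS => x wxi.
rewrite [LHS](@kern_conv_swap _ _ alpha01 T C _ (fun t => (pt \_ Q) (x, t)) wxi
  (measurable_slice_t x mFt) (fun t => tC _) (w_t x) (patch_slice_t pt x)).
apply: eq_Rintegral => t _.
have [Qp|nQ] := pselect (Q (x, t)); last by rewrite w0// !mul0r mulr0.
by rewrite patch_in// /rc2 /rcaputo/= mulrN mulN1r opprK.
Qed.

End rcaputo_plane.

End plane_convolution.

Lemma ae_le_Rintegral d (X : measurableType d) (R : realType)
    (mu : {measure set X -> \bar R}) (f g : X -> R) :
  mu.-integrable setT (EFin \o f) -> mu.-integrable setT (EFin \o g) ->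
  {ae mu, forall x, f x <= g x} -> \int[mu]_x f x <= \int[mu]_x g x.
Proof.
move=> fi gi fg; rewrite -subr_ge0 -RintegralB//.
have mf : measurable_fun setT f by apply/measurable_EFinP; exact: measurable_int fi.
have mg : measurable_fun setT g by apply/measurable_EFinP; exact: measurable_int gi.
have -> : \int[mu]_x (g x - f x) = \int[mu]_x `|g x - f x|.
  apply: ae_eq_Rintegral; first exact: measurable_funB.
    by apply: measurableT_comp => //; exact: measurable_funB.
  by apply: filterS fg => x fgx; rewrite ger0_norm// subr_ge0.
by apply: Rintegral_ge0.
Qed.

Lemma ae_half_sum_le d (X : measurableType d) (R : realType)
    (mu : {measure set X -> \bar R}) (f1 f2 g : X -> R) :
  mu.-integrable setT (EFin \o f1) -> mu.-integrable setT (EFin \o f2) ->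
  mu.-integrable setT (EFin \o g) ->
  {ae mu, forall x, 2^-1 * (f1 x + f2 x) <= g x} ->
  2^-1 * (\int[mu]_x f1 x + \int[mu]_x f2 x) <= \int[mu]_x g x.
Proof.
move=> i1 i2 ig fg; have i12 := integrableDR i1 i2.
rewrite -RintegralD// -RintegralZl//; apply: ae_le_Rintegral => //.
exact: integrableZR.
Qed.

Section plane_coercivity.
Context {R : realType} (alpha b T : R) (s : R -> R).
Hypothesis alpha01 : 0 < alpha < 1.
Hypothesis dom : moving_domain b T s.

Local Notation Q := (Qs s T).
Local Notation a := (sinv b T s).
Local Notation mu := (@lebesgue_measure R).
Local Notation mu2 := (@lebesgue_measure R \x @lebesgue_measure R)%E.
Local Notation kern := (kern alpha).

Lemma integrable_weight (p : R -> R) (q : R * R -> R) (k : R -> R) (C : R) :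
  measurable_fun [set: plane R] q ->
  (forall z, `|q z| <= C * `|p z.1| * ((0 < z.2) && (z.2 < T))%R%:R) ->
  mu.-integrable setT (EFin \o p) ->
  measurable_fun setT k -> (forall t, 0 <= k t) ->
  mu.-integrable setT (EFin \o (fun t => ((0 < t) && (t < T))%R%:R * k t)) ->
  mu2.-integrable setT (EFin \o (fun z => q z * k z.2)).
Proof.
move=> mq qC pi mk k0 ki.
apply: (integrable_le _ (integrable_prodM (integrableZR C (integrable_norm pi)) ki)).
  by apply: measurable_funM => //; exact: measurableT_comp mk measurable_snd.
move=> z /=; rewrite normrM [X in _ * X <= _]ger0_norm// mulrA.
by rewrite ler_wpM2r.
Qed.

Let ind_kern_left := integrable_itvb_kern alpha01 T.

Let ind_kern_right t0 : mu.-integrable setT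
  (EFin \o (fun t => ((0 < t) && (t < T))%R%:R * kern (t0 - t))).
Proof.
apply: (@integrable_kern_right _ _ alpha01 0 T 1 t0 (fun t => ((0 < t) && (t < T))%R%:R)).
- exact: integrableR_measurable (integrable_itvb 0 T).
- by move=> x; case: (_ && _); rewrite ?normr1 ?normr0.
- by move=> x /negbTE ->.
Qed.

Let indx (x : R) : R := ((0 < x) && (x < s T))%R%:R.

Let bounded_dom (q : R * R -> R) C : (forall z, `|q z| <= C) ->
  (forall z, ~ Q z -> q z = 0) ->
  forall z, `|q z| <= C * `|((0 < z.1) && (z.1 < s T))%R%:R| *
    ((0 < z.2) && (z.2 < T))%R%:R.
Proof.
move=> qC q0 z; have C0 : 0 <= C := le_trans (normr_ge0 _) (qC (0, 0)).
have [/(Qs_rect dom)[-> ->]|/q0 ->] := pselect (Q z).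
  by rewrite normr1 !mulr1.
by rewrite normr0 !mulr_ge0.
Qed.

Lemma integrable_kern_after (q : R * R -> R) C :
  measurable_fun [set: plane R] q ->
  (forall z, `|q z| <= C) -> (forall z, ~ Q z -> q z = 0) ->
  mu2.-integrable setT (EFin \o (fun z => q z * kern z.2)).
Proof.
move=> mq qC q0; apply: (@integrable_weight indx q kern C mq (bounded_dom qC q0)) => //.
- exact: integrable_itvb.
- exact: measurable_kern.
- by move=> t; exact: kern_ge0.
Qed.

Lemma integrable_kern_before (q : R * R -> R) C t0 :
  measurable_fun [set: plane R] q ->
  (forall z, `|q z| <= C) -> (forall z, ~ Q z -> q z = 0) ->
  mu2.-integrable setT (EFin \o (fun z => q z * kern (t0 - z.2))).
Proof.
move=> mq qC q0; apply: (@integrable_weight indx q (fun t => kern (t0 - t)) C mq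
  (bounded_dom qC q0)) => //.
- exact: integrable_itvb.
- by apply: measurableT_comp (measurable_kern alpha) _; exact: measurable_funB.
- by move=> t; exact: kern_ge0.
Qed.

Variables phi px pt : R * R -> R.
Hypothesis tphi : xt_test T s phi px pt.

Let cphi : {within closure Q, continuous phi}. Proof. by case: tphi => -[]. Qed.
Let cpt : {within closure Q, continuous pt}. Proof. by case: tphi. Qed.

Let F := phi \_ Q.
Let Ft := pt \_ Q.
Let mF := closure_measurable dom cphi.
Let mFt := closure_measurable dom cpt.

Let slice x (f : R * R -> R) : 0 < x < s T -> x != b ->
  forall t, ~~ (a x < t < T) -> (f \_ Q) (x, t) = 0.
Proof.
move=> /andP[x0 xT] xb t nt; rewrite patch_off// => /(Qs_slice dom _ x0 xT xb).
exact/negP.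
Qed.

Section damp.
Variable t0 : R.

Definition damp (z : R * R) : R := F z / jump t0 z.2.

Let jge1 t := jump_ge1 t0 t.

Lemma damp_off z : ~ Q z -> damp z = 0.
Proof. by move=> nQ; rewrite /damp /F patch_off// mul0r. Qed.

Lemma damp_le z : `|damp z| <= `|F z|.
Proof.
rewrite /damp normrM normfV ler_piMr// invf_le1; last first.
  by rewrite normr_gt0 gt_eqF// (lt_le_trans _ (jge1 _)).
by rewrite (le_trans (jge1 z.2))// ler_norm.
Qed.

Lemma le_damp z : F z ^+ 2 <= 4 * damp z ^+ 2.
Proof.
have -> : F z = jump t0 z.2 * damp z.
  by rewrite /damp mulrCA divff ?mulr1// gt_eqF// (lt_le_trans _ (jge1 _)).
rewrite exprMn ler_wpM2r ?sqr_ge0// /jump; case: (_ < _) => /=; lra.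
Qed.

Lemma measurable_damp : measurable_fun [set: plane R] damp.
Proof.
apply: measurable_funM => //.
exact: (measurableT_comp (measurable_jumpV t0) measurable_snd).
Qed.

Lemma damp_bounded : exists2 C, 0 <= C & forall z, `|damp z| <= C.
Proof.
have [C [C0 FC]] := closure_bounded dom cphi.
by exists C => // z; exact: le_trans (damp_le z) (FC z).
Qed.

Lemma sqint_damp : sqint mu2 damp.
Proof.
have [C C0 cC] := damp_bounded.
apply: (@sqint2_bounded _ (s T) T C) => //; first exact: measurable_damp.
move=> z nz; apply: damp_off => /(Qs_rect dom) Qz; exact: nz.
Qed.

Let damp2_off z : ~ Q z -> damp z ^+ 2 = 0.
Proof. by move=> /damp_off ->; rewrite expr0n. Qed.

Lemma integrable_damp_before c :
  mu2.-integrable setT (EFin \o (fun z => damp z ^+ 2 * kern (c - z.2))).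
Proof.
have [C C0 cC] := damp_bounded.
apply: (@integrable_kern_before _ (C ^+ 2)) => //.
- by apply: measurable_funX; exact: measurable_damp.
- by move=> z; rewrite normrX lerXn2r ?nnegrE.
Qed.

Lemma integrable_damp_after :
  mu2.-integrable setT (EFin \o (fun z => damp z ^+ 2 * (z.1 < b)%R%:R * kern z.2)).
Proof.
have [C C0 cC] := damp_bounded.
apply: (@integrable_kern_after _ (C ^+ 2)) => //.
- apply: measurable_funM; first by apply: measurable_funX; exact: measurable_damp.
  by apply: measurable_natb; apply: measurable_fun_ltr.
- move=> z; rewrite normrM normrX -[leRHS]mulr1 ler_pM ?exprn_ge0//.
    by rewrite lerXn2r ?nnegrE.
  by case: (_ < _); rewrite ?normr1 ?normr0.
- by move=> z /damp2_off ->; rewrite mul0r.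
Qed.

(** [rcaputo_coercive] is applied on the slices [x != b], with entry time [sinv x]. The entry term
    is nonnegative and is dropped for [x >= b]; for [x < b] the entry time is 0 and the term is kept
    with its weight [kern t], singular at the initial time. *)
Lemma plane_coercive :
  2^-1 * (\int[mu2]_z (damp z ^+ 2 * kern (t0 - z.2)) +
          \int[mu2]_z (damp z ^+ 2 * (z.1 < b)%R%:R * kern z.2))
  <= dot mu2 damp (rc2 alpha T s pt \_ Q).
Proof.
have i1 := integrable_damp_before t0; have i2 := integrable_damp_after.
have i3 := sqintM sqint_damp (sqint_rc2 alpha01 dom cpt).
have E z : damp z * (rc2 alpha T s pt \_ Q) z = damp z * rc2 alpha T s pt z.
  by have [Qz|/damp_off ->] := pselect (Q z); rewrite ?mul0r// patch_in.
have j1 := integrable_Rintegral1 i1; have j2 := integrable_Rintegral1 i2.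
have j3 := integrable_Rintegral1 i3.
rewrite /dot -(Rintegral_prod1 i1) -(Rintegral_prod1 i2) -(Rintegral_prod1 i3).
apply: (ae_half_sum_le j1 j2 j3).
have := ae_neq b; apply: (@filterS _ _ (ae_filter_ringOfSetsType mu)) => x xb.
have [xI|nxI] := boolP (0 < x < s T); last first.
  have c0 t : damp (x, t) = 0 by rewrite /damp /F (patch_slice_x dom)// mul0r.
  by rewrite !Rintegral_eq0 ?addr0 ?mulr0// => t;
     rewrite c0 ?expr0n ?mul0r// !mul0r.
have [C [C0 FC]] := closure_bounded dom cphi.
have [L [L0 FL]] := closure_bounded dom cpt.
have /andP[x0 xT] := xI.
have := @rcaputo_coercive _ _ alpha01 (a x) T L C (fun t => F (x, t)) (fun t => Ft (x, t))
  (measurable_slice_t x mF) (measurable_slice_t x mFt) (fun t => FC (x, t))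
  (fun t => FL (x, t)) (slice phi xI xb) (slice pt xI xb) (t_slice_FTC dom tphi xI xb) t0.
under [X in _ <= X -> _]eq_Rintegral do rewrite -E.
apply: le_trans; rewrite ler_wpM2l// lerD2l.
have cE t : (damp (x, t) ^+ 2) * kern (t - a x) =
   (F (x, t) / jump t0 t) ^+ 2 * kern (t - a x) by [].
have [bx|xb'] := leP b x.
  rewrite Rintegral_eq0; last by move=> t /=; rewrite mulr0 mul0r.
  by apply: Rintegral_ge0 => t _; rewrite mulr_ge0 ?sqr_ge0 ?kern_ge0.
rewrite le_eqVlt; apply/orP; left; apply/eqP/eq_Rintegral => t _ /=.
by rewrite mulr1 /sinv (ltW xb') subr0.
Qed.

End damp.

End plane_coercivity.

(** * A priori estimate and existence *)

Section data_bounds.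
Context {R : realType} (alpha b T : R) (s : R -> R).
Hypothesis alpha01 : 0 < alpha < 1.
Hypothesis dom : moving_domain b T s.

Let T0 : 0 < T. Proof. by case: dom. Qed.
Let b0 : 0 < b. Proof. by case: dom. Qed.

Local Notation Q := (Qs s T).
Local Notation a := (sinv b T s).
Local Notation mu := (@lebesgue_measure R).
Local Notation mu2 := (@lebesgue_measure R \x @lebesgue_measure R)%E.
Local Notation kern := (kern alpha).

Let b_sT : b <= s T. Proof. by apply: (s_geb dom) => //; exact: ltW. Qed.

Lemma sqint_itv_open (h : R -> R) : {within `[0, T], continuous h} ->
  sqint mu (h \_ `]0, T[).
Proof.
move=> ch; pose i (t : R) : R := ((0 < t) && (t < T))%R%:R.
have mi : measurable_fun setT (fun t : R => (0 < t) && (t < T)).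
  by apply: measurable_and; exact: measurable_fun_ltr.
have E (g : R -> R) : g \_ `]0, T[ = (fun t => (g \_ `[0, T]) t * i t).
  apply/funext => t; rewrite /i !patchE !mem_setE !in_itv/=.
  case: (boolP (0 < t < T)) => [/andP[t0 tT]|]; last by rewrite mulr0.
  by rewrite !ltW// mulr1.
have ih (g : R -> R) : {within `[0, T], continuous g} ->
    mu.-integrable setT (EFin \o (g \_ `]0, T[)).
  by move=> cg; rewrite E; apply: integrable_mulb => //; exact: integrable_continuous_itv.
split; first exact: integrableR_measurable (ih _ ch).
have -> : (fun t => (h \_ `]0, T[) t ^+ 2) = (fun t => h t ^+ 2) \_ `]0, T[.
  by apply/funext => t; rewrite !patchE; case: ifPn => // _; rewrite expr0n.
apply: ih; move/subspace_continuousP: ch => ch; apply/subspace_continuousP => t tT.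
by apply: cvgM; exact: ch.
Qed.

Section boundary_flux.
Variables (phi px : R * R -> R) (h : R -> R).
Hypothesis xphi : x_test T s phi px.
Hypothesis ch : {within `[0, T], continuous h}.

Lemma boundary_sqint : sqint mu ((fun t => phi (0, t)) \_ `]0, T[).
Proof.
apply: sqint_itv_open; have [c _ _ _] := xphi.
apply: (within_continuous_slice (B := closure Q) _ (@continuous_pair1 _ 0) c) => t.
rewrite /= in_itv/= => /andP[t0 tT]; apply: (closure_Qs dom) => //.
by rewrite (le_trans (ltW b0))// (s_geb dom).
Qed.

Lemma boundary_flux_dot : \int[mu]_(t in `]0, T[) (h t * phi (0, t)) =
  dot mu (h \_ `]0, T[) ((fun t => phi (0, t)) \_ `]0, T[).
Proof.
rewrite Rintegral_mkcond; apply: eq_Rintegral => t _.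
by rewrite !patchE; case: ifPn => // _; rewrite mulr0.
Qed.

Lemma boundary_flux_bound : (\int[mu]_(t in `]0, T[) (h t * phi (0, t))) ^+ 2 <=
  dot mu (h \_ `]0, T[) (h \_ `]0, T[) * (s T * dot mu2 (px \_ Q) (px \_ Q)).
Proof.
rewrite boundary_flux_dot.
have sb := boundary_sqint.
rewrite (le_trans (dot_cauchy_schwarz (sqint_itv_open ch) sb))// ler_wpM2l ?dot_ge0//.
have [_ cpx _ _] := xphi.
have spx := sqint_closure dom cpx.
have i2 : mu2.-integrable setT (EFin \o (fun z => (px \_ Q) z * (px \_ Q) z)).
  exact: sqintM.
rewrite [X in _ * X]/dot -(Rintegral_prod2 i2) -RintegralZl//; last first.
  exact: integrable_Rintegral2 i2.
apply: le_Rintegral => //.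
- exact: sqintM.
- by apply: integrableZR; exact: integrable_Rintegral2 i2.
- move=> t _; rewrite patchE mem_setE in_itv/=; case: ifPn => [t0T|_].
    have := x_slice_bound dom xphi t0T; rewrite expr2 => /le_trans; apply.
    by under eq_Rintegral do rewrite expr2.
  rewrite mulr0 mulr_ge0//; first by rewrite ltW// (sT_gt0 dom).
  by apply: Rintegral_ge0 => x _; rewrite -expr2 sqr_ge0.
Qed.

End boundary_flux.

Section initial_datum.
Variable u0 : R -> R.
Hypothesis su0 : sqint mu (u0 \_ `]0, b[).

Local Notation e0 := (u0 \_ `]0, b[).

(** The initial datum frozen in time, so that the difference of a solution and [datum] is again a
    square-integrable function on the plane that vanishes off [Q]. *)
Definition datum (z : R * R) : R := e0 z.1 * ((0 < z.2) && (z.2 < T))%R%:R.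

Let e0_off x : ~~ (0 < x < b) -> e0 x = 0.
Proof. by move=> xb; rewrite patchE mem_setE in_itv/= (negbTE xb). Qed.

Lemma datum_off z : ~ Q z -> datum z = 0.
Proof.
move=> nQ; rewrite /datum; have [/andP[x0 xb]|/e0_off ->] := boolP (0 < z.1 < b); last first.
  by rewrite mul0r.
have [/andP[t0 tT]|] := boolP (0 < z.2 < T); last by rewrite mulr0.
exfalso; apply: nQ; split; rewrite ?t0// x0.
by rewrite (lt_le_trans xb)// (s_geb dom)// ltW.
Qed.

Lemma measurable_datum : measurable_fun [set: plane R] datum.
Proof.
apply: measurable_funM; first exact: measurableT_comp su0.1 measurable_fst.
by apply: measurable_natb; apply: measurable_and; apply: measurable_fun_ltr.
Qed.

Lemma sqint_datum : sqint mu2 datum.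
Proof.
split; first exact: measurable_datum.
have := integrable_prodM su0.2 (integrable_itvb 0 T).
apply: eq_integrable => // z _ /=; congr EFin; rewrite /datum exprMn.
by case: (_ && _); rewrite ?expr1n ?expr0n.
Qed.

Let e0_int : mu.-integrable setT (EFin \o e0).
Proof.
have gi := integrable_itvb 0 b.
have sg : sqint mu (fun x : R => ((0 < x) && (x < b))%R%:R).
  split; first exact: integrableR_measurable gi.
  apply: eq_integrable gi => // x _ /=; congr EFin.
  by case: (_ && _); rewrite ?expr1n ?expr0n.
have := sqintM su0 sg; apply: eq_integrable => // x _ /=; congr EFin.
by case: (boolP (0 < x < b)) => [|/e0_off ->]; rewrite ?mulr1 ?mul0r.
Qed.

Let ind_kern := integrable_itvb_kern alpha01 T.

Definition datum_mass := \int[mu2]_z (datum z ^+ 2 * kern z.2).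

Let datum_mass_int : mu2.-integrable setT (EFin \o (fun z => datum z ^+ 2 * kern z.2)).
Proof.
have := integrable_prodM su0.2 ind_kern.
apply: eq_integrable => // z _ /=; congr EFin; rewrite /datum exprMn mulrA.
by case: (_ && _); rewrite ?expr1n ?expr0n.
Qed.

Variables phi px pt : R * R -> R.
Hypothesis tphi : xt_test T s phi px pt.

Let cphi : {within closure Q, continuous phi}. Proof. by case: tphi => -[]. Qed.
Let cpt : {within closure Q, continuous pt}. Proof. by case: tphi. Qed.
Let F := phi \_ Q.
Let Ft := pt \_ Q.
Let mF := closure_measurable dom cphi.
Let mFt := closure_measurable dom cpt.

Let DF_int : mu2.-integrable setT (EFin \o (fun z => datum z * F z * kern z.2)).
Proof.
have [C [C0 FC]] := closure_bounded dom cphi.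
apply: (@integrable_weight _ T e0 (fun z => datum z * F z) kern C) => //.
- by apply: measurable_funM => //; exact: measurable_datum.
- move=> z; rewrite /datum !normrM mulrAC [X in X * _]mulrC ler_pM ?mulr_ge0//.
    by rewrite ler_wpM2r.
  by case: (_ && _); rewrite ?normr1 ?normr0.
- exact: measurable_kern.
- by move=> t; exact: kern_ge0.
Qed.

(** On each slice [x < b] the datum is constant in time, so [integral_rcaputo] with entry time 0
    replaces the fractional derivative of the test function by the test function itself against
    [kern t]. *)
Lemma datum_term : dot mu2 datum (rc2 alpha T s pt \_ Q) =
  \int[mu2]_z (datum z * F z * kern z.2).
Proof.
have i1 := sqintM sqint_datum (sqint_rc2 alpha01 dom cpt).
rewrite /dot -(Rintegral_prod1 i1) -(Rintegral_prod1 DF_int).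
apply: eq_Rintegral => x _.
have [xI|/e0_off ex] := boolP (0 < x < b); last first.
  by rewrite !Rintegral_eq0// => t; rewrite /datum /= ex !mul0r.
have /andP[x0 xb] := xI.
have xT : x < s T := lt_le_trans xb b_sT.
have [C [C0 FC]] := closure_bounded dom cphi.
have [L [L0 FL]] := closure_bounded dom cpt.
have ax : a x = 0 by rewrite /sinv (ltW xb).
have xnb : x != b by rewrite lt_eqF.
have xI' : 0 < x < s T by rewrite x0.
have off (f : R * R -> R) t : ~~ (0 < t < T) -> (f \_ Q) (x, t) = 0.
  exact: (patch_slice_t dom).
have ftc := t_slice_FTC dom tphi xI' xnb; rewrite ax in ftc.
have I1 := @integral_rcaputo _ _ alpha01 0 T L C (fun t => F (x, t)) (fun t => Ft (x, t))
  (measurable_slice_t x mF) (measurable_slice_t x mFt) (fun t => FC (x, t))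
  (fun t => FL (x, t)) (off phi) (off pt) ftc.
have gB (t : R) : `|((0 < t) && (t < T))%R%:R| <= 1 :> R.
  by case: (_ && _); rewrite ?normr1 ?normr0.
have g0 (t : R) : ~~ (0 < t < T) -> ((0 < t) && (t < T))%R%:R = 0 :> R.
  by move=> /negbTE ->.
have [I2 _] := @rcaputo_against _ _ alpha01 0 T L C (fun t => F (x, t)) (fun t => Ft (x, t))
  (measurable_slice_t x mF) (measurable_slice_t x mFt) (fun t => FC (x, t))
  (fun t => FL (x, t)) (off pt) ftc _ 1
  (integrableR_measurable (integrable_itvb 0 T)) gB g0.
transitivity (e0 x * \int[mu]_t (((0 < t) && (t < T))%R%:R *
    rcaputo alpha (fun t => Ft (x, t)) t)).
  rewrite -RintegralZl//; apply: eq_Rintegral => t _.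
  rewrite /datum /= -mulrA; congr (_ * _).
  case: (boolP (0 < t < T)) => [/andP[t0 tT]|_]; last by rewrite !mul0r.
  rewrite patch_in//; apply/(Qs_slice dom) => //.
  by rewrite ax t0.
rewrite I1 -RintegralZl//; last first.
  have := @integrable_kern_left _ _ alpha01 0 T C (fun t => F (x, t))
    (measurable_slice_t x mF) (fun t => FC (x, t)) (off phi).
  by [].
apply: eq_Rintegral => t _; rewrite /datum/= subr0 -!mulrA; congr (_ * _).
by case: (boolP (0 < t < T)) => [|/off Foff]; rewrite ?mul1r// /F Foff !mul0r.
Qed.

(** Cauchy-Schwarz with the singular weight [kern t] split evenly: the half on the test function is
    the entry term of [plane_coercive]. The 4 undoes the division by the weight, as in [le_damp]. *)
Lemma datum_bound (t0 : R) : dot mu2 datum (rc2 alpha T s pt \_ Q) ^+ 2 <=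
  datum_mass * (4 * \int[mu2]_z (damp T s phi t0 z ^+ 2 * (z.1 < b)%R%:R * kern z.2)).
Proof.
rewrite datum_term.
pose r (z : R * R) := Num.sqrt (kern z.2).
have mr : measurable_fun [set: plane R] r.
  exact: measurableT_comp (measurable_sqrt_kern alpha) measurable_snd.
have r2 z : r z ^+ 2 = kern z.2 by rewrite sqr_sqrtr// kern_ge0.
pose f1 z := datum z * r z.
pose f2 (z : plane R) : R := F z * (z.1 < b)%R%:R * r z.
have b2 (c : bool) : (c%:R : R) ^+ 2 = c%:R by case: c; rewrite ?expr1n ?expr0n.
have s1 : sqint mu2 f1.
  split; first by apply: measurable_funM => //; exact: measurable_datum.
  apply: eq_integrable datum_mass_int => // z _ /=; congr EFin.
  by rewrite -(r2 z) -exprMn.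
have i2 := integrable_damp_after alpha01 dom tphi t0.
have le2 z : f2 z ^+ 2 <= 4 * (damp T s phi t0 z ^+ 2 * (z.1 < b)%R%:R * kern z.2).
  have -> : f2 z ^+ 2 = F z ^+ 2 * (z.1 < b)%R%:R * kern z.2.
    by rewrite -(r2 z) -[X in _ * X * _]b2 /f2; ring.
  rewrite [leRHS]mulrA ler_wpM2r ?kern_ge0// [leRHS]mulrA ler_wpM2r//.
  exact: le_damp.
have s2 : sqint mu2 f2.
  have m2 : measurable_fun [set: plane R] f2.
    apply: measurable_funM => //; apply: measurable_funM => //.
    by apply: measurable_natb; apply: measurable_fun_ltr.
  split=> //; apply: (integrable_le _ (integrableZR 4 i2)).
    exact: measurable_funX.
  by move=> z; rewrite ger0_norm ?sqr_ge0.
have -> : \int[mu2]_z (datum z * F z * kern z.2) = dot mu2 f1 f2.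
  apply: eq_Rintegral => z _; rewrite /f1 /f2 -r2.
  case: (ltP z.1 b) => zb; first by rewrite mulr1 expr2; ring.
  rewrite /datum e0_off ?mul0r// negb_and -!leNgt zb orbT//.
rewrite (le_trans (dot_cauchy_schwarz s1 s2))//.
have -> : dot mu2 f1 f1 = datum_mass.
  by apply: eq_Rintegral => z _; rewrite -expr2 exprMn r2.
rewrite ler_wpM2l//.
  by apply: Rintegral_ge0 => z _; rewrite mulr_ge0 ?sqr_ge0 ?kern_ge0.
rewrite -RintegralZl//; apply: le_Rintegral => //.
- exact: sqintM.
- exact: integrableZR.
- by move=> z _; rewrite -expr2.
Qed.

End initial_datum.

End data_bounds.

(** The supremum need not be attained, and a point reaching half of it suffices; the loss is the 2
    found in [load_const] and [dual_radius]. If the supremum is not positive, [G] vanishes on [A]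
    and any point serves. *)
Lemma near_maximizer (R : realType) (A : set R) (G : R -> R) (B : R) :
  A !=set0 -> (forall c, A c -> 0 <= G c <= B) ->
  exists2 t0, A t0 & forall c, A c -> G c <= 2 * G t0.
Proof.
move=> [a Aa] GB; pose S := sup (G @` A).
have supS : has_sup (G @` A).
  split; first by exists (G a), a.
  by exists B => _ [c /GB/andP[_ cB] <-].
have GS c : A c -> G c <= S by move=> Ac; apply: ub_le_sup supS.2 _ _; exists c.
have [S0|S0] := leP S 0.
  exists a => // c /GS/le_trans; apply; rewrite (le_trans S0)// mulr_ge0//.
  by case/andP: (GB a Aa).
have SS : 0 < S / 2 by rewrite divr_gt0.
have [_ [t0 At0 <-] H] := sup_adherent SS supS.
by exists t0 => // c /GS/le_trans; apply; rewrite -/S in H; lra.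
Qed.

Section test_products.
Context {R : realType} (b T : R) (s : R -> R).
Hypothesis dom : moving_domain b T s.
Local Notation Q := (Qs s T).
Local Notation mu2 := (@lebesgue_measure R \x @lebesgue_measure R)%E.

Lemma x_testM (f fx g gx : R * R -> R) : x_test T s f fx -> x_test T s g gx ->
  x_test T s (fun z => f z * g z) (fun z => f z * gx z + fx z * g z).
Proof.
move=> [/subspace_continuousP f1 /subspace_continuousP f2 f3 f4].
move=> [/subspace_continuousP g1 /subspace_continuousP g2 g3 g4]; split.
- by apply/subspace_continuousP => z Qz; apply: cvgM; [exact: f1|exact: g1].
- apply/subspace_continuousP => z Qz; apply: cvgD; apply: cvgM;
    by [exact: f1|exact: f2|exact: g1|exact: g2].
- move=> x t Qxt; have H := is_deriveM (f3 _ _ Qxt) (g3 _ _ Qxt).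
  by apply: (is_derive_eq H); rewrite /GRing.scale/= [g _ * _]mulrC.
- by move=> t tT; rewrite f4// mul0r.
Qed.

(** A weight depending on time only leaves the integral over each slice in [x], which is then a
    boundary value. *)
Lemma weighted_x_FTC (w : R -> R) (C : R) (psi px : R * R -> R) :
  measurable_fun setT w -> (forall t, `|w t| <= C) ->
  x_test T s psi px -> (forall t, psi (0, t) = 0) ->
  \int[mu2]_z (w z.2 * (px \_ Q) z) = 0.
Proof.
move=> mw wC xt psi0; have [_ cpx _ _] := xt.
have [D [D0 pD]] := closure_bounded dom cpx.
have mpx := closure_measurable dom cpx.
have i2 : mu2.-integrable setT (EFin \o (fun z => w z.2 * (px \_ Q) z)).
  apply: (@integrable2_bounded _ (s T) T (C * D)).
  - by apply: measurable_funM => //; exact: measurableT_comp mw measurable_snd.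
  - by move=> z; rewrite normrM ler_pM.
  - by move=> z nz; rewrite (patch_Qs_rect dom)// mulr0.
rewrite -(Rintegral_prod2 i2); apply: Rintegral_eq0 => t /=.
have [tT|tT] := boolP (0 < t < T); last first.
  by apply: Rintegral_eq0 => x; rewrite (patch_slice_t dom)// mulr0.
rewrite RintegralZl//; first by rewrite (x_slice_FTC dom xt tT) psi0 oppr0 mulr0.
have ib := integrableZR D (integrable_itvb 0 (s T)).
apply: (integrable_le _ ib); first exact: measurable_slice_x.
move=> x /=; have [xs|xs] := boolP (0 < x < s T); first by rewrite mulr1 pD.
by rewrite (patch_slice_x dom)// normr0 mulr0.
Qed.

End test_products.

Section energy.
Context {R : realType} (alpha b T : R) (s : R -> R).
Hypothesis alpha01 : 0 < alpha < 1.
Hypothesis dom : moving_domain b T s.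
Local Notation Q := (Qs s T).
Local Notation mu := (@lebesgue_measure R).
Local Notation mu2 := (@lebesgue_measure R \x @lebesgue_measure R)%E.
Local Notation kern := (kern alpha).

Let T0 : 0 < T. Proof. by case: dom. Qed.

Lemma kern_mass_reflectE (x : R) :
  \int[mu]_t (kern (x - t) * (x - t <= T)%R%:R) = kern_mass alpha T.
Proof.
pose f r := kern r * (r <= T)%R%:R.
have mf := integrableR_measurable (kern_integrable alpha01 T).
have mfo : measurable_fun setT (fun t : R => f (- t)).
  exact: measurableT_comp mf (@oppr_measurable _ _).
have f0 t : (0 <= (f t)%:E)%E by rewrite lee_fin mulr_ge0 ?kern_ge0.
transitivity (\int[mu]_t f (- (t + - x))).
  by apply: eq_Rintegral => t _; rewrite /f opprB.
rewrite (Rintegral_translation (f := fun t => f (- t)) _ mfo).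
congr fine; rewrite (@ge0_integral_opp _ (fun t => (f t)%:E))//.
exact/measurable_EFinP.
Qed.

Definition energy (v : R * R -> R) (c : R) : R :=
  \int[mu2]_z (v z ^+ 2 * kern (c - z.2)).

Lemma energy_ge0 v c : 0 <= energy v c.
Proof. by apply: Rintegral_ge0 => z _; rewrite mulr_ge0 ?sqr_ge0 ?kern_ge0. Qed.

Lemma energy_integrable (v : R * R -> R) C c :
  measurable_fun [set: plane R] v ->
  (forall z, `|v z| <= C) -> (forall z, ~ Q z -> v z = 0) ->
  mu2.-integrable setT (EFin \o (fun z => v z ^+ 2 * kern (c - z.2))).
Proof.
move=> mv vC v0; apply: (@integrable_kern_before _ _ b T s alpha01 dom _ (C ^+ 2)).
- exact: measurable_funX.
- by move=> z; rewrite normrX lerXn2r ?nnegrE// (le_trans (normr_ge0 _) (vC z)).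
- by move=> z /v0 ->; rewrite expr0n.
Qed.

(** Uniformity in [c] is what allows [near_maximizer] to choose [t0]. *)
Lemma energy_bounded (v : R * R -> R) C :
  measurable_fun [set: plane R] v ->
  (forall z, `|v z| <= C) -> (forall z, ~ Q z -> v z = 0) ->
  exists B, forall c, c <= T -> energy v c <= B.
Proof.
move=> mv vC v0.
exists (\int[mu]_x (C ^+ 2 * ((0 < x) && (x < s T))%R%:R * kern_mass alpha T)) => c cT.
have vi := energy_integrable c mv vC v0.
have gi := integrable_prodM (integrableZR (C ^+ 2) (integrable_itvb 0 (s T)))
  (kern_mass_reflect alpha01 T c).
have -> : \int[mu]_x (C ^+ 2 * ((0 < x) && (x < s T))%R%:R * kern_mass alpha T) =
   \int[mu2]_z (C ^+ 2 * ((0 < z.1) && (z.1 < s T))%R%:R *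
      (kern (c - z.2) * (c - z.2 <= T)%R%:R)).
  rewrite -(Rintegral_prod1 gi); apply: eq_Rintegral => x _ /=.
  by rewrite RintegralZl ?kern_mass_reflectE//; exact: kern_mass_reflect.
apply: le_Rintegral => // z _.
have [Qz|/v0 ->] := pselect (Q z); last first.
  by rewrite expr0n /= mul0r; apply: mulr_ge0; apply: mulr_ge0; rewrite ?sqr_ge0 ?kern_ge0.
have [-> /andP[z0 _]] := Qs_rect dom Qz.
have -> : c - z.2 <= T by rewrite lerBlDr (le_trans cT)// lerDl ltW.
rewrite !mulr1 ler_wpM2r ?kern_ge0// -[leLHS]ger0_norm ?sqr_ge0// normrX.
by rewrite lerXn2r ?nnegrE// (le_trans (normr_ge0 _) (vC z)).
Qed.

(** On (0, T) the kernel [kern (T - t)] is at least T^(-alpha). *)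
Lemma dot_le_energy (v : R * R -> R) : sqint mu2 v -> (forall z, ~ Q z -> v z = 0) ->
  mu2.-integrable setT (EFin \o (fun z => v z ^+ 2 * kern (T - z.2))) ->
  dot mu2 v v <= T `^ alpha * energy v T.
Proof.
move=> sv v0 vi; rewrite -RintegralZl//; apply: le_Rintegral => //.
- exact: sqintM.
- exact: integrableZR.
move=> z _; rewrite -expr2; have [Qz|/v0 ->] := pselect (Q z); last first.
  by rewrite expr0n mul0r mulr0.
have [_ /andP[z0 zT]] := Qs_rect dom Qz.
rewrite mulrCA -[leLHS]mulr1 ler_wpM2l ?sqr_ge0//.
have Tz : 0 < T - z.2 by rewrite subr_gt0.
have TzT : T - z.2 <= T by rewrite gerBl ltW.
rewrite (le_trans _ (ler_wpM2l (powR_ge0 _ _) (ler_kern alpha01 Tz TzT)))//.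
by rewrite kern_gt0// powRN divff// gt_eqF// powR_gt0.
Qed.

End energy.

(** * The a priori estimate *)

Section energy_estimate.
Context {R : realType} (alpha b T : R) (s : R -> R).
Hypothesis alpha01 : 0 < alpha < 1.
Hypothesis dom : moving_domain b T s.
Local Notation Q := (Qs s T).
Local Notation mu := (@lebesgue_measure R).
Local Notation mu2 := (@lebesgue_measure R \x @lebesgue_measure R)%E.
Local Notation kern := (kern alpha).

Variable kap : R.
Hypothesis kap0 : 0 < kap.
Variables (f : R * R -> R) (h u0 : R -> R).
Hypothesis sf : sqint mu2 (f \_ Q).
Hypothesis ch : {within `[0, T], continuous h}.
Hypothesis su0 : sqint mu (u0 \_ `]0, b[).

Let T0 : 0 < T. Proof. by case: dom. Qed.

(** The right-hand side of the weak formulation, with the term of the initial datum brought over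
    after integration by parts; [kap] stands for 1 / Gamma(1 - alpha). *)
Definition load (phi pt : R * R -> R) : R :=
  \int[mu]_(t in `]0, T[) (h t * phi (0, t)) + dot mu2 (f \_ Q) (phi \_ Q) +
  kap * dot mu2 (datum b T u0) (rc2 alpha T s pt \_ Q).

(** The 3 comes from the square of a sum of three terms, 2 T^alpha from [dot_le_energy] and the
    near-maximality of [t0], and the 4 from [datum_bound]. *)
Definition load_const : R :=
  3 * (dot mu (h \_ `]0, T[) (h \_ `]0, T[) * s T +
       dot mu2 (f \_ Q) (f \_ Q) * (2 * T `^ alpha) +
       kap ^+ 2 * (4 * datum_mass alpha b T u0)).

Let sqr3 (x y z : R) : (x + y + z) ^+ 2 <= 3 * (x ^+ 2 + y ^+ 2 + z ^+ 2).
Proof.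
rewrite -subr_ge0.
have -> : 3 * (x ^+ 2 + y ^+ 2 + z ^+ 2) - (x + y + z) ^+ 2 =
  (x - y) ^+ 2 + (x - z) ^+ 2 + (y - z) ^+ 2 by ring.
by rewrite !addr_ge0 ?sqr_ge0.
Qed.

Let load_arith (x y z X Y Z D : R) : x ^+ 2 <= X * D -> y ^+ 2 <= Y * D ->
  z ^+ 2 <= Z * D -> (x + y + kap * z) ^+ 2 <= 3 * (X + Y + kap ^+ 2 * Z) * D.
Proof.
move=> xX yY zZ; rewrite (le_trans (sqr3 _ _ _))// -mulrA ler_wpM2l// exprMn.
by rewrite 2!mulrDl !lerD// -mulrA ler_wpM2l// sqr_ge0.
Qed.

Section fixed_test.
Variables phi px pt : R * R -> R.
Hypothesis tphi : xt_test T s phi px pt.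
Variable t0 : R.

Let cphi : {within closure Q, continuous phi}. Proof. by case: tphi => -[]. Qed.
Let cpx : {within closure Q, continuous px}. Proof. by case: tphi => -[]. Qed.
Let mphi := closure_measurable dom cphi.

Local Notation vphi := (damp T s phi t0).

Definition early_mass := \int[mu2]_z (vphi z ^+ 2 * (z.1 < b)%R%:R * kern z.2).

(** One summand for each datum: the energy bounds the pairing with [f], [early_mass] that with the
    initial datum, and the gradient the boundary flux. *)
Definition test_size :=
  energy alpha (phi \_ Q) t0 + early_mass + dot mu2 (px \_ Q) (px \_ Q).

Definition damp_x (z : R * R) := (px \_ Q) z / jump t0 z.2.

Let jge1 t := jump_ge1 t0 t.
Let jgt0 t : 0 < jump t0 t. Proof. exact: lt_le_trans (jge1 t). Qed.
Let jinv_le1 t : (jump t0 t)^-1 <= 1. Proof. by rewrite invf_le1. Qed.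
Let jinv_ge t : 2^-1 <= (jump t0 t)^-1.
Proof. by rewrite lef_pV2 ?posrE// /jump; case: (_ < _) => /=; lra. Qed.

Lemma early_mass_ge0 : 0 <= early_mass.
Proof.
by apply: Rintegral_ge0 => z _; rewrite mulr_ge0 ?kern_ge0// mulr_ge0 ?sqr_ge0.
Qed.

Lemma sqint_damp_x : sqint mu2 damp_x.
Proof.
apply: sqint_le (sqint_closure dom cpx) _.
  apply: measurable_funM; first exact: (closure_measurable dom cpx).
  exact: (measurableT_comp (measurable_jumpV t0) measurable_snd).
move=> z; rewrite /damp_x normrM ler_piMr// ger0_norm ?jinv_le1// invr_ge0.
exact: ltW.
Qed.

(** The choice of [t0] enters at the time [T] only, to pass from the L^2 norm of [phi], controlled
    by the energy at [T], to the energy at [t0]. *)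
Lemma load_bound :
  (forall c, 0 < c <= T -> energy alpha (phi \_ Q) c <= 2 * energy alpha (phi \_ Q) t0) ->
  load phi pt ^+ 2 <= load_const * test_size.
Proof.
move=> sup_t0; have xphi : x_test T s phi px by case: tphi.
have e1 := boundary_flux_bound dom xphi ch.
have e3 := datum_bound alpha01 dom su0 tphi t0.
have sphi := sqint_closure dom cphi.
have e2 := dot_cauchy_schwarz sf sphi.
have off z : ~ Q z -> (phi \_ Q) z = 0 by exact: patch_off.
have [C [C0 phiC]] := closure_bounded dom cphi.
have ei := energy_integrable alpha01 dom T mphi phiC off.
have e4 := dot_le_energy alpha01 dom sphi off ei.
have TT : 0 < T <= T by rewrite T0 lexx.
have e5 := sup_t0 T TT.
have Ta := powR_ge0 T alpha.
have W0 := early_mass_ge0.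
have E0 := energy_ge0 alpha (phi \_ Q) t0.
have Dx0 := dot_ge0 mu2 (px \_ Q).
have ff0 := dot_ge0 mu2 (f \_ Q).
have hh0 := dot_ge0 mu (h \_ `]0, T[).
have dm0 : 0 <= datum_mass alpha b T u0.
  by apply: Rintegral_ge0 => z _; rewrite mulr_ge0 ?sqr_ge0 ?kern_ge0.
have sT0 := sT_gt0 dom.
apply: load_arith.
- apply: le_trans e1 _; rewrite -mulrA; apply: ler_wpM2l => //.
  by apply: ler_wpM2l; [exact: ltW|rewrite lerDr; exact: addr_ge0 E0 W0].
- apply: le_trans e2 _; rewrite -mulrA; apply: ler_wpM2l => //.
  apply: le_trans e4 _; rewrite [2 * _]mulrC -mulrA; apply: ler_wpM2l => //.
  apply: le_trans e5 _; apply: ler_wpM2l => //; rewrite /test_size -addrA lerDl.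
  exact: addr_ge0 W0 Dx0.
- apply: le_trans e3 _; rewrite [4 * datum_mass _ _ _ _]mulrC -mulrA.
  apply: ler_wpM2l => //; apply: ler_wpM2l => //; rewrite /test_size addrAC lerDr.
  exact: addr_ge0 E0 Dx0.
Qed.

(** 1/8 is the 1/2 of [plane_coercive] times the 1/4 lost between the energies of [phi] and of [phi]
    over the weight; the other 1/2 is the least value of the inverse weight. *)
Definition coercivity_const := Num.min (kap / 8) 2^-1.

Lemma test_coercive :
  coercivity_const * test_size <=
  kap * dot mu2 vphi (rc2 alpha T s pt \_ Q) + dot mu2 damp_x (px \_ Q).
Proof.
have e1 := plane_coercive alpha01 dom tphi t0.
rewrite -/(energy alpha vphi t0) -/early_mass in e1.
have W0 := early_mass_ge0.
have off z : ~ Q z -> (phi \_ Q) z = 0 by exact: patch_off.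
have [C [C0 phiC]] := closure_bounded dom cphi.
have ei := energy_integrable alpha01 dom t0 mphi phiC off.
have i1 := integrable_damp_before alpha01 dom tphi t0 t0.
have e2 : energy alpha (phi \_ Q) t0 <= 4 * energy alpha vphi t0.
  rewrite -RintegralZl//; apply: le_Rintegral => //; first exact: integrableZR.
  by move=> z _; rewrite mulrA ler_wpM2r ?kern_ge0// le_damp.
have spx := sqint_closure dom cpx.
have e3 : 2^-1 * dot mu2 (px \_ Q) (px \_ Q) <= dot mu2 damp_x (px \_ Q).
  rewrite -RintegralZl//; last exact: sqintM.
  apply: le_Rintegral => //.
  - by apply: integrableZR; exact: sqintM.
  - exact: sqintM sqint_damp_x spx.
  - by move=> z _; rewrite /damp_x mulrAC mulrC ler_wpM2l// -expr2 sqr_ge0.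
have E0 : 0 <= energy alpha (phi \_ Q) t0 := energy_ge0 _ _ _.
have Dx0 : 0 <= dot mu2 (px \_ Q) (px \_ Q) := dot_ge0 _ _.
have c1 : coercivity_const <= kap / 8 by rewrite ge_min lexx.
have c2 : coercivity_const <= 2^-1 by rewrite ge_min lexx orbT.
rewrite /test_size mulrDr lerD//; last first.
  by rewrite (le_trans _ e3)// ler_wpM2r.
apply: (le_trans (ler_wpM2r (addr_ge0 E0 W0) c1)).
rewrite (le_trans _ (ler_wpM2l (ltW kap0) e1))// -mulrA ler_wpM2l ?(ltW kap0)//.
lra.
Qed.

(* [damp * psx + damp_x * psi] is the x-derivative of [phi * psi] divided by a
   weight that depends on time only. *)
Lemma damp_bracket (psi psx : R * R -> R) : x_test T s psi psx ->
  (forall t, psi (0, t) = 0) ->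
  dot mu2 vphi (psx \_ Q) + dot mu2 damp_x (psi \_ Q) = 0.
Proof.
move=> xpsi psi0; have xphi : x_test T s phi px by case: tphi.
have [cpsi cpsx _ _] := xpsi.
have xprod := x_testM xphi xpsi.
rewrite -RintegralD//; last 2 first.
- exact: sqintM (sqint_damp dom tphi t0) (sqint_closure dom cpsx).
- exact: sqintM sqint_damp_x (sqint_closure dom cpsi).
rewrite -[RHS](@weighted_x_FTC _ _ _ _ dom _ 1 _ _ (measurable_jumpV t0) _ xprod)//.
- apply: eq_Rintegral => z _; rewrite /damp_x /damp.
  have [Qz|nQ] := pselect (Q z); last by rewrite !patch_off// !mul0r !mulr0 addr0.
  rewrite !patch_in//; ring.
- by move=> t; rewrite ger0_norm ?jinv_le1// invr_ge0 ltW.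
- by move=> t; rewrite psi0 mulr0.
Qed.

End fixed_test.
End energy_estimate.

(** Monotone convergence in the truncation level, the truncated integrands being eventually constant
    at each point. It recovers the full kernel from bounds obtained with a bounded one. *)
Lemma integrable_truncation d (X : measurableType d) (R : realType)
    (m : {measure set X -> \bar R}) (w k : X -> R) (M : R) :
  measurable_fun setT w -> measurable_fun setT k ->
  (forall x, 0 <= w x) -> (forall x, 0 <= k x) ->
  (forall n : nat, m.-integrable setT (EFin \o (fun x => w x * Num.min (k x) n%:R)) /\
     \int[m]_x (w x * Num.min (k x) n%:R) <= M) ->
  m.-integrable setT (EFin \o (fun x => w x * k x)) /\ \int[m]_x (w x * k x) <= M.
Proof.
move=> mw mk w0 k0 H; pose g (n : nat) x := (w x * Num.min (k x) n%:R)%:E.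
have g0 n x : (0 <= g n x)%E by rewrite lee_fin mulr_ge0// le_min k0 ler0n.
have mg n : measurable_fun setT (g n).
  by apply/measurable_EFinP; apply: measurable_funM => //; apply: measurable_minr.
have ndg x : {homo g^~ x : n p / (n <= p)%N >-> (n <= p)%E}.
  move=> n p np; rewrite lee_fin ler_wpM2l// le_min ge_min lexx/= ge_min.
  by rewrite ler_nat np orbT.
have gM n : (\int[m]_x g n x <= M%:E)%E.
  have [i iM] := H n; have fin := integrable_fin_num measurableT i.
  by rewrite -(fineK fin) lee_fin.
have lg x : limn (g^~ x) = (w x * k x)%:E.
  apply: cvg_lim => //; apply: cvg_near_cst.
  exists (Num.truncn (k x)).+1 => // n /= kn; rewrite /g min_l//.
  rewrite ltW// (lt_le_trans (truncnS_gt _))// ler_nat.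
  exact: kn.
have E : (\int[m]_x (w x * k x)%:E = limn (fun n => \int[m]_x g n x))%E.
  rewrite -monotone_convergence//; apply: eq_integral => x _.
  by rewrite lg.
have I : (\int[m]_x (w x * k x)%:E <= M%:E)%E.
  rewrite E; apply: lime_le; last exact: nearW.
  apply: ereal_nondecreasing_is_cvgn => n p np.
  by apply: ge0_le_integral => // x _; exact: ndg.
have I0 : (0 <= \int[m]_x (w x * k x)%:E)%E.
  by apply: integral_ge0 => x _; rewrite lee_fin mulr_ge0.
split; last first.
  rewrite -lee_fin fineK//.
  by rewrite fin_numE gt_eqF ?(lt_le_trans (ltNyr 0))// lt_eqF// (le_lt_trans I)// ltry.
apply/integrableP; split; first by apply/measurable_EFinP; exact: measurable_funM.
under eq_integral do rewrite /= ger0_norm ?mulr_ge0//.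
by rewrite (le_lt_trans I)// ltry.
Qed.

Lemma sqint_patch d (X : measurableType d) (R : realType)
    (m : {measure set X -> \bar R}) (A : set X) (f : X -> R) :
  measurable A -> sqint m f -> sqint m (f \_ A).
Proof.
move=> mA [mf f2]; apply: (sqint_le _ (conj mf f2)).
  by apply/(measurable_restrictT _ mA); exact: measurable_funTS.
by move=> z; rewrite patchE; case: ifPn => // _; rewrite normr0.
Qed.

(** * Duality and the energy solution *)

Section existence.
Context {R : realType} (alpha b T : R) (s : R -> R).
Hypothesis alpha01 : 0 < alpha < 1.
Hypothesis dom : moving_domain b T s.
Local Notation Q := (Qs s T).
Local Notation mu := (@lebesgue_measure R).
Local Notation mu2 := (@lebesgue_measure R \x @lebesgue_measure R)%E.
Local Notation kern := (kern alpha).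

Variable kap : R.
Hypothesis kap0 : 0 < kap.
Variables (f : R * R -> R) (h u0 : R -> R).
Hypothesis sf : sqint mu2 (f \_ Q).
Hypothesis ch : {within `[0, T], continuous h}.
Hypothesis su0 : sqint mu (u0 \_ `]0, b[).

Let T0 : 0 < T. Proof. by case: dom. Qed.

Local Notation ell := (load alpha b T s kap f h u0).

Lemma patch_lin (A : set (R * R)) (f1 f2 : R * R -> R) (a : R) :
  (fun z => a * f1 z + f2 z) \_ A = (fun z => a * (f1 \_ A) z + (f2 \_ A) z).
Proof.
apply/funext => z; have [Az|nA] := pselect (A z); first by rewrite !patch_in.
by rewrite !patch_off// mulr0 addr0.
Qed.

Lemma rc2_lin (p1 p2 : R * R -> R) (a : R) :
  {within closure Q, continuous p1} -> {within closure Q, continuous p2} ->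
  rc2 alpha T s (fun z => a * p1 z + p2 z) \_ Q =
  (fun z => a * (rc2 alpha T s p1 \_ Q) z + (rc2 alpha T s p2 \_ Q) z).
Proof.
move=> c1 c2; rewrite -patch_lin; apply/funext => z.
have [Qz|nQ] := pselect (Q z); last by rewrite !patch_off.
rewrite !patch_in// /rc2 /rcaputo; have [_ /andP[z0 _]] := Qs_rect dom Qz.
have I (p : R * R -> R) : {within closure Q, continuous p} -> mu.-integrable setT
    (EFin \o (fun t => (p \_ Q) (z.1, t) * kern (t - z.2))).
  move=> cp; have [C [C0 pC]] := closure_bounded dom cp.
  have mp := closure_measurable dom cp.
  by have [] := @psi_kern_bound _ _ alpha01 T C (fun t => (p \_ Q) (z.1, t))
    (measurable_slice_t z.1 mp) (fun t => pC _) (patch_slice_t dom p z.1) _ z0.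
rewrite mulrN -opprD -RintegralZl//; last exact: I.
rewrite -RintegralD//; [|exact: integrableZR (I _ c1)|exact: I].
congr (- _); apply: eq_Rintegral => t _; rewrite patch_lin; ring.
Qed.

Lemma load_lin (f1 x1 t1 f2 x2 t2 : R * R -> R) (a : R) :
  xt_test T s f1 x1 t1 -> xt_test T s f2 x2 t2 ->
  ell (fun z => a * f1 z + f2 z) (fun z => a * t1 z + t2 z) =
  a * ell f1 t1 + ell f2 t2.
Proof.
move=> xt1 xt2; have xt3 := xt_test_lin a xt1 xt2.
have [X1 ct1 _ _] := xt1; have [X2 ct2 _ _] := xt2; have [X3 _ _ _] := xt3.
have [c1 _ _ _] := X1; have [c2 _ _ _] := X2.
have B1 := boundary_sqint dom X1; have B2 := boundary_sqint dom X2.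
have sh := sqint_itv_open ch.
have E : \int[mu]_(t in `]0, T[) (h t * (a * f1 (0, t) + f2 (0, t))) =
    a * \int[mu]_(t in `]0, T[) (h t * f1 (0, t)) + \int[mu]_(t in `]0, T[) (h t * f2 (0, t)).
  rewrite !boundary_flux_dot -dotZr// -dotDr//; last exact: sqintZ.
  rewrite Rintegral_mkcond; apply: eq_Rintegral => t _.
  by rewrite !patchE; case: ifPn => _ //; apply/esym; exact: mul0r.
rewrite /load E rc2_lin// patch_lin.
have F1 := sqint_closure dom c1; have F2 := sqint_closure dom c2.
have G1 := sqint_rc2 alpha01 dom ct1; have G2 := sqint_rc2 alpha01 dom ct2.
have sd := sqint_datum T su0.
have D1 := dotDr (sqintZ a F1) F2 sf; have D2 := dotDr (sqintZ a G1) G2 sd.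
rewrite (dotZr a F1 sf) in D1; rewrite (dotZr a G1 sd) in D2.
have arith (e1 e2 p p1 p2 q q1 q2 : R) : p = a * p1 + p2 -> q = a * q1 + q2 ->
    a * e1 + e2 + p + kap * q = a * (e1 + p1 + kap * q1) + (e2 + p2 + kap * q2).
  by move=> -> ->; ring.
exact: arith D1 D2.
Qed.

(* The pairs [(psx, psi)] carry no load: they force the second component of the
   solution to be the weak x-derivative of the first. *)
Definition tests : set ((R * R -> R) * (R * R -> R) * R) :=
  [set y | exists phi px pt psi psx, [/\ xt_test T s phi px pt, x_test T s psi psx,
     (forall t, psi (0, t) = 0) &
     y = (fun z => kap * (rc2 alpha T s pt \_ Q) z + (psx \_ Q) z,
          fun z => (px \_ Q) z + (psi \_ Q) z, ell phi pt)]].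

Lemma tests_lin a y z : tests y -> tests z ->
  tests (fun p => a * y.1.1 p + z.1.1 p, fun p => a * y.1.2 p + z.1.2 p, a * y.2 + z.2).
Proof.
move=> [f1 [x1 [t1 [g1 [h1 [xt1 xg1 g10 ->]]]]]] [f2 [x2 [t2 [g2 [h2 [xt2 xg2 g20 ->]]]]]].
exists (fun p => a * f1 p + f2 p), (fun p => a * x1 p + x2 p), (fun p => a * t1 p + t2 p),
  (fun p => a * g1 p + g2 p), (fun p => a * h1 p + h2 p); split.
- exact: xt_test_lin.
- exact: x_test_lin.
- by move=> t; rewrite g10 g20 mulr0 addr0.
- have [_ ct1 _ _] := xt1; have [_ ct2 _ _] := xt2.
  rewrite (load_lin a xt1 xt2) rc2_lin// !patch_lin; congr (_, _, _); apply/funext => p /=;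
    ring.
Qed.

Let patch0 (A : set (R * R)) : (fun=> 0 : R) \_ A = (fun=> 0).
Proof. by apply/funext => z; rewrite patchE; case: ifPn. Qed.

Lemma rc2_0 : rc2 alpha T s (fun=> 0) \_ Q = (fun=> 0).
Proof.
apply/funext => z; have [Qz|nQ] := pselect (Q z); last by rewrite patch_off.
rewrite patch_in// /rc2 /rcaputo Rintegral_eq0 ?oppr0// => t.
by rewrite patch0 mul0r.
Qed.

Lemma load0 : ell (fun=> 0) (fun=> 0) = 0.
Proof.
have D0 g : dot mu2 g (fun=> 0) = 0 by apply: Rintegral_eq0 => z; rewrite mulr0.
have B0 : \int[mu]_(t in `]0, T[) (h t * 0) = 0.
  by rewrite Rintegral_mkcond Rintegral_eq0// => t; rewrite patchE; case: ifP; rewrite // mulr0.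
by rewrite /load rc2_0 patch0 !D0 B0 mulr0 !addr0.
Qed.

Lemma tests_x (psi psx : R * R -> R) : x_test T s psi psx ->
  (forall t, psi (0, t) = 0) -> tests (psx \_ Q, psi \_ Q, 0).
Proof.
move=> xp psi0; exists (fun=> 0), (fun=> 0), (fun=> 0), psi, psx.
split=> //; first exact: xt_test0.
rewrite load0 rc2_0 patch0.
by congr (_, _, _); apply/funext => z; rewrite ?mulr0 add0r.
Qed.

Lemma tests_xt (phi px pt : R * R -> R) : xt_test T s phi px pt ->
  tests (fun z => kap * (rc2 alpha T s pt \_ Q) z, px \_ Q, ell phi pt).
Proof.
move=> xt; exists phi, px, pt, (fun=> 0), (fun=> 0).
split=> //; first exact: x_test0.
by rewrite patch0; congr (_, _, _); apply/funext => z; rewrite addr0.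
Qed.

Lemma tests0 : tests (fun=> 0, fun=> 0, 0).
Proof. by have := tests_x (x_test0 T s) (fun=> erefl); rewrite patch0. Qed.

(** [M] bounds squares. Integrability is demanded next to the bound because [\int] gives an infinite
    integral the value 0. *)
Definition bounded_pairs (M : R) : set ((R * R -> R) * (R * R -> R)) :=
  [set v | [/\ sqint mu2 v.1 /\ sqint mu2 v.2, (forall z, ~ Q z -> v.1 z = 0),
     dot mu2 v.2 v.2 <= M & forall c, 0 < c <= T ->
       mu2.-integrable setT (EFin \o (fun z => v.1 z ^+ 2 * kern (c - z.2))) /\
       energy alpha v.1 c <= M]].

Lemma tests_sqint y : tests y -> sqint mu2 y.1.1 /\ sqint mu2 y.1.2.
Proof.
move=> [phi [px [pt [psi [psx [xt xp _ ->]]]]]] /=.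
have [[_ c1 _ _] c2 _ _] := xt; have [c3 c4 _ _] := xp.
split; apply: sqintD; try exact: (sqint_closure dom).
by apply: sqintZ; exact: (sqint_rc2 alpha01 dom).
Qed.

(** The load [L] is at most sqrt(B D) and the coercive pairing [E] at least c D, so the factor sqrt
    B / (c sqrt D) makes the pairing dominate the load, while the squared size [lam ^+ 2 * D] has a
    bound independent of the test function. If [D = 0] the load vanishes. *)
Let scaling (B c D L E : R) : 0 <= B -> 0 < c -> 0 <= D -> L ^+ 2 <= B * D -> c * D <= E ->
  let lam := Num.sqrt B / c / Num.sqrt D in
  [/\ 0 <= lam, L <= lam * E & lam ^+ 2 * D <= B / c ^+ 2].
Proof.
move=> B0 c0 D0 LBD cDE lam; have lam0 : 0 <= lam.
  by rewrite /lam !divr_ge0 ?sqrtr_ge0// ltW.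
have [D00|Dn] := eqVneq D 0.
  have L0 : L = 0.
    by apply/eqP; rewrite -sqrf_eq0; rewrite D00 mulr0 in LBD; rewrite eq_le LBD sqr_ge0.
  split=> //; first by rewrite L0 mulr_ge0// (le_trans _ cDE)// D00 mulr0.
  by rewrite D00 mulr0 divr_ge0// sqr_ge0.
have Dp : 0 < D by rewrite lt_def Dn.
have r0 : 0 < Num.sqrt D by rewrite sqrtr_gt0.
have DE : D = Num.sqrt D ^+ 2 by rewrite sqr_sqrtr.
have BE : B = Num.sqrt B ^+ 2 by rewrite sqr_sqrtr.
split=> //.
  apply: (@le_trans _ _ (Num.sqrt B * Num.sqrt D)).
    rewrite -sqrtrM// (le_trans (ler_norm _))// -sqrtr_sqr; exact: ler_wsqrtr.
  apply: le_trans (ler_wpM2l lam0 cDE).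
  rewrite le_eqVlt; apply/orP; left; apply/eqP; rewrite /lam.
  transitivity (Num.sqrt B / c / Num.sqrt D * (c * Num.sqrt D ^+ 2)).
    by field; rewrite !gt_eqF.
  by rewrite -DE.
rewrite /lam le_eqVlt; apply/orP; left; apply/eqP.
transitivity (Num.sqrt B ^+ 2 / c ^+ 2 * (Num.sqrt D ^+ 2)^-1 * D); last first.
  by rewrite -DE -BE mulfVK.
by field; rewrite !gt_eqF.
Qed.

Let load_const_ge0 : 0 <= load_const alpha b T s kap f h u0.
Proof.
have dm0 : 0 <= datum_mass alpha b T u0.
  by apply: Rintegral_ge0 => z _; rewrite mulr_ge0 ?sqr_ge0 ?kern_ge0.
have h1 := mulr_ge0 (dot_ge0 mu (h \_ `]0, T[)) (ltW (sT_gt0 dom)).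
have h2 := mulr_ge0 (dot_ge0 mu2 (f \_ Q)) (mulr_ge0 (ler0n R 2) (powR_ge0 T alpha)).
have h3 := mulr_ge0 (sqr_ge0 kap) (mulr_ge0 (ler0n R 4) dm0).
by apply: mulr_ge0 => //; apply: addr_ge0 h3; apply: addr_ge0.
Qed.

Let coercivity_const_gt0 : 0 < coercivity_const kap.
Proof. by rewrite lt_min divr_gt0//= invr_gt0. Qed.

(** The quotient is the squared size obtained in [scaling]; the 2 is the loss in the near-maximality
    of [t0], by which the energy at [t0] bounds the energy at every other time. *)
Definition dual_radius := 2 * (load_const alpha b T s kap f h u0 / coercivity_const kap ^+ 2).

Lemma dual_radius_ge0 : 0 <= dual_radius.
Proof. by apply: mulr_ge0 => //; apply: divr_ge0 => //; exact: sqr_ge0. Qed.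

Lemma tests_dominated y : tests y -> exists2 v, bounded_pairs dual_radius v &
  y.2 <= dot mu2 v.1 y.1.1 + dot mu2 v.2 y.1.2.
Proof.
move=> [phi [px [pt [psi [psx [xt xp psi0 ->]]]]]] /=.
have [[cphi cpx _ _] cpt _ _] := xt; have [cpsi cpsx _ _] := xp.
have off z : ~ Q z -> (phi \_ Q) z = 0 by exact: patch_off.
have mphi := closure_measurable dom cphi.
have [C [C0 phiC]] := closure_bounded dom cphi.
have [B EB] := energy_bounded alpha01 dom mphi phiC off.
have [||t0 _ sup_t0] := @near_maximizer R [set c | 0 < c <= T] (energy alpha (phi \_ Q)) B.
- by exists T; rewrite /= T0 lexx.
- by move=> c /andP[_ cT]; rewrite energy_ge0 EB.
have LB := load_bound alpha01 dom kap sf ch su0 xt sup_t0.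
have EC := test_coercive alpha01 dom kap0 xt t0.
have BR := damp_bracket dom xt t0 xp psi0.
have E0 := energy_ge0 alpha (phi \_ Q) t0.
have W0 := early_mass_ge0 alpha b T s phi t0.
have Dx0 := dot_ge0 mu2 (px \_ Q).
have D0 : 0 <= test_size alpha b T s phi px t0 by exact: addr_ge0 (addr_ge0 E0 W0) Dx0.
have [] := scaling load_const_ge0 coercivity_const_gt0 D0 LB EC.
set lam := _ / _ / _ => lam0 Lle lamD.
have sd := sqint_damp dom xt t0; have sdx := sqint_damp_x dom xt t0.
have spx := sqint_closure dom cpx; have spsi := sqint_closure dom cpsi.
have spsx := sqint_closure dom cpsx; have srt := sqint_rc2 alpha01 dom cpt.
exists (fun z => lam * damp T s phi t0 z, fun z => lam * damp_x T s px t0 z) => /=; last first.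
  (* By [BR] the part [(psx, psi)] of the test contributes nothing to the pairing, as it contributes
     nothing to the load. *)
  have srt' := sqintZ kap srt.
  rewrite (dotZl lam sd (sqintD srt' spsx)) (dotZl lam sdx (sqintD spx spsi)).
  rewrite (dotDr srt' spsx sd) (dotDr spx spsi sdx) (dotZr kap srt sd) -mulrDr addrACA BR.
  by rewrite addr0.
have half1 : load_const alpha b T s kap f h u0 / coercivity_const kap ^+ 2 <= dual_radius.
  by have := dual_radius_ge0; rewrite /dual_radius; lra.
split=> /=.
- by split; exact: sqintZ.
- by move=> z nQ; rewrite damp_off// mulr0.
- rewrite (dotZl lam sdx (sqintZ lam sdx)) (dotZr lam sdx sdx) mulrA -expr2.
  apply: le_trans half1; apply: le_trans lamD; apply: ler_wpM2l; first exact: sqr_ge0.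
  apply: (@le_trans _ _ (dot mu2 (px \_ Q) (px \_ Q))); last first.
    exact: ler_wpDl (addr_ge0 E0 W0) (lexx _).
  apply: le_Rintegral => //; [exact: sqintM|exact: sqintM|].
  move=> z _; rewrite -!expr2 /damp_x expr_div_n ler_piMr ?sqr_ge0// invf_le1.
    by rewrite exprn_ege1// jump_ge1.
  by rewrite exprn_gt0// (lt_le_trans _ (jump_ge1 _ _)).
move=> c cT; have ci := integrable_damp_before alpha01 dom xt t0 c.
have E z : (lam * damp T s phi t0 z) ^+ 2 * kern (c - z.2) =
    lam ^+ 2 * (damp T s phi t0 z ^+ 2 * kern (c - z.2)) by ring.
split.
  by under [X in EFin \o X]eq_fun do rewrite E; exact: integrableZR.
rewrite /energy; under eq_Rintegral do rewrite E.
rewrite RintegralZl// -/(energy alpha (damp T s phi t0) c).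
have e1 : energy alpha (damp T s phi t0) c <= 2 * energy alpha (phi \_ Q) t0.
  apply: le_trans (sup_t0 _ cT); apply: le_Rintegral => //.
    exact: (energy_integrable alpha01 dom c mphi phiC off).
  move=> z _; rewrite ler_wpM2r ?kern_ge0// -[leLHS]real_normK ?num_real//.
  by rewrite -[leRHS]real_normK ?num_real// lerXn2r ?nnegrE// damp_le.
have e2 : energy alpha (phi \_ Q) t0 <= test_size alpha b T s phi px t0.
  by rewrite /test_size -addrA; exact: ler_wpDr (addr_ge0 W0 Dx0) (lexx _).
have e3 := ler_wpM2l (sqr_ge0 lam) e1; have e4 := ler_wpM2l (sqr_ge0 lam) e2.
rewrite /dual_radius; apply: le_trans e3 _; rewrite mulrCA; apply: ler_wpM2l => //.
exact: le_trans e4 lamD.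
Qed.

Let bounded_pairs_dot v : bounded_pairs dual_radius v ->
  [/\ sqint mu2 v.1, sqint mu2 v.2,
    dot mu2 v.1 v.1 <= Num.max dual_radius (T `^ alpha * dual_radius) &
    dot mu2 v.2 v.2 <= Num.max dual_radius (T `^ alpha * dual_radius)].
Proof.
move=> [[s1 s2] off d2 en]; have TT : 0 < T <= T by rewrite T0 lexx.
have [i1 e1] := en T TT; split=> //; rewrite le_max ?d2//.
have d1 := dot_le_energy alpha01 dom s1 off i1.
by rewrite (le_trans d1 (ler_wpM2l (powR_ge0 _ _) e1)) orbT.
Qed.

Let bounded_pairs0 : bounded_pairs dual_radius (fun=> 0, fun=> 0).
Proof.
have r0 := dual_radius_ge0.
have Z c (z : R * R) : 0 ^+ 2 * kern (c - z.2) = 0 by rewrite expr0n mul0r.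
split=> /=; [by split; exact: sqint0|by []| |].
  by rewrite /dot Rintegral_eq0// => z; rewrite mul0r.
move=> c _; rewrite /energy; split; last by rewrite Rintegral_eq0.
rewrite (_ : _ \o _ = cst 0%E); first exact: integrable0.
by apply/funext => z /=; rewrite Z.
Qed.

Let tests_off y : tests y -> forall z, ~ Q z -> y.1.1 z = 0.
Proof.
move=> [phi [px [pt [psi [psx [_ _ _ ->]]]]]] z nQ /=.
by rewrite !patch_off// mulr0 addr0.
Qed.

(* The energy bound comes from the bipolar theorem, by testing with the solution
   times the truncated kernel. *)
Lemma energy_solution : exists u p : R * R -> R,
  [/\ sqint mu2 u /\ sqint mu2 p, (forall z, ~ Q z -> u z = 0),
    (forall y, tests y -> dot mu2 u y.1.1 + dot mu2 p y.1.2 = y.2) &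
    forall c, 0 < c <= T ->
      mu2.-integrable setT (EFin \o (fun z => u z ^+ 2 * kern (c - z.2))) /\
      energy alpha u c <= dual_radius].
Proof.
have [||u [p [su sp up H]]] := @dual_existence _ _ _ mu2 _ _ _
  bounded_pairs0 bounded_pairs_dot tests_sqint tests0 _ _ tests_dominated.
- move=> y z Yy Yz; have := tests_lin 1 Yy Yz.
  by under eq_fun do rewrite mul1r; under [X in tests (_, X, _)]eq_fun do rewrite mul1r;
    rewrite mul1r.
- move=> a y Yy; have := tests_lin a Yy tests0.
  by under eq_fun do rewrite addr0; under [X in tests (_, X, _)]eq_fun do rewrite addr0;
    rewrite addr0.
(* The first component of a test vanishes off [Q], so [u] can be cut off there without changing its
   pairings with tests. *)
have suQ : sqint mu2 (u \_ Q) := sqint_patch (Qs_measurable dom) su.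
have uQ y : (forall z, ~ Q z -> y z = 0) -> dot mu2 (u \_ Q) y = dot mu2 u y.
  move=> y0; apply: eq_Rintegral => z _.
  by have [Qz|/[dup] nQ /y0 ->] := pselect (Q z); rewrite ?mulr0// patch_in.
exists (u \_ Q), p; split=> //.
- by move=> z nQ; rewrite patch_off.
- by move=> y Yy; rewrite uQ ?up//; exact: tests_off.
move=> c cT.
have mk : measurable_fun [set: plane R]
    (fun z => kern (c - z.2)).
  by apply: measurableT_comp (measurable_kern alpha) _; exact: measurable_funB.
have [muQ iuQ] := suQ.
rewrite /energy; apply: (@integrable_truncation _ _ _ mu2 (fun z => (u \_ Q) z ^+ 2)
  (fun z => kern (c - z.2))).
- exact: measurable_funX.
- exact: mk.
- by move=> z; exact: sqr_ge0.
- by move=> z; exact: kern_ge0.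
(* Truncation is needed because [u] times the full kernel may fail to be square integrable, and then
   the bipolar property does not apply to it. *)
move=> n; pose k (z : plane R) := Num.min (kern (c - z.2)) n%:R.
have k0 z : 0 <= k z by rewrite le_min kern_ge0 ler0n.
have kn z : k z <= n%:R by rewrite ge_min lexx orbT.
have kk z : k z <= kern (c - z.2) by rewrite ge_min lexx.
have mkn : measurable_fun setT k by apply: measurable_minr.
have sy : sqint mu2 (fun z => (u \_ Q) z * k z).
  apply: (sqint_le _ (sqintZ n%:R suQ)); first exact: measurable_funM.
  by move=> z; rewrite !normrM mulrC ler_wpM2r// !ger0_norm.
have yE z : (u \_ Q) z ^+ 2 * k z = (u \_ Q) z * ((u \_ Q) z * k z) by rewrite mulrA.
have iy : mu2.-integrable setT (EFin \o (fun z => (u \_ Q) z ^+ 2 * k z)).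
  by under [X in EFin \o X]eq_fun do rewrite yE; exact: sqintM.
split=> //; set G := Rintegral _ _ _.
have GE : dot mu2 u (fun z => (u \_ Q) z * k z) + dot mu2 p (fun=> 0) = G.
  rewrite [X in _ + X]Rintegral_eq0 ?addr0; last by move=> z; rewrite mulr0.
  rewrite -uQ; first by apply: eq_Rintegral => z _; rewrite yE.
  by move=> z nQ; rewrite patch_off// mul0r.
(* The pairing of [v] with [u] times [k] is at most half of the energy of [v] plus [G]. The bipolar
   property passes this bound to [u], whose own pairing is [G], and [G] is absorbed on the left. *)
have : G <= 2^-1 * (dual_radius + G); last by lra.
rewrite -{1}GE; apply: H => //; first exact: sqint0.
move=> v [[sv1 sv2] v0 _ /(_ c cT)[vi ve]].
rewrite [X in _ + X]Rintegral_eq0 ?addr0; last by move=> z; rewrite mulr0.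
have vb : dot mu2 v.1 (fun z => (u \_ Q) z * k z) <= 2^-1 * (energy alpha v.1 c + G).
  rewrite -RintegralD// -RintegralZl//; last exact: integrableDR.
  apply: le_Rintegral => //; [exact: sqintM|by apply: integrableZR; exact: integrableDR|].
  move=> z _; apply: (@le_trans _ _ (2^-1 * (v.1 z ^+ 2 * k z + (u \_ Q) z ^+ 2 * k z))).
    rewrite -subr_ge0; have -> : 2^-1 * (v.1 z ^+ 2 * k z + (u \_ Q) z ^+ 2 * k z) -
        v.1 z * ((u \_ Q) z * k z) = 2^-1 * ((v.1 z - (u \_ Q) z) ^+ 2 * k z) by field.
    by rewrite mulr_ge0 ?invr_ge0// mulr_ge0 ?sqr_ge0.
  by rewrite ler_wpM2l ?invr_ge0// lerD2r ler_wpM2l// sqr_ge0.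
by apply: (le_trans vb); rewrite ler_wpM2l ?invr_ge0// lerD2r.
Qed.

End existence.

(** * Weak solutions *)

(** Integrability has to come first, since a divergent integral would have the value 0: the
    integrand is at most [kern] up to 1 and, as e^(-x) <= 1 / x, at most a multiple of [dens]
    beyond. Its value at 2 then bounds it below on (1, 2). *)
Lemma Gamma_gt0 (R : realType) (alpha : R) : 0 < alpha < 1 -> 0 < Gamma (1 - alpha).
Proof.
move=> a01; have /andP[a0 a1] := a01.
pose mu := @lebesgue_measure R.
pose g (x : R) := ((fun x : R => x `^ (1 - alpha - 1) * expR (- x)) \_ `]0, +oo[) x.
have gE x : g x = kern alpha x * expR (- x).
  rewrite /g patchE mem_setE in_itv/= andbT /kern; case: ifPn => [|_]; last by rewrite mul0r.
  by rewrite addrAC subrr add0r.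
have mg : measurable_fun setT g.
  rewrite (funext gE); apply: measurable_funM; first exact: measurable_kern.
  apply: measurableT_comp => //; exact: (@oppr_measurable _ _).
have k0 x : 0 <= kern alpha x by exact: kern_ge0.
pose d (x : R) := kern alpha x * (x <= 1)%R%:R + alpha^-1 * (dens alpha x * (1 <= x)%R%:R).
have di : mu.-integrable setT (EFin \o d).
  apply: integrableDR; first exact: kern_integrable.
  by apply: integrableZR; exact: dens_tail_integrable.
have gd x : `|g x| <= d x.
  rewrite gE ger0_norm ?mulr_ge0 ?expR_ge0//.
  have dn0 : 0 <= dens alpha x by exact: dens_ge0.
  have [x1|x1] := leP x 1.
    rewrite /d x1 mulr1 ler_wpDr ?mulr_ge0 ?invr_ge0 ?(ltW a0)//.
    have [x0|x0] := leP x 0; first by rewrite kern_le0// mul0r.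
    by rewrite ler_piMr// -expR0 ler_expR oppr_le0 ltW.
  have x0 : 0 < x by rewrite (lt_trans _ x1).
  rewrite /d (leNgt x 1) x1 mulr0 add0r (ltW x1) mulr1 /dens x0 kern_gt0// mulrA mulVf ?gt_eqF// mul1r.
  have -> : x `^ (- alpha - 1) = x `^ (- alpha) * x^-1.
    rewrite powRD ?powR_inv1 ?(ltW x0)//; apply/implyP => _; exact: lt0r_neq0.
  rewrite ler_wpM2l ?powR_ge0// expRN lef_pV2 ?posrE ?expR_gt0//.
  by rewrite (le_trans _ (expR_ge1Dx x))// lerDr.
have gi : mu.-integrable setT (EFin \o g) by apply: (integrable_le _ di gd); exact: mg.
pose i (x : R) : R := ((1 < x) && (x < 2))%R%:R.
have ii : mu.-integrable setT (EFin \o i) := integrable_itvb 1 2.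
have i1 : \int[mu]_x i x = 1.
  rewrite (@Rintegral_FTC_open _ 1 2 id (fun=> 1) i) ?ltr1n//; first by lra.
  - by apply: continuous_subspaceT => x; exact: cvg_cst.
  - by apply: continuous_subspaceT => x; exact: cvg_id.
  - exact: integrableR_measurable ii.
  - by move=> x _ _; rewrite mul1r.
pose c := kern alpha 2 * expR (- 2) : R.
have c0 : 0 < c by rewrite mulr_gt0 ?expR_gt0// kern_gt0// powR_gt0.
apply: lt_le_trans c0 _; rewrite -[leLHS]mulr1 -[X in _ * X <= _]i1 -RintegralZl//.
rewrite [leRHS]Rintegral_mkcond; apply: le_Rintegral => //; first exact: integrableZR.
move=> x _; rewrite -[leRHS]/(g x) gE /i.
case: (boolP (1 < x < 2)) => [/andP[x1 x2]|_]; last by rewrite mulr0 mulr_ge0 ?expR_ge0.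
have x0 : 0 < x by rewrite (lt_trans _ x1).
rewrite mulr1 /c ler_pM ?expR_ge0 ?kern_ge0//; first by apply: ler_kern => //; exact: ltW.
by rewrite ler_expR lerN2 ltW.
Qed.

(** Both limits of integration become zeros of the integrand: the kernel vanishes after the time of
    [p], and [v] vanishes up to the lower limit. *)
Lemma frac_int_conv2 (R : realType) (alpha : R) (lo : R -> R) (w v : R * R -> R) p :
  (forall r, lo p.1 < r < p.2 -> w (p.1, r) = v (p.1, r)) ->
  (forall r, r <= lo p.1 -> v (p.1, r) = 0) ->
  frac_int alpha lo w p = (Gamma (1 - alpha))^-1 * conv2 alpha v p.
Proof.
move=> wv v0; rewrite /frac_int; congr (_ * _).
rewrite Rintegral_mkcond; apply: eq_Rintegral => r _; rewrite patchE mem_setE in_itv/=.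
case: (boolP (lo p.1 < r < p.2)) => [/[dup] /andP[_ rp] /wv ->|].
  by rewrite kern_gt0// subr_gt0.
rewrite negb_and -!leNgt => /orP[/v0 -> | pr]; first by rewrite mulr0.
by rewrite kern_le0 ?mul0r// subr_le0.
Qed.

Section bounds.
Context {R : realType} (alpha b T : R) (s : R -> R).
Hypothesis alpha01 : 0 < alpha < 1.
Hypothesis dom : moving_domain b T s.
Local Notation Q := (Qs s T).
Local Notation mu := (@lebesgue_measure R).
Local Notation mu2 := (@lebesgue_measure R \x @lebesgue_measure R)%E.
Local Notation kern := (kern alpha).

(** Cauchy-Schwarz with the kernel split into two square roots, one cut off at lag [T] so that it is
    square integrable. *)
Lemma kern_conv_sqr (w : R -> R) (t : R) : t <= T -> measurable_fun setT w ->
  (forall r, ~~ (0 < r < T) -> w r = 0) ->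
  mu.-integrable setT (EFin \o (fun r => w r ^+ 2 * kern (t - r))) ->
  kern_conv alpha w t ^+ 2 <= kern_mass alpha T * \int[mu]_r (w r ^+ 2 * kern (t - r)).
Proof.
move=> tT mw w0 wi; pose q (r : R) := Num.sqrt (kern (t - r)).
have q2 r : q r ^+ 2 = kern (t - r) by rewrite sqr_sqrtr// kern_ge0.
have mq : measurable_fun setT q.
  by apply: measurableT_comp (measurable_sqrt_kern alpha) _; exact: measurable_funB.
have b2 (c : bool) : (c%:R : R) ^+ 2 = c%:R by case: c; rewrite ?expr1n ?expr0n.
have s1 : sqint mu (fun r => q r * (t - r <= T)%R%:R).
  split.
    apply: measurable_funM => //; apply: measurable_natb; apply: measurable_fun_ler => //.
    exact: measurable_funB.
  apply: eq_integrable (kern_mass_reflect alpha01 T t) => // r _ /=.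
  by rewrite exprMn q2 b2.
have s2 : sqint mu (fun r => w r * q r).
  split; first exact: measurable_funM.
  by apply: eq_integrable wi => // r _ /=; rewrite exprMn q2.
have -> : kern_conv alpha w t = dot mu (fun r => q r * (t - r <= T)%R%:R) (fun r => w r * q r).
  apply: eq_Rintegral => r _; have [/andP[r0 _]|/w0 ->] := boolP (0 < r < T); last first.
    by rewrite mulr0 mul0r mulr0.
  by rewrite lerBlDr (le_trans tT) ?lerDl ?(ltW r0)// mulr1 -q2; ring.
apply: le_trans (dot_cauchy_schwarz s1 s2) _; rewrite le_eqVlt; apply/orP; left; apply/eqP.
congr (_ * _); last by apply: eq_Rintegral => r _; rewrite -q2; ring.
rewrite -(kern_mass_reflectE T alpha01 t); apply: eq_Rintegral => r _.
by rewrite -expr2 exprMn q2 b2.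
Qed.

(** At each time [t], [kern_conv_sqr] holds for almost every [x], and its right-hand side integrates
    over [x] to [kern_mass] times the energy at [t]. The resulting bound is the same at all times of
    (0, T). *)
Lemma LinftyL2_I_0 (u : R * R -> R) (M : R) :
  sqint mu2 u -> (forall z, ~ Q z -> u z = 0) ->
  (forall c, 0 < c <= T ->
     mu2.-integrable setT (EFin \o (fun z => u z ^+ 2 * kern (c - z.2))) /\
     energy alpha u c <= M) ->
  LinftyL2 (s T) T (I_0 alpha (u \_ Q)).
Proof.
move=> su u0 uM; have uE : u \_ Q = u.
  by apply/funext => z; have [Qz|nQ] := pselect (Q z); [rewrite patch_in|rewrite patch_off ?u0].
pose k := (Gamma (1 - alpha))^-1.
have IE : I_0 alpha (u \_ Q) = (fun p => k * conv2 alpha u p).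
  apply/funext => p; rewrite uE; apply: frac_int_conv2 => // r r0.
  by apply: u0 => /(Qs_rect dom)[_ /andP[/=]]; rewrite ltNge r0.
have mI : measurable_fun [set: plane R]
    (fun p => k * conv2 alpha u p).
  by apply: measurable_funM => //; apply: measurable_conv2; case: su.
rewrite IE; split; first exact: measurable_funTS.
pose N := k ^+ 2 * kern_mass alpha T * M.
apply: (@le_lt_trans _ _ (N%:E `^ 2^-1)%E); last exact: poweR_lty (ltry _).
apply/ess_supP; apply: nearW => t; rewrite unlock.
set rect := [set p | _].
have [/[dup] tT /andP[t0 tT']|nt] := boolP (0 < t < T); last first.
  rewrite integral0_eq => [|x _]; first by rewrite poweR0r ?poweR_ge0// invr_neq0.
  by rewrite patch_off ?abse0 ?poweR0r// => -[_]; rewrite /= (negbTE nt).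
have tT2 : 0 < t <= T by rewrite t0 ltW.
have [ui ue] := uM t tT2.
have Ji := integrable_Rintegral1 ui; have JE := Rintegral_prod1 ui.
pose J x := \int[mu]_r (u (x, r) ^+ 2 * kern (t - r)).
have J0 x : 0 <= J x by apply: Rintegral_ge0 => r _; rewrite mulr_ge0 ?sqr_ge0 ?kern_ge0.
have m0 : 0 <= k ^+ 2 * kern_mass alpha T by rewrite mulr_ge0 ?sqr_ge0 ?kern_mass_ge0.
have mIt : measurable_fun setT (fun x => k * conv2 alpha u (x, t)) by exact: (measurable_slice_x t mI).
have mrt : measurable_fun setT (fun x : R => 0 < x < s T).
  by apply: measurable_and; apply: measurable_fun_ltr.
have rE x : ((fun p => k * conv2 alpha u p) \_ rect) (x, t) =
    k * conv2 alpha u (x, t) * ((0 < x) && (x < s T))%R%:R.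
  have [xs|xs] := boolP (0 < x < s T); first by rewrite mulr1 patch_in.
  by rewrite mulr0 patch_off// => -[]; rewrite /= (negbTE xs).
have I : (\int[mu]_x (`|(((fun p => k * conv2 alpha u p) \_ rect) (x, t))%:E| `^ 2) <= N%:E)%E.
  apply: (@le_trans _ _ (\int[mu]_x (k ^+ 2 * kern_mass alpha T * J x)%:E)%E); last first.
    have Ki := integrableZR (k ^+ 2 * kern_mass alpha T) Ji.
    rewrite -(fineK (integrable_fin_num measurableT Ki)) lee_fin.
    rewrite -[leLHS]/(\int[mu]_x (k ^+ 2 * kern_mass alpha T * J x)) RintegralZl// /N.
    by rewrite ler_wpM2l// /J JE.
  have E x : (`|(((fun p => k * conv2 alpha u p) \_ rect) (x, t))%:E| `^ 2 =
     ((k * conv2 alpha u (x, t) * ((0 < x) && (x < s T))%R%:R) ^+ 2)%:E)%E.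
    by rewrite rE abse_EFin poweR_EFin -[2]/(2%:R) powR_mulrn// real_normK ?num_real.
  under eq_integral do rewrite E.
  apply: ae_ge0_le_integral => //.
  - by move=> x _; rewrite lee_fin sqr_ge0.
  - apply/measurable_EFinP; apply: measurable_funX; apply: measurable_funM => //.
    exact: measurable_natb.
  - by move=> x _; rewrite lee_fin mulr_ge0.
  - exact: measurable_int (integrableZR (k ^+ 2 * kern_mass alpha T) Ji).
  have := ae_integrable1 ui; apply: filterS => x uxi _.
  rewrite lee_fin exprMn.
  have b1 (c : bool) : (c%:R : R) ^+ 2 <= 1 by case: c; rewrite ?expr1n ?expr0n.
  apply: (@le_trans _ _ ((k * conv2 alpha u (x, t)) ^+ 2)).
    by rewrite ler_piMr ?sqr_ge0.
  rewrite exprMn -[leRHS]mulrA ler_wpM2l ?sqr_ge0//.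
  apply: (@kern_conv_sqr (fun r => u (x, r)) t (ltW tT')) => //.
  - by apply: measurable_slice_t; case: su.
  - by move=> r rT; apply: u0 => /(Qs_rect dom)[_]; rewrite /= (negbTE rT).
apply: gt0_ler_poweR => //.
- by rewrite in_itv/= leey integral_ge0// => x _; exact: poweR_ge0.
- by rewrite in_itv/= leey (le_trans _ I)// integral_ge0// => x _; exact: poweR_ge0.
Qed.

End bounds.

Lemma Rintegral_patchM d (X : measurableType d) (R : realType)
    (mu : {measure set X -> \bar R}) (A : set X) (g1 g2 k1 k2 : X -> R) :
  (forall x, A x -> g1 x * g2 x = k1 x * k2 x) ->
  (forall x, ~ A x -> k1 x * k2 x = 0) ->
  \int[mu]_(x in A) (g1 x * g2 x) = \int[mu]_x (k1 x * k2 x).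
Proof.
move=> gk k0; rewrite Rintegral_mkcond; apply: eq_Rintegral => x _; rewrite patchE.
by case: ifPn => [|/negP]; rewrite inE => Ax; [exact: gk|rewrite k0].
Qed.

Theorem theorem1p1 (R : realType) (alpha T b : R) (s ds : R -> R)
    (f : R * R -> R) (h u0 : R -> R)
    (halpha : 0 < alpha < 1) (hT : 0 < T) (hb : 0 < b)
    (s_cont : {within `[0, T], continuous s}) (s0 : s 0 = b)
    (s_diff : forall t, t \in `]0, T] -> is_derive_within `[0, T] s t (ds t))
    (ds_ge0 : forall t, t \in `]0, T] -> 0 <= ds t)
    (ds_weight : exists g : R -> R, {within `[0, T], continuous g} /\
       forall t, t \in `]0, T] -> g t = t `^ (1 - alpha) * ds t)
    (hf : L2 (mu2 R) (Qs s T) f)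
    (hh : C1_segment 0 T h)
    (hu0 : L2 (mu1 R) `]0, b[ u0) :
  exists u : R * R -> R, weak_solution alpha b T s f h u0 u.
Proof.
have dom : moving_domain b T s.
  by split=> //; exact: (derive_within_ge0_nondecreasing s_cont s_diff ds_ge0).
have ch := C1_segment_continuous hh.
have sf : sqint (mu2 R) (f \_ (Qs s T)) by apply/Lfun2P; exact: hf.
have su0 : sqint (mu1 R) (u0 \_ `]0, b[) by apply/Lfun2P; exact: hu0.
pose kap := (Gamma (1 - alpha))^-1.
have kap0 : 0 < kap by rewrite invr_gt0 Gamma_gt0.
have [u [p [[su sp] uoff up ue]]] := energy_solution halpha dom kap0 sf ch su0.
have uQ : u \_ (Qs s T) = u.
  apply/funext => z; have [Qz|nQ] := pselect (Qs s T z); first by rewrite patch_in.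
  by rewrite patch_off ?uoff.
exists u, p; split.
- by rewrite /L2 uQ; apply/Lfun2P.
- split.
    move=> psi psitest; have [xpsi psi0] := x_test_test_function psitest.
    (* For a test without load the duality identity is the definition of the weak derivative. *)
    have H := up _ (tests_x alpha b kap f h u0 xpsi psi0).
    move/eqP: H; rewrite addr_eq0 => /eqP /= H.
    rewrite (@Rintegral_patchM _ _ _ (mu2 R) (Qs s T) u ('D_(dir_x R) psi) u ('D_(dir_x R) psi \_ (Qs s T))); last 2 first.
    + by move=> z Qz; rewrite patch_in.
    + by move=> z nQ; rewrite uoff// mul0r.
    rewrite (@Rintegral_patchM _ _ _ (mu2 R) (Qs s T) p psi p (psi \_ (Qs s T))); last 2 first.
    + by move=> z Qz; rewrite patch_in.
    + by move=> z nQ; rewrite patch_off// mulr0.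
    exact: H.
  by apply/Lfun2P; apply: sqint_patch sp; exact: (Qs_measurable dom).
- exact: (LinftyL2_I_0 halpha dom su uoff ue).
move=> phi C1phi phiT phis.
have [px [pt [xt pE]]] := xt_test_C1 C1phi phiT phis.
have [[cphi cpx _ _] cpt _ _] := xt.
have H := up _ (tests_xt alpha b kap f h u0 xt).
pose w z := u z - datum b T u0 z.
have w0 z : ~ Qs s T z -> w z = 0.
  by move=> nQ; rewrite /w uoff// (datum_off dom)// subr0.
have sd := sqint_datum T su0.
have sw : sqint (mu2 R) w by exact: sqintB.
have srt := sqint_rc2 halpha dom cpt.
have IE z : Qs s T z ->
    I_s alpha b T s (fun q => u q - (u0 \_ `]0, b[) q.1) z = kap * conv2 alpha w z.
  case: z => x t Qz; apply: frac_int_conv2 => r /=.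
    move=> /andP[ar rt]; rewrite /w /datum/=.
    have [_ /andP[/= t0 tT]] := Qs_rect dom Qz.
    by rewrite (le_lt_trans (sinv_ge0 _ _ _ _) ar) (lt_trans rt tT) mulr1.
  move=> ra; apply: w0 => /[dup] Qr [/= /andP[x0 xs] /andP[r0 rT]].
  (* On the line [x = b], where slices need not start at [sinv x], the lower limit is 0 and [Q] has
     no point at times [r <= 0]. *)
  have [xb|xb] := eqVneq x b; first by move: ra; rewrite xb /sinv lexx leNgt r0.
  have [/andP[/= _ xT] _] := Qs_rect dom Qr.
  by have /andP[] := (Qs_slice dom r x0 xT xb).1 Qr; rewrite ltNge ra.
rewrite (@Rintegral_patchM _ _ _ (mu2 R) (Qs s T) 
  (I_s alpha b T s (fun q => u q - (u0 \_ `]0, b[) q.1)) ('D_(dir_t R) phi)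
  (fun z => kap * conv2 alpha w z) (pt \_ (Qs s T)));
  last 2 first.
- by move=> z Qz; rewrite IE// patch_in// (pE _ Qz).2.
- by move=> z nQ; rewrite patch_off// mulr0.
rewrite (@Rintegral_patchM _ _ _ (mu2 R) (Qs s T) p ('D_(dir_x R) phi) p (px \_ (Qs s T))); last 2 first.
- by move=> z Qz; rewrite patch_in// (pE _ Qz).1.
- by move=> z nQ; rewrite patch_off// mulr0.
rewrite (@Rintegral_patchM _ _ _ (mu2 R) (Qs s T) f phi (f \_ (Qs s T)) (phi \_ (Qs s T))); last 2 first.
- by move=> z Qz; rewrite !patch_in.
- by move=> z nQ; rewrite patch_off// mul0r.
(* After integration by parts the [datum] half of [w] is the last term of [load], and the [u] half
   is the pairing given by duality. *)
have -> : \int[mu2 R]_z (kap * conv2 alpha w z * (pt \_ (Qs s T)) z) =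
    kap * (dot (mu2 R) (datum b T u0) (rc2 alpha T s pt \_ (Qs s T)) -
           dot (mu2 R) u (rc2 alpha T s pt \_ (Qs s T))).
  under eq_Rintegral do rewrite -mulrA.
  rewrite RintegralZl//; last exact: (conv2_integrable halpha dom cpt sw w0).
  by rewrite (conv2_swap halpha dom cpt sw w0) (dotBl su sd srt) opprB.
move: H; rewrite /= (dotZr kap srt su) /load => H.
have arith (d e a l1 l2 : R) : kap * e + a = l1 + l2 + kap * d ->
    - (kap * (d - e)) + a = l1 + l2.
  by move=> /(canRL (addKr _)) ->; ring.
exact: arith H.
Qed.
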